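(* Fix a sign $\pm$. Let $V$ be an irreducible quasifinite highest weight $\hat{\mathcal D}^\pm$-module with central charge $c$ and $$\Delta^\pm(x)=\frac{F(x)}{2\sinh(x/2)},$$ $F$ an even quasipolynomial with $F(0)=0$. Write, with $a_{s,j}\in\mathbb C$ nonzero for only finitely many $(s,j)$ and with the normalization of the index $s$ described in the context, $$F(x)+c\cosh(x/2)=\sum_{s\in\mathbb C}\sum_{j\ge0}a_{s,j}\,\eta_j(x;s-\tfrac12)\quad(-\text{ case}),\qquad F(x)+c=\sum_{s\in\mathbb C}\sum_{j\ge0}a_{s,j}\,\eta_j(x;s)\quad(+\text{ case}).$$ Then $V$ is isomorphic to the tensor product, over the distinct equivalence classes $S$ of the set $\{s: a_{s,j}\ne0\text{ for some }j\}$, of the modules $L_s^{[m],\pm}(\Lambda_S)$, where $s$ is the representative of $S$, $m=m_S$, and $\Lambda_S$ is the weight attached to $S$ as in the context.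
   Context: **The algebras $\hat{\mathcal D}^\pm$.** $\hat{\mathcal D}=\mathcal D\oplus\mathbb CC$, $\mathcal D$ spanned by $t^kf(D)$ ($k\in\mathbb Z$, $f\in\mathbb C[w]$, $D=t\frac d{dt}$), $C$ central, $[t^rf(D),t^sg(D)]=t^{r+s}(f(D+s)g(D)-f(D)g(D+r))+\Psi\,C$, $\Psi$ antisymmetric, $\Psi=\sum_{-r\le j\le-1}f(j)g(j+r)$ if $r=-s\ge0$, $\Psi=0$ if $r+s\ne0$; $\deg t^kf(D)=k$, $\deg C=0$. $\hat{\mathcal D}^-$: spanned by $C$ and $t^kg(D+k/2)$, $g$ odd if $k$ even, $g$ even if $k$ odd. $\hat{\mathcal D}^+$: spanned by $C$ and $t^kg(D+(k+1)/2)$, $g$ odd. An irreducible highest weight module with highest weight $\xi\in(\hat{\mathcal D}^\pm_0)^*$ (highest weight vector killed by elements of positive degree) has central charge $c=\xi(C)$ and $\Delta^\pm(x)=\sum_{n\text{ odd}}\Delta_n^\pm x^n/n!$, $\Delta^-_n=-\xi(D^n)$, $\Delta^+_n=-\xi((D+\frac12)^n)$. Quasifinite: all graded components finite-dimensional; for such modules $\Delta^\pm$ always has the form $F(x)/(2\sinh(x/2))$ with $F$ an even quasipolynomial (finite linear combination of $p(x)e^{\alpha x}$, $p$ polynomial), $F(0)=0$. **Functions.** $\eta_j(x;\mu)=\frac1{2\,j!}x^j(e^{\mu x}+(-1)^je^{-\mu x})$, so $\eta_j(x;-\mu)=(-1)^j\eta_j(x;\mu)$. **Normalization of $s$.** If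 $s\in\mathbb Z$ then $s\le0$; if $s\in\frac12+\mathbb Z$ then $s\le\frac12$ in the $-$ case and $s\le-\frac12$ in the $+$ case; if $s\notin\frac12\mathbb Z$ then $\mathrm{Im}\,s>0$ when $\mathrm{Im}\,s\neq0$, and $s-\lfloor s\rfloor<\frac12$ when $s\in\mathbb R$. Equivalence: $s\sim s'$ iff $s\equiv\pm s'\pmod{\mathbb Z}$. Representative of a class $S$: $s=0$ if $S\subset\mathbb Z$; $s=\frac12$ ($-$ case) or $s=-\frac12$ ($+$ case) if $S\subset\frac12+\mathbb Z$; otherwise any element $s\in S$. Then $S\subset s-\mathbb Z$, and $S\subset s-\mathbb Z_{+}$ if $s\in\frac12\mathbb Z$. $m_S$ is the largest $j$ with $a_{s',j}\ne0$ for some $s'\in S$. **Matrix algebras.** $R_m=\mathbb C[u]/(u^{m+1})$; $\mathfrak{gl}^{[m]}$: matrices $(a_{ij})_{i,j\in\mathbb Z}$ over $R_m$ with finitely many nonzero diagonals; $\widehat{\mathfrak{gl}}^{[m]}=\mathfrak{gl}^{[m]}\oplus R_m$, central extension by the cocycle $\mathrm{Tr}([J,A]B)$, $J=\sum_{i\le0}E_{ii}$; $\deg E_{ij}=j-i$. Subalgebras (matrices of the indicated kind)$\,\oplus R_m$: $b_\infty^{[m]}$: $a_{ij}(u)=(-1)^{i+j+1}a_{-j,-i}(-u)$; $\tilde b_\infty^{[m]}$: $a_{ij}(u)=-a_{-j,-i}(-u)$; $c_\infty^{[m]}$: $a_{ij}(u)=(-1)^{i+j+1}a_{1-j,1-i}(-u)$;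 $d_\infty^{[m]}$: $a_{ij}(u)=-a_{1-j,1-i}(-u)$. **Homomorphisms.** $\phi^{[m]}_s(t^kf(D))=\sum_jf(s-j+u)E_{j-k,j}$, $f(s-j+u)=\sum_{i=0}^mf^{(i)}(s-j)u^i/i!$. $\hat\phi_s^{[m]}(C)=1$, $\hat\phi_s^{[m]}=\phi_s^{[m]}$ in degree $\ne0$, and $\hat\phi^{[m]}_s(e^{xD})=\phi_s^{[m]}(e^{xD})-\frac{e^{sx}-1}{e^x-1}1-\sum_{i=1}^m\frac{x^ie^{sx}}{i!(e^x-1)}u^i$ (power series in $x$), restricted to $\hat{\mathcal D}^\pm$. The image lies in $\mathfrak g^{[m]}$, where $\mathfrak g^{[m]}=\widehat{\mathfrak{gl}}^{[m]}$ if $s\notin\frac12\mathbb Z$; in the $-$ case $\mathfrak g^{[m]}=b_\infty^{[m]}$ for $s=0$, $c_\infty^{[m]}$ for $s=\frac12$; in the $+$ case $\mathfrak g^{[m]}=d_\infty^{[m]}$ for $s=0$, $\tilde b_\infty^{[m]}$ for $s=-\frac12$. For $\Lambda\in(\mathfrak g_0^{[m]})^*$, $L_s^{[m],\pm}(\Lambda)$ is the irreducible highest weight $\mathfrak g^{[m]}$-module of highest weight $\Lambda$ (highest weight vector killed by positive degree), viewed as a $\hat{\mathcal D}^\pm$-module via $\hat\phi_s^{[m]}$. **Weight $\Lambda_S$** ($0\le j\le m=m_S$; all sums are finite, and $\Lambda_S$ is extended additively to infinite diagonal matrices): - $s\notin\frac12\mathbb Z$: put $h_i^{(j)}=a_{s-i,j}$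 ($i\in\mathbb Z$), $c_j=\sum_ih_i^{(j)}$; $\Lambda_S(u^j)=c_j$ for $u^j\in R_m$, and $\Lambda_S(u^jE_{ii})=\sum_{k\ge i}(h_k^{(j)}-c_j\delta_{k,0})$. - $s\in\{0,\pm\frac12\}$: put $c_j=\sum_{k\ge0}a_{s-k,j}$ for $j$ even, $c_j=0$ for $j$ odd; $\Lambda_S(u^j)=c_j$ for $u^j\in R_m$. For $i\ge1$, the element $u^jE_{ii}-(-u)^jE_{-i,-i}$ (for $b_\infty^{[m]},\tilde b_\infty^{[m]}$), respectively $u^jE_{ii}-(-u)^jE_{1-i,1-i}$ (for $c_\infty^{[m]},d_\infty^{[m]}$), has $\Lambda_S$-value $\sum_{k\ge i}a_{s-k,j}$. For $b_\infty^{[m]},\tilde b_\infty^{[m]}$ and $j$ odd, moreover $\Lambda_S(2u^jE_{00})=\sum_{k\ge0}a_{s-k,j}$. *)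

(* Defs.v *)
From HB Require Import structures.
From mathcomp Require Import all_boot all_order all_algebra.
From mathcomp Require Import qpoly complex.
From mathcomp Require Import all_classical all_reals.

Set Implicit Arguments.
Unset Strict Implicit.
Unset Printing Implicit Defensive.

Import Order.TTheory GRing.Theory Num.Theory.
Local Open Scope classical_set_scope.
Local Open Scope ring_scope.
Local Open Scope complex_scope.

(* Infinite sums are written [\sum_(i \in A) F i] (finitely supported sums of  *)
(* fsbigop.v, equal to 0 when the support is infinite); wherever they occur    *)
(* below the support is finite on the elements of the algebras considered.     *)

Section Modules.
Variable K : fieldType.

(* A Lie algebra is presented as a subset [lie_mem] of an ambient vector space *)
(* carrying a bracket; [lie_deg k] cuts out the elements of degree k. Nothing  *)
(* is ever required of elements of the ambient space outside [lie_mem].        *)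
Record graded_lie := GradedLie {
  lie_sort :> lmodType K;
  lie_br : lie_sort -> lie_sort -> lie_sort;
  lie_mem : set lie_sort;
  lie_deg : int -> set lie_sort }.

Definition lie_homog (g : graded_lie) (k : int) : set g :=
  @lie_mem g `&` @lie_deg g k.

Definition lspan (V : lmodType K) (S : set V) : set V :=
  [set v | exists n (e : 'I_n -> V) (b : 'I_n -> K),
     (forall i, S (e i)) /\ v = \sum_i b i *: e i].

(* for a linear subspace W this is finite-dimensionality *)
Definition finite_dim (V : lmodType K) (W : set V) : Prop :=
  exists n (e : 'I_n -> V), W `<=` lspan (range e).

Section Module.
Variables (g : graded_lie) (V : lmodType K) (rho : g -> V -> V).

Definition is_module : Prop :=
  [/\ forall x, lie_mem x -> linear (rho x),
      forall a x y v, lie_mem x -> lie_mem y ->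
        rho (a *: x + y) v = a *: rho x v + rho y v
    & forall x y v, lie_mem x -> lie_mem y ->
        rho (lie_br x y) v = rho x (rho y v) - rho y (rho x v)].

Definition irreducible_module : Prop :=
  (exists v : V, v != 0) /\
  forall W : {pred V}, submod_closed W ->
    (forall x v, lie_mem x -> v \in W -> rho x v \in W) ->
    (forall v, v \in W -> v = 0) \/ (forall v, v \in W).

Definition highest_weight_vector (v0 : V) (xi : g -> K) : Prop :=
  [/\ v0 != 0,
      forall k x, 0 < k -> lie_homog k x -> rho x v0 = 0
    & forall x, lie_homog 0 x -> rho x v0 = xi x *: v0].

Definition irreducible_hw_module (v0 : V) (xi : g -> K) : Prop :=
  [/\ is_module, irreducible_module & highest_weight_vector v0 xi].

(* U(g)_k v0: the span of the vectors x_1 (x_2 (... (x_r v0))) with the x_i    *)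
(* homogeneous of degrees adding up to k                                       *)
Definition graded_component (v0 : V) (k : int) : set V :=
  lspan [set v | exists w : seq (int * g),
    [/\ forall p, p \in w -> lie_homog p.1 p.2,
        \sum_(p <- w) p.1 = k
      & v = foldr (fun p => rho p.2) v0 w]].

Definition quasifinite (v0 : V) : Prop :=
  forall k, finite_dim (graded_component v0 k).

End Module.

Definition module_iso (g : graded_lie) (V W : lmodType K)
    (rhoV : g -> V -> V) (rhoW : g -> W -> W) : Prop :=
  exists f : {linear V -> W}, bijective f /\
    forall x v, lie_mem x -> f (rhoV x v) = rhoW x (f v).

Section Tensor.
Variables (n : nat) (L : 'I_n -> lmodType K).

Definition multilinear (W : lmodType K) (f : (forall i, L i) -> W) : Prop :=
  forall i (v : forall j, L j), linear (fun x : L i => f (eqtype.dfwith v x)).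

Definition is_tensor_product (T : lmodType K) (tau : (forall i, L i) -> T) :=
  multilinear tau /\
  forall (W : lmodType K) (f : (forall i, L i) -> W), multilinear f ->
    exists h : {linear T -> W}, (forall v, h (tau v) = f v) /\
      forall h' : {linear T -> W}, (forall v, h' (tau v) = f v) -> h' =1 h.

Definition is_tensor_module (g : graded_lie) (rho : forall i, g -> L i -> L i)
    (T : lmodType K) (rhoT : g -> T -> T) (tau : (forall i, L i) -> T) : Prop :=
  [/\ is_tensor_product tau, is_module rhoT
    & forall x v, lie_mem x ->
        rhoT x (tau v) = \sum_i tau (eqtype.dfwith v (rho i x (v i)))].

End Tensor.
End Modules.

Section PowerSeries.
Variable K : fieldType.

(* A series is its sequence of coefficients; the product is [fps_mul], not   *)
(* the pointwise product of functions.                                        *)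
Definition fps : lmodType K := (nat -> K^o)%type.
Implicit Types f g : fps.

Definition fps_mul f g : fps := fun n => \sum_(i < n.+1) f i * g (n - i)%N.
Definition fps1 : fps := fun n => (n == 0%N)%:R.
Definition fps_Xn (j : nat) : fps := fun n => (n == j)%:R.
Definition fps_exp (alpha : K) : fps := fun n => alpha ^+ n / n`!%:R.

(* the series q with q g = f when it exists, see [fps_divK] *)
Definition fps_div f g : fps := xget 0 [set q | fps_mul q g = f].

Fixpoint fps_quot_seq f g (n : nat) : seq K :=
  if n is p.+1 then
    let q := fps_quot_seq f g p in
    rcons q ((f p.+1 - \sum_(i < p) q`_i * g (p.+1 - i)%N) / g 1%N)
  else [::].

Lemma fps_divK f g : f 0%N = 0 -> g 0%N = 0 -> g 1%N != 0 ->
  fps_mul (fps_div f g) g = f.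
Proof.
move=> f0 g0 g1.
suff [q qP] : exists q, fps_mul q g = f.
  by rewrite /fps_div; case: xgetP => [_ _ //|/(_ q)].
have szq n : size (fps_quot_seq f g n) = n.
  by elim: n => //= n IHn; rewrite size_rcons IHn.
have nthq n p i : (i < n)%N -> (fps_quot_seq f g (n + p))`_i
    = (fps_quot_seq f g n)`_i.
  elim: p => [|p IHp] lt_in; first by rewrite addn0.
  rewrite addnS /= nth_rcons szq ltn_addr // IHp //.
exists (fun i => (fps_quot_seq f g i.+1)`_i); apply/funext => -[|p].
  by rewrite /fps_mul big_ord_recr big_ord0 /= g0 mulr0 addr0 f0.
rewrite /fps_mul !big_ord_recr /= subnn g0 mulr0 addr0 subSnn.
rewrite nth_rcons szq ltnn eqxx mulfVK //.
rewrite addrC -addrA [X in _ + X](_ : _ = 0) ?addr0 //.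
apply/eqP; rewrite addrC subr_eq0; apply/eqP/eq_bigr => i _; congr (_ * _).
by rewrite -(nthq i.+1 (p - i.+1)%N) // subnKC.
Qed.

Definition fps_even f : Prop := forall n, odd n -> f n = 0.

Definition quasipolynomial f : Prop :=
  exists n (p : 'I_n -> {poly K}) (alpha : 'I_n -> K),
    f = \sum_i fps_mul (fun k => (p i)`_k) (fps_exp (alpha i)).

Definition two_sinh_half : fps := fps_exp (2^-1) - fps_exp (- 2^-1).
Definition cosh_half : fps := 2^-1 *: (fps_exp (2^-1) + fps_exp (- 2^-1)).

Definition eta_series (j : nat) (mu : K) : fps :=
  (2 * j`!%:R)^-1 *:
    fps_mul (fps_Xn j) (fps_exp mu + (-1) ^+ j *: fps_exp (- mu)).

End PowerSeries.

Inductive dsign := Dminus | Dplus.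

Section Dhat.
Variable K : fieldType.

(* (x, z) stands for \sum_k t^k x_k(D) + z C *)
Definition Dhat : lmodType K := ((int -> {poly K}) * K^o)%type.

Definition pshift (a : K) (f : {poly K}) : {poly K} := f \Po ('X + a%:P).

Definition Psi0 (r : int) (f g : {poly K}) : K :=
  \sum_(j \in [set j : int | - r <= j <= -1]) f.[j%:~R] * g.[(j + r)%:~R].

(* the coefficient of C in [t^r f(D), t^{-r} g(D)] *)
Definition Psi (r : int) (f g : {poly K}) : K :=
  if 0 <= r then Psi0 r f g else - Psi0 (- r) g f.

Definition Dhat_br (x y : Dhat) : Dhat :=
  (fun n : int => \sum_(r \in [set: int])
     (pshift (n - r)%:~R (x.1 r) * y.1 (n - r)
      - x.1 r * pshift r%:~R (y.1 (n - r))),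
   \sum_(r \in [set: int]) Psi r (x.1 r) (y.1 (- r))).

Definition even_fun (f : {poly K}) : Prop := f \Po (- 'X) = f.
Definition odd_fun (f : {poly K}) : Prop := f \Po (- 'X) = - f.

Definition Dhat_mem (eps : dsign) : set Dhat :=
  [set x | finite_set [set k : int | x.1 k != 0] /\
     forall k : int, exists g : {poly K},
       match eps with
       | Dminus => x.1 k = pshift (k%:~R / 2) g /\
                   (if odd `|k|%N then even_fun g else odd_fun g)
       | Dplus => x.1 k = pshift ((k + 1)%:~R / 2) g /\ odd_fun g
       end].

Definition Dhat_deg (k : int) : set Dhat :=
  [set x | (forall n, n != k -> x.1 n = 0) /\ (k != 0 -> x.2 = 0)].

Definition Dhat_lie (eps : dsign) : graded_lie K :=
  GradedLie Dhat_br (Dhat_mem eps) Dhat_deg.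

Definition Dhat_C : Dhat := (0, 1).
Definition Dhat_poly (f : {poly K}) : Dhat :=
  (fun k : int => if k == 0 then f else 0, 0).

Definition Delta (eps : dsign) (xi : Dhat -> K) : fps K := fun n =>
  if odd n then
    - xi (Dhat_poly (match eps with
                     | Dminus => 'X ^+ n
                     | Dplus => ('X + (2^-1)%:P) ^+ n
                     end)) / n`!%:R
  else 0.

End Dhat.

Inductive infty_type := gl_infty | b_infty | bt_infty | c_infty | d_infty.

Section GlHat.
Variables (K : fieldType) (m : nat).

(* R_m = K[u]/(u^{m+1}); u is ['qX] *)
Definition Rm := {poly %/ ('X^(m.+1) : {poly K})}.
Definition in_Rm (p : {poly K}) : Rm := in_qpoly 'X^(m.+1) p.

Definition Rm_neg (a : Rm) : Rm := in_Rm ((a : {poly K}) \Po (- 'X)).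

Definition imx := int -> int -> Rm.
Definition imx_mul (A B : imx) : imx :=
  fun i j => \sum_(k \in [set: int]) A i k * B k j.
Definition imx_tr (A : imx) : Rm := \sum_(i \in [set: int]) A i i.
Definition imx_J : imx := fun i j => ((i == j) && (i <= 0))%:R.
Definition imx_comm (A B : imx) : imx := imx_mul A B - imx_mul B A.

(* (A, z) stands for A + z, with z in the central R_m *)
Definition glhat : lmodType K := (imx * Rm)%type.

Definition glhat_br (X Y : glhat) : glhat :=
  (imx_comm X.1 Y.1, imx_tr (imx_mul (imx_comm imx_J X.1) Y.1)).

Definition fin_diag (A : imx) : Prop :=
  finite_set [set k : int | exists i, A i (i + k) != 0].

Definition imx_sym (ty : infty_type) (A : imx) : Prop :=
  match ty with
  | gl_infty => True
  | b_infty => forall i j,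
      A i j = ((-1 : K) ^ (i + j + 1)) *: Rm_neg (A (- j) (- i))
  | bt_infty => forall i j, A i j = - Rm_neg (A (- j) (- i))
  | c_infty => forall i j,
      A i j = ((-1 : K) ^ (i + j + 1)) *: Rm_neg (A (1 - j) (1 - i))
  | d_infty => forall i j, A i j = - Rm_neg (A (1 - j) (1 - i))
  end.

Definition glhat_mem (ty : infty_type) : set glhat :=
  [set X | fin_diag X.1 /\ imx_sym ty X.1].

Definition glhat_deg (k : int) : set glhat :=
  [set X | (forall i j, j - i != k -> X.1 i j = 0) /\ (k != 0 -> X.2 = 0)].

Definition infty_lie (ty : infty_type) : graded_lie K :=
  GradedLie glhat_br (glhat_mem ty) glhat_deg.

Definition phi (s : K) (x : int -> {poly K}) : imx :=
  fun i j => in_Rm (pshift (s - j%:~R) (x (j - i))).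

(* the power series multiplying u^i in phi(e^{xD}) - phihat(e^{xD}) *)
Definition phi_corr (s : K) (i : nat) : fps K :=
  fps_div
    (if i == 0%N then fps_exp s - fps1 K
     else (i`!%:R)^-1 *: fps_mul (fps_Xn K i) (fps_exp s))
    (fps_exp 1 - fps1 K).

(* e^{xD} = \sum_n D^n x^n / n!, so phihat(D^n) is n! times the coefficient of *)
(* x^n in phihat(e^{xD})                                                       *)
Definition phihat (s : K) (x : Dhat K) : glhat :=
  (phi s x.1,
   x.2 *: 1 - \sum_(n < size (x.1 0)) ((x.1 0)`_n * n`!%:R) *:
                 \sum_(i < m.+1) phi_corr s i n *: 'qX ^+ i).

End GlHat.

Section Weights.
Variable R : realType.
Local Notation C := R[i].

Definition is_integer (s : C) : Prop := exists n : int, s = n%:~R.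
Definition is_half_odd (s : C) : Prop := exists n : int, s = n%:~R + 2^-1.

(* the order of R[i] compares elements with equal imaginary parts *)
Definition normalized (eps : dsign) (s : C) : Prop :=
  [/\ is_integer s -> s <= 0,
      is_half_odd s -> s <= (match eps with Dminus => 2^-1 | Dplus => - 2^-1 end)
    & ~ is_integer s -> ~ is_half_odd s ->
        (complex.Im s != 0 -> 0 < complex.Im s) /\
        (complex.Im s = 0 ->
           complex.Re s - (Num.floor (complex.Re s))%:~R < 2^-1)].

Definition equiv_pmZ (s t : C) : Prop :=
  exists n : int, s = t + n%:~R \/ s = - t + n%:~R.

Section Expansion.
Variables (eps : dsign) (a : C -> nat -> C).

Definition in_supp (s : C) : Prop := exists j, a s j != 0.

(* s is an admissible representative of the class (in the support of a) of t *)
Definition representative (t s : C) : Prop :=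
  equiv_pmZ s t /\
  [/\ is_integer t -> s = 0,
      is_half_odd t -> s = (match eps with Dminus => 2^-1 | Dplus => - 2^-1 end)
    & ~ is_integer t -> ~ is_half_odd t -> in_supp s].

(* s enumerates, without repetition, one representative of each class *)
Definition representatives (n : nat) (s : 'I_n -> C) : Prop :=
  [/\ forall i, exists2 t, in_supp t & representative t (s i),
      forall t, in_supp t -> exists i, representative t (s i)
    & forall i j, equiv_pmZ (s i) (s j) -> i = j].

Definition mS (s : C) : nat :=
  \big[maxn/0%N]_(p \in [set p : C * nat | a p.1 p.2 != 0 /\ equiv_pmZ p.1 s])
    p.2.

Definition rep_type (s : C) : infty_type :=
  match eps with
  | Dminus => if s == 0 then b_infty else if s == 2^-1 then c_infty else gl_infty
  | Dplus => if s == 0 then d_infty else if s == - 2^-1 then bt_infty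
             else gl_infty
  end.

(* c_j for s not a half-integer, and for s a half-integer, respectively *)
Definition cS_gl (s : C) (j : nat) : C :=
  \sum_(k \in [set: int]) a (s - k%:~R) j.
Definition tailS (s : C) (i : int) (j : nat) : C :=
  \sum_(k \in [set k : int | i <= k]) a (s - k%:~R) j.
Definition cS_half (s : C) (j : nat) : C := if odd j then 0 else tailS s 0 j.

Definition LambdaS_gl (s : C) (m : nat) (X : glhat C m) : C :=
  \sum_(i \in [set: int]) \sum_(j < m.+1) (X.1 i i : {poly C})`_j *
     (\sum_(k \in [set k : int | i <= k])
        (a (s - k%:~R) j - cS_gl s j * (k == 0)%:R))
  + \sum_(j < m.+1) (X.2 : {poly C})`_j * cS_gl s j.

(* In the classical subalgebras a diagonal matrix is determined by its entries *)
(* of index i >= 1: it is the sum over i >= 1 and j of the coefficient of u^j  *)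
(* in its i-th entry times u^j E_{ii} - (-u)^j E_{i'i'}, with i' = -i (b, bt)  *)
(* or i' = 1-i (c, d), plus, for b and bt, an E_{00} part with odd powers of u *)
Definition LambdaS_half (with00 : bool) (s : C) (m : nat) (X : glhat C m) : C :=
  \sum_(i \in [set i : int | 1 <= i])
     \sum_(j < m.+1) (X.1 i i : {poly C})`_j * tailS s i j
  + (if with00 then
       \sum_(j < m.+1 | odd j) (X.1 0 0 : {poly C})`_j * (tailS s 0 j / 2)
     else 0)
  + \sum_(j < m.+1) (X.2 : {poly C})`_j * cS_half s j.

Definition LambdaS (s : C) (m : nat) : glhat C m -> C :=
  match rep_type s with
  | gl_infty => @LambdaS_gl s m
  | b_infty | bt_infty => @LambdaS_half true s m
  | c_infty | d_infty => @LambdaS_half false s m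
  end.

End Expansion.
End Weights.

(* Main.v *)
(* A tensor product of irreducible highest weight modules, over Lie algebras   *)
(* g_i, remains irreducible over a subalgebra D of their sum as soon as, on    *)
(* finitely many vectors, D imitates every homogeneous element of nonzero      *)
(* degree of each g_i: vectors killed by D_{>0} are then killed by every       *)
(* (g_i)_{>0}, so they are multiples of the tensor of the highest weight       *)
(* vectors, and that tensor generates everything. Here the density holds       *)
(* because a weight with finite support makes an element of degree k act on a  *)
(* given vector through finitely many matrix entries, and these entries are    *)
(* jets of f at the points s_i - j: inequivalent representatives make the      *)
(* points and their mirror images distinct, so Hermite interpolation followed  *)
(* by symmetrization produces f. Irreducible highest weight modules with equal *)
(* highest weights are isomorphic, so only the weights remain to be compared.  *)
(* Every f(D) of degree 0 is a difference q(D+1) - q(D) with q a shifted even  *)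
(* polynomial; summing by parts, Lambda_S takes on it the value                *)
(* c_0 q(0) - \sum a_{s,j} [u^j] q(s + u), while pairing q with the generating *)
(* series F + c cosh(x/2), resp. F + c, gives the same value for xi.           *)

Require Import Defs.
From HB Require Import structures.
From mathcomp Require Import all_boot all_order all_algebra.
From mathcomp Require Import qpoly complex.
From mathcomp Require Import all_classical all_reals.
From mathcomp Require Import zify ring lra.

Set Implicit Arguments.
Unset Strict Implicit.
Unset Printing Implicit Defensive.

Import Order.TTheory GRing.Theory Num.Theory.
Local Open Scope classical_set_scope.
Local Open Scope ring_scope.

(** * Highest weight modules over graded Lie algebras *)

(** Two facts suffice: the tensor product T of the modules attached to the classes stays irreducible
    under the algebra of differential operators, and the tensor of the highest weight vectors has
    weight [xi]. Then [highest_weight_iso] applies: the submodule of V x T generated by the pair of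
    highest weight vectors is the graph of an isomorphism.

    Irreducibility ([irreducible_tensor_exists]). In an irreducible module a vector is determined by
    the coefficients of the highest weight vector seen after applying words of raising elements
    ([word_coef_sep]). Products of these functionals separate the vectors of T, which is itself
    built from them ([tensor_product_exists]). On finitely many vectors, an element of nonzero
    degree of one matrix algebra is imitated by a differential operator that acts as 0 on the other
    factors ([phihat_dense]). Hence singular vectors of T are multiples of the top vector
    ([tensor_singular]), and the top vector generates T ([tensor_generated]). Imitation combines two
    things: on a given vector an element of fixed degree acts through finitely many matrix columns
    only ([finite_support]), and jets of a polynomial at finitely many points can be prescribed,
    subject only to the reflection symmetry ([imitate_window]).

    Comparison of weights ([weightE]). Each f(D) of degree 0 in the subalgebra is q(D+1) - q(D) with
    q a shift of an even polynomial e. Multiplication by 2 sinh(x/2) is adjoint to this difference,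
    so xi(f(D)) is minus the pairing of F with e, and the expansion of F turns it into c q(0) minus
    the sum of a_{s,j} [u^j] q(s + u) ([weight_difference]). The weights Lambda_S are tail sums of
    the same numbers; summation by parts shows that each yields the share of its own class
    ([LambdaS_diff]), and the normalization of the indices lets the classes be listed without
    repetition ([class_sum]). *)

Section LinearFunctions.
Variables (K : fieldType) (U V : lmodType K) (f : U -> V).
Hypothesis f_lin : linear f.

Lemma lin0 : f 0 = 0.
Proof. by have := f_lin (-1) 0 0; rewrite scaler0 addr0 scaleN1r addNr. Qed.

Lemma linD u v : f (u + v) = f u + f v.
Proof. by have := f_lin 1 u v; rewrite !scale1r. Qed.

Lemma linZ a u : f (a *: u) = a *: f u.
Proof. by have := f_lin a u 0; rewrite lin0 !addr0. Qed.

Lemma linN u : f (- u) = - f u.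
Proof. by rewrite -scaleN1r linZ scaleN1r. Qed.

Lemma linB u v : f (u - v) = f u - f v.
Proof. by rewrite linD -scaleN1r linZ scaleN1r. Qed.

Lemma lin_sum (I : Type) (r : seq I) (P : pred I) (e : I -> U) :
  f (\sum_(i <- r | P i) e i) = \sum_(i <- r | P i) f (e i).
Proof. by apply: (big_morph f linD lin0). Qed.

End LinearFunctions.

Section GradedModules.
Variables (K : numFieldType) (g : graded_lie K).

(** Modules carry no grading of their own; the eigenvalues of the grading element [d] supply one,
    and in characteristic 0 they separate the degrees. *)
Record graded_closed (d : g) : Prop := GradedClosed {
  mem_lin : forall a (x y : g), lie_mem x -> lie_mem y -> lie_mem (a *: x + y);
  homog_br : forall k l (x y : g), lie_homog k x -> lie_homog l y ->
    lie_homog (k + l) (lie_br x y);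
  mem_homog : forall x : g, lie_mem x -> exists n (k : 'I_n -> int) (e : 'I_n -> g),
    (forall i, lie_homog (k i) (e i)) /\ x = \sum_i e i;
  grading_homog : lie_homog 0 d;
  grading_br : forall k (x : g), lie_homog k x -> lie_br d x = k%:~R *: x }.

Variables (d : g) (gP : graded_closed d).

Lemma homog_mem k (x : g) : lie_homog k x -> lie_mem x.
Proof. by case. Qed.

Lemma lie_mem0 : lie_mem (0 : g).
Proof.
have d_mem := homog_mem (grading_homog gP).
by have := mem_lin gP (-1) d_mem d_mem; rewrite scaleN1r addNr.
Qed.

Lemma lie_mem_sum n (e : 'I_n -> g) : (forall i, lie_mem (e i)) ->
  lie_mem (\sum_i e i).
Proof.
move=> e_mem; elim/big_ind: _ => [|x y xm ym|i _ //]; first exact: lie_mem0.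
by rewrite -[x]scale1r; apply: (mem_lin gP).
Qed.

Section Module.
Variables (V : lmodType K) (rho : g -> V -> V).
Hypothesis rhoP : is_module rho.

Lemma rho_lin k x : lie_homog k x -> linear (rho x).
Proof. by case: rhoP => + _ _ => H /homog_mem /H. Qed.

Lemma rho_br k l x y v : lie_homog k x -> lie_homog l y ->
  rho x (rho y v) = rho y (rho x v) + rho (lie_br x y) v.
Proof.
case: rhoP => _ _ H /homog_mem xm /homog_mem ym.
by rewrite H // addrC subrK.
Qed.

Lemma rho0 v : rho 0 v = 0.
Proof.
case: rhoP => _ H _; have := H (-1) 0 0 v lie_mem0 lie_mem0.
by rewrite scaler0 addr0 scaleN1r addNr.
Qed.

Lemma rhoZ a x v : lie_mem x -> rho (a *: x) v = a *: rho x v.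
Proof.
case: rhoP => _ H _ xm; have := H a x 0 v xm lie_mem0.
by rewrite rho0 !addr0.
Qed.

Lemma rho_sum n (e : 'I_n -> g) v : (forall i, lie_mem (e i)) ->
  rho (\sum_i e i) v = \sum_i rho (e i) v.
Proof.
case: rhoP => _ H _.
elim: n e => [|n IHn] e em; first by rewrite !big_ord0 rho0.
rewrite !big_ord_recl -[e ord0]scale1r H ?scale1r ?IHn //.
exact: lie_mem_sum.
Qed.

Lemma rho_mem_closed (P : V -> Prop) : P 0 -> (forall a u v, P u -> P v -> P (a *: u + v)) ->
  (forall k x v, lie_homog k x -> P v -> P (rho x v)) ->
  forall x v, lie_mem x -> P v -> P (rho x v).
Proof.
move=> P0 Plin Phom x v /(mem_homog gP)[n [k [e [eh ->]]]] Pv.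
rewrite rho_sum => [|i]; last exact: homog_mem (eh i).
elim/big_ind: _ => [//|u w Pu Pw|i _]; last exact: Phom (eh i) Pv.
by rewrite -[u]scale1r; apply: Plin.
Qed.

(** Bounds the number of raising steps that a vector survives, so that raising a nonzero vector of a
    submodule ends at a singular vector; see [tensor_irreducible]. *)
Fixpoint pos_nilpotent (n : nat) (v : V) : Prop :=
  if n is p.+1 then
    forall k x, 0 < k -> lie_homog k x -> pos_nilpotent p (rho x v)
  else v = 0.

Lemma pos_nilpotent_lin n a u v : pos_nilpotent n u -> pos_nilpotent n v ->
  pos_nilpotent n (a *: u + v).
Proof.
elim: n u v => [|n IH] u v /=; first by move=> -> ->; rewrite scaler0 addr0.
move=> nu nv k x k0 xk; rewrite (rho_lin xk).
by apply: IH; [apply: nu xk | apply: nv xk].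
Qed.

Lemma pos_nilpotent0 n : pos_nilpotent n 0.
Proof.
by elim: n => //= n IH k x k0 xk; rewrite (lin0 (rho_lin xk)).
Qed.

Lemma pos_nilpotentW m n v : (m <= n)%N -> pos_nilpotent m v -> pos_nilpotent n v.
Proof.
elim: m n v => [n v _ ->|m IH [//|n] v mn nv]; first exact: pos_nilpotent0.
by move=> k x k0 xk; apply: IH mn (nv _ _ k0 xk).
Qed.

Section HighestWeight.
Variables (v0 : V) (xi : g -> K).
Hypothesis v0P : highest_weight_vector rho v0 xi.

Let v0_neq0 : v0 != 0. Proof. by case: v0P. Qed.
Let v0_pos k x : 0 < k -> lie_homog k x -> rho x v0 = 0.
Proof. by case: v0P => _ + _; apply. Qed.
Let v0_zero x : lie_homog 0 x -> rho x v0 = xi x *: v0.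
Proof. by case: v0P => _ _; apply. Qed.

(* v has degree -z, and only letters of negative degree are used, so that      *)
(* z < 0 leaves only v = 0 ([depth_lt0]); stability under all homogeneous      *)
(* elements is [depth_act].                                                    *)
Inductive depth : int -> V -> Prop :=
| depth_hw : depth 0 v0
| depth_0 z : depth z 0
| depth_lin z a u v : depth z u -> depth z v -> depth z (a *: u + v)
| depth_low z k x u : 0 < k -> lie_homog (- k) x -> depth z u ->
    depth (z + k) (rho x u).

Lemma depthZ z a u : depth z u -> depth z (a *: u).
Proof. by move=> zu; rewrite -[_ *: _]addr0; apply: depth_lin => //; apply: depth_0. Qed.

Lemma depthD z u v : depth z u -> depth z v -> depth z (u + v).
Proof. by move=> zu zv; rewrite -[u]scale1r; apply: depth_lin. Qed.

Lemma depth_lt0 z v : depth z v -> z < 0 -> v = 0.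
Proof.
elim=> {z v} [|//|z a u v _ IHu _ IHv z0|z k x u k0 xk _ IH zk].
- by rewrite ltxx.
- by rewrite IHu // IHv // scaler0 addr0.
by rewrite IH ?(lin0 (rho_lin xk)) //; lia.
Qed.

(** A lowering element is just one more letter. Any other element is commuted past the leftmost
    letter, and both resulting terms fall under the induction on the derivation of [depth]. *)
Lemma depth_act z l x v : lie_homog l x -> depth z v -> depth (z - l) (rho x v).
Proof.
move=> + zv; elim: zv l x => {z v} [l x xl|z l x xl|z a u v _ IHu _ IHv l x xl|].
- have [l0|l0|l0] := ltgtP l 0.
  + by apply: (@depth_low 0 (- l)); rewrite ?opprK ?oppr_gt0 //; apply: depth_hw.
  + by rewrite (v0_pos l0 xl); apply: depth_0.
  by rewrite l0 in xl *; rewrite v0_zero // subr0; apply/depthZ/depth_hw.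
- by rewrite (lin0 (rho_lin xl)); apply: depth_0.
- by rewrite (rho_lin xl); apply: depth_lin; [apply: IHu | apply: IHv].
move=> z k y u k0 yk zu IH l x xl.
have [l0|l0] := ltP l 0.
  apply: (@depth_low (z + k) (- l)); rewrite ?opprK ?oppr_gt0 //.
  exact: depth_low.
rewrite (rho_br _ xl yk) addrAC; apply: depthD.
  by apply: depth_low => //; apply: IH.
have -> : z - l + k = z - (l - k) by lia.
exact/IH/(homog_br gP xl yk).
Qed.

Lemma depth0_line v : depth 0 v -> exists b, v = b *: v0.
Proof.
suff H z : depth z v -> z = 0 -> exists b, v = b *: v0 by move=> /H; apply.
elim=> {z v} [_|z _|z a u v _ IHu _ IHv /[dup] /IHu[b ->] /IHv[c ->]|].
- by exists 1; rewrite scale1r.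
- by exists 0; rewrite scale0r.
- by exists (a * b + c); rewrite scalerA scalerDl.
move=> z k x u k0 xk zu _ zk; exists 0.
by rewrite (depth_lt0 zu) ?(lin0 (rho_lin xk)) ?scale0r //; lia.
Qed.

Let dl : linear (rho d). Proof. exact: rho_lin (grading_homog gP). Qed.

Lemma depth_eigen z v : depth z v -> rho d v = (xi d - z%:~R) *: v.
Proof.
have dh := grading_homog gP.
elim=> {z v} [|z|z a u v _ IHu _ IHv|z k x u k0 xk _ IH].
- by rewrite v0_zero // mulr0z subr0.
- by rewrite (lin0 dl) scaler0.
- by rewrite dl IHu IHv scalerDr !scalerA [a * _]mulrC.
rewrite (rho_br _ dh xk) IH (linZ (rho_lin xk)) (grading_br gP xk).
rewrite rhoZ; last exact: homog_mem xk.
rewrite -scalerDl; congr (_ *: _).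
by rewrite mulrNz mulrzDr; ring.
Qed.

(** Together with the line of [v0] these vectors make up the module generated by [v0]; [below_line]
    makes the sum direct. *)
Inductive below : V -> Prop :=
| below_0 : below 0
| below_add z u v : 0 < z -> depth z u -> below v -> below (u + v).

Lemma below_lin a u v : below u -> below v -> below (a *: u + v).
Proof.
elim=> [|z {}u w z0 zu _ IH] bv; first by rewrite scaler0 add0r.
rewrite scalerDr -addrA; apply: below_add z0 _ (IH bv); exact: depthZ.
Qed.

Lemma below_neg k x u : k <= 0 -> lie_homog k x -> below u -> below (rho x u).
Proof.
move=> k0 xk; elim=> [|z {}u w z0 zu _ IH].
  by rewrite (lin0 (rho_lin xk)); apply: below_0.
rewrite (linD (rho_lin xk)); apply: (@below_add (z - k)) => //; first lia.
exact: depth_act.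
Qed.

(** Product of the operators d - (xi d - z): a factor kills the vectors of depth z, and on the
    eigenvalue of [v0] the whole product is multiplication by the product of the z. *)
Let shifts (zs : seq int) (v : V) : V :=
  foldr (fun z w => rho d w - (xi d - z%:~R) *: w) v zs.

Let shifts_eigen zs b v : rho d v = b *: v ->
  exists c, shifts zs v = c *: v.
Proof.
move=> dv; elim: zs => [|z zs [c IH]] /=; first by exists 1; rewrite scale1r.
by rewrite IH (linZ dl) dv !scalerA -scalerBl; eexists.
Qed.

Let shifts_lin zs : linear (shifts zs).
Proof.
elim: zs => [//|z zs IH] a u v /=; rewrite IH dl !scalerDr scalerN !scalerA.
by rewrite [a * _]mulrC opprD addrACA.
Qed.

Let shifts_hw zs v : rho d v = xi d *: v ->
  shifts zs v = (\prod_(z <- zs) z%:~R) *: v.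
Proof.
move=> dv; elim: zs => [|z zs IH] /=; first by rewrite big_nil scale1r.
rewrite IH (linZ dl) dv big_cons !scalerA -scalerBl; congr (_ *: _).
by rewrite mulrC -mulrBl opprB addrCA subrr addr0.
Qed.

Let below_shifts u : below u ->
  exists2 zs : seq int, all (fun z => 0 < z) zs & shifts zs u = 0.
Proof.
elim=> [|z {}u v z0 zu _ [zs zs0 IH]]; first by exists [::].
exists (z :: zs); rewrite /= ?z0 // (linD (shifts_lin zs)) IH addr0.
have eu := depth_eigen zu; have [c ->] := shifts_eigen zs eu.
by rewrite (linZ dl) eu scalerA mulrC -scalerA subrr.
Qed.

(** A product of [shifts] with all z > 0 kills [u], yet on an eigenvector of eigenvalue xi d it
    multiplies by a nonzero integer. *)
Lemma below_hw u : below u -> rho d u = xi d *: u -> u = 0.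
Proof.
move=> /below_shifts[zs zs0 su] du; apply/eqP; move: su.
rewrite shifts_hw // => /eqP; rewrite scaler_eq0 => /orP[|//].
rewrite prodf_seq_eq0 => /hasP[z zzs]; rewrite intr_eq0 => /eqP z0.
by move/allP: zs0 => /(_ z zzs); rewrite z0 ltxx.
Qed.

Lemma below_line b : below (b *: v0) -> b = 0.
Proof.
move=> /below_hw bv0; apply/eqP; move: bv0 => /(_ _)/eqP.
rewrite (linZ dl) v0_zero; last exact: grading_homog gP.
by rewrite !scalerA mulrC => /(_ erefl); rewrite scaler_eq0 (negPf v0_neq0) orbF.
Qed.

Definition generated (v : V) : Prop := exists b u, below u /\ v = b *: v0 + u.

Lemma generated_lin a u v : generated u -> generated v -> generated (a *: u + v).
Proof.
move=> [b [u' [bu ->]]] [c [v' [bv ->]]].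
exists (a * b + c), (a *: u' + v'); split; first exact: below_lin.
by rewrite scalerDr scalerDl scalerA addrACA.
Qed.

Lemma generated0 : generated 0.
Proof. by exists 0, 0; split; [exact: below_0 | rewrite scale0r addr0]. Qed.

Lemma generated_hw : generated v0.
Proof. by exists 1, 0; split; [exact: below_0 | rewrite scale1r addr0]. Qed.

Lemma depth_generated z v : depth z v -> generated v.
Proof.
move=> zv; have [z0|z0|z0] := ltgtP z 0.
- by rewrite (depth_lt0 zv z0); apply: generated0.
- exists 0, v; rewrite scale0r add0r; split => //.
  by rewrite -[v]addr0; apply: below_add zv below_0.
rewrite z0 in zv; have [b ->] := depth0_line zv.
by exists b, 0; split; [exact: below_0 | rewrite addr0].
Qed.

Lemma generated_homog k x v : lie_homog k x -> generated v -> generated (rho x v).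
Proof.
move=> xk [b [u [bu ->]]]; rewrite (rho_lin xk); apply: generated_lin.
  exact: depth_generated (depth_act xk depth_hw).
elim: bu => [|z {}u w z0 zu _ IH]; first by rewrite (lin0 (rho_lin xk)); apply: generated0.
rewrite (linD (rho_lin xk)) -[rho x u]scale1r; apply: generated_lin IH.
exact: depth_generated (depth_act xk zu).
Qed.

Lemma generated_act x v : lie_mem x -> generated v -> generated (rho x v).
Proof.
apply: rho_mem_closed; [exact: generated0|exact: generated_lin|].
exact: generated_homog.
Qed.

Lemma generated_eigen v : generated v -> rho d v = xi d *: v ->
  exists b, v = b *: v0.
Proof.
move=> [b [u [bu ->]]]; rewrite dl v0_zero; last exact: grading_homog gP.
rewrite scalerDr !scalerA [b * _]mulrC => /addrI /(below_hw bu) ->.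
by exists b; rewrite addr0.
Qed.

(* meaningful on [generated] vectors only *)
Definition hw_coef (v : V) : K :=
  xget 0 [set b | exists u, below u /\ v = b *: v0 + u].

Lemma hw_coefE b u : below u -> hw_coef (b *: v0 + u) = b.
Proof.
move=> bu; rewrite /hw_coef; case: xgetP => [c _ /= [w [bw]]|/(_ b)]; last first.
  by case; exists u.
move/eqP; rewrite -subr_eq0 opprD addrACA -scalerBl addr_eq0 => /eqP e.
apply/esym/eqP; rewrite -subr_eq0; apply/eqP/below_line; rewrite e.
rewrite opprB addrC -[- u]scaleN1r.
by apply: below_lin.
Qed.

Lemma hw_coef_lin a u v : generated u -> generated v ->
  hw_coef (a *: u + v) = a * hw_coef u + hw_coef v.
Proof.
move=> [b [u' [bu ->]]] [c [v' [bv ->]]].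
rewrite scalerDr scalerA addrACA -scalerDl !hw_coefE //.
exact: below_lin.
Qed.

Lemma hw_coef_hw : hw_coef v0 = 1.
Proof. by rewrite -[v0]scale1r -[_ *: _]addr0 hw_coefE //; apply: below_0. Qed.

Lemma hw_coef_zero x v : lie_homog 0 x -> generated v ->
  hw_coef (rho x v) = xi x * hw_coef v.
Proof.
move=> x0 [b [u [bu ->]]]; rewrite (rho_lin x0) v0_zero // scalerA.
by rewrite !hw_coefE // 1?mulrC //; apply: below_neg x0 bu.
Qed.

Lemma hw_coef_neg k x v : k < 0 -> lie_homog k x -> generated v ->
  hw_coef (rho x v) = 0.
Proof.
move=> k0 xk [b [u [bu ->]]]; rewrite (rho_lin xk).
rewrite -[X in hw_coef X]add0r -[X in X + _](scale0r v0) hw_coefE //.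
apply: below_lin; last exact: below_neg (ltW k0) xk bu.
rewrite -[rho _ _]addr0; apply: (@below_add (- k)); rewrite ?oppr_gt0 //.
  by rewrite -[- k]sub0r; apply: depth_act xk depth_hw.
exact: below_0.
Qed.

End HighestWeight.
End Module.

(** * Separating functionals and nilpotency in irreducible modules *)

Section Irreducible.
Variables (V : lmodType K) (rho : g -> V -> V) (v0 : V) (xi : g -> K).
Hypothesis irrV : irreducible_hw_module rho v0 xi.

Let rhoP : is_module rho. Proof. by case: irrV. Qed.
Let v0P : highest_weight_vector rho v0 xi. Proof. by case: irrV. Qed.

(** Irreducibility is defined with boolean predicates; classical reflection transfers it to
    propositions, and decomposition into homogeneous parts reduces stability to homogeneous
    elements. *)
Lemma irreducible_cases (P : V -> Prop) : P 0 ->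
  (forall a u v, P u -> P v -> P (a *: u + v)) ->
  (forall k x v, lie_homog k x -> P v -> P (rho x v)) ->
  (forall v, P v -> v = 0) \/ (forall v, P v).
Proof.
move=> P0 Plin Phom; case: irrV => _ [_ irr] _.
have PE (v : V) : (v \in [pred v : V | `[< P v >]]) = `[< P v >] by [].
case: (irr [pred v : V | `[< P v >]]) => [| |H|H].
- split=> [|a u v]; rewrite !PE; first exact/asboolP.
  by move=> /asboolP Pu /asboolP Pv; apply/asboolP/Plin.
- move=> x v xm; rewrite !PE => /asboolP Pv; apply/asboolP.
  exact: (rho_mem_closed rhoP).
- by left=> v Pv; apply: H; rewrite PE; apply/asboolP.
by right=> v; have := H v; rewrite PE => /asboolP.
Qed.

Lemma irreducible_ind (P : V -> Prop) : P v0 ->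
  (forall a u v, P u -> P v -> P (a *: u + v)) ->
  (forall k x v, lie_homog k x -> P v -> P (rho x v)) -> forall v, P v.
Proof.
move=> Pv0 Plin Phom; case: (@irreducible_cases P) => // [|H].
  by have := Plin (-1) _ _ Pv0 Pv0; rewrite scaleN1r addNr.
by case: v0P => /eqP; case; apply: H.
Qed.

Lemma irreducible_generated v : generated rho v0 v.
Proof.
apply: irreducible_ind => [|a u w|k x w]; first exact: generated_hw.
  exact: generated_lin.
exact: (generated_homog rhoP v0P).
Qed.

Definition pos_word (w : seq g) : Prop :=
  forall x, x \in w -> exists2 k, 0 < k & lie_homog k x.

Lemma pos_word_nil : pos_word [::].
Proof. by []. Qed.

(** For raising words [w] these functionals play the part of a dual basis and later serve as
    coordinates on each tensor factor. *)
Definition word_coef (w : seq g) (v : V) : K :=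
  hw_coef rho v0 (foldr rho v w).

Lemma pos_word_cons x w : pos_word (x :: w) ->
  (exists2 k, 0 < k & lie_homog k x) /\ pos_word w.
Proof.
move=> xw; split=> [|y yw]; first by apply: xw; rewrite mem_head.
by apply: xw; rewrite in_cons yw orbT.
Qed.

Lemma word_coef_lin w a u v : pos_word w ->
  word_coef w (a *: u + v) = a * word_coef w u + word_coef w v.
Proof.
move=> wp; rewrite /word_coef.
suff -> : foldr rho (a *: u + v) w = a *: foldr rho u w + foldr rho v w.
  by rewrite (hw_coef_lin rhoP v0P) //; apply: irreducible_generated.
elim: w wp => [//|x w IH] /pos_word_cons[[k _ xk] /IH] /= ->.
exact: (rho_lin rhoP xk).
Qed.

Lemma word_coef_nil_hw : word_coef [::] v0 = 1.
Proof. exact: (hw_coef_hw rhoP v0P). Qed.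

Lemma word_coef_rcons w x v : word_coef (rcons w x) v = word_coef w (rho x v).
Proof. by rewrite /word_coef foldr_rcons. Qed.

Lemma pos_word_rcons w x : pos_word w ->
  (exists2 k, 0 < k & lie_homog k x) -> pos_word (rcons w x).
Proof. by move=> wp xp y; rewrite mem_rcons inE => /orP[/eqP -> //|/wp]. Qed.

(** The common kernel of the functionals is a submodule, and it misses [v0], on which the empty word
    takes the value 1. *)
Lemma word_coef_sep v : (forall w, pos_word w -> word_coef w v = 0) -> v = 0.
Proof.
pose P v := forall w, pos_word w -> word_coef w v = 0.
have Plin a u w : P u -> P w -> P (a *: u + w).
  by move=> Pu Pw s sp; rewrite word_coef_lin // Pu // Pw // mulr0 addr0.
have P_pos k x u : 0 < k -> lie_homog k x -> P u -> P (rho x u).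
  move=> k0 xk Pu s sp; rewrite -word_coef_rcons; apply: Pu.
  by apply: pos_word_rcons sp _; exists k.
(* Induction on the word: its rightmost letter [y] is moved past [x]. This leaves x y u, with y u
   again in the kernel, and [y, x] u, both tested against a shorter word. *)
have Phom s : pos_word s -> forall k x u, lie_homog k x -> P u ->
    word_coef s (rho x u) = 0.
  elim/last_ind: s => [_ k x u xk Pu|s y IH sp k x u xk Pu].
    have gu := irreducible_generated u.
    have [k0|k0|k0] := ltgtP k 0.
    - exact: (hw_coef_neg rhoP v0P k0 xk).
    - exact: (P_pos _ _ _ k0 xk Pu).
    rewrite k0 in xk; rewrite /word_coef /= (hw_coef_zero rhoP v0P) //.
    by have := Pu [::]; rewrite /word_coef /= => ->; rewrite ?mulr0.
  have [l l0 yl] : exists2 l, 0 < l & lie_homog l y.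
    by apply: sp; rewrite mem_rcons mem_head.
  have {}sp : pos_word s by move=> z zs; apply: sp; rewrite mem_rcons inE zs orbT.
  rewrite word_coef_rcons (rho_br rhoP _ yl xk) -[rho x _]scale1r.
  rewrite word_coef_lin // (IH _ k) //; last exact: P_pos l0 yl Pu.
  by rewrite (IH _ (l + k)) ?mulr0 ?addr0 //; apply: (homog_br gP).
move=> Pv; case: (@irreducible_cases P) => [||k x u xk Pu s sp|H|H].
- move=> s sp; have := word_coef_lin (-1) v v sp.
  by rewrite scaleN1r addNr mulN1r addNr.
- exact: Plin.
- exact: Phom xk Pu.
- exact: H.
have /eqP : word_coef [::] v0 = 0 by apply: H.
by rewrite word_coef_nil_hw oner_eq0.
Qed.

(** Every raising element strictly decreases the depth, and negative depth leaves only 0. *)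
Lemma depth_nilpotent n z v : z < n%:Z -> depth rho v0 z v -> pos_nilpotent rho n v.
Proof.
elim: n z v => [|n IH] z v zn zv /=; first exact: (depth_lt0 rhoP v0P zv).
move=> k x k0 xk; apply: (IH (z - k)); first lia.
exact: (depth_act rhoP v0P).
Qed.

Lemma irreducible_nilpotent v : exists n, pos_nilpotent rho n v.
Proof.
have lin a u w : (exists n, pos_nilpotent rho n u) -> (exists n, pos_nilpotent rho n w) ->
    exists n, pos_nilpotent rho n (a *: u + w).
  move=> [m mu] [n nw]; exists (maxn m n); apply: (pos_nilpotent_lin rhoP).
    exact: (pos_nilpotentW rhoP (leq_maxl _ _) mu).
  exact: (pos_nilpotentW rhoP (leq_maxr _ _) nw).
have dn z u : depth rho v0 z u -> exists n, pos_nilpotent rho n u.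
  by move=> zu; exists `|z|.+1%N; apply: depth_nilpotent zu; lia.
have [b [u [bu ->]]] := irreducible_generated v.
apply: (lin); first exact: dn (depth_hw _ _).
elim: bu => [|z {}u w z0 zu _ IH]; first by exists 0%N.
by rewrite -[u]scale1r; apply: lin IH; apply: dn zu.
Qed.

(** All functionals [word_coef] vanish: the empty word by degree, any other because its rightmost
    letter already kills the vector. *)
Lemma singular_below_eq0 k x : k < 0 -> lie_homog k x ->
  (forall l y, 0 < l -> lie_homog l y -> rho y (rho x v0) = 0) -> rho x v0 = 0.
Proof.
move=> k0 xk sing; apply: word_coef_sep => w; case/lastP: w => [_|w y wp].
  by apply: (hw_coef_neg rhoP v0P k0 xk); apply: irreducible_generated.
have [l l0 yl] : exists2 l, 0 < l & lie_homog l y.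
  by apply: wp; rewrite mem_rcons mem_head.
rewrite word_coef_rcons (sing l) //.
have wp' : pos_word w by move=> z zs; apply: wp; rewrite mem_rcons inE zs orbT.
by have := word_coef_lin (-1) 0 0 wp'; rewrite scaleN1r addNr mulN1r addNr.
Qed.

End Irreducible.
End GradedModules.

Lemma linear_bundle (K : fieldType) (U V : lmodType K) (f : U -> V) :
  linear f -> exists h : {linear U -> V}, h =1 f.
Proof.
move=> f_lin.
by exists (HB.pack_for {linear U -> V} f (GRing.isLinear.Build K U V *:%R f f_lin)).
Qed.

(** * Uniqueness of the irreducible module of a given highest weight *)

Section HighestWeightUniqueness.
Variables (K : numFieldType) (g : graded_lie K) (d : g) (gP : graded_closed d).

Section ProductModule.
Variables (V W : lmodType K) (rho : g -> V -> V) (sigma : g -> W -> W).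
Variables (v0 : V) (w0 : W) (xi : g -> K).
Hypothesis rhoP : irreducible_hw_module rho v0 xi.
Hypothesis sigmaP : irreducible_hw_module sigma w0 xi.

Definition prod_act (x : g) (p : V * W) : (V * W)%type :=
  (rho x p.1, sigma x p.2).

Lemma prod_module : is_module prod_act.
Proof.
case: rhoP => [[r1 r2 r3] _ _]; case: sigmaP => [[s1 s2 s3] _ _].
split=> [x xm a [u1 u2] [w1 w2]|a x y [u w] xm ym|x y [u w] xm ym].
- by rewrite /prod_act /= (r1 _ xm) (s1 _ xm).
- by rewrite /prod_act /= r2 // s2.
by rewrite /prod_act /= r3 // s3.
Qed.

Lemma prod_hw : highest_weight_vector prod_act (v0, w0) xi.
Proof.
case: rhoP => _ _ [v0n r1 r2]; case: sigmaP => _ _ [w0n s1 s2].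
split=> [|k x k0 xk|x x0].
- by apply: contraNneq v0n => -[->].
- by rewrite /prod_act (r1 _ _ k0 xk) (s1 _ _ k0 xk).
by rewrite /prod_act r2 // s2.
Qed.

(** The submodule generated by the pair of highest weight vectors, read as a relation; it turns out
    to be the graph of an isomorphism. *)
Definition hw_graph (v : V) (w : W) := generated prod_act (v0, w0) (v, w).

Lemma hw_graph_total v : exists w, hw_graph v w.
Proof.
move: v; apply: (irreducible_ind gP rhoP) => [|a u v [w uw] [w' vw']|k x v xk [w vw]].
- by exists w0; apply: generated_hw.
- exists (a *: w + w'); have := generated_lin a uw vw'.
  by [].
exists (sigma x w).
exact: (generated_homog gP prod_module prod_hw xk vw).
Qed.

(** The fibre over 0 is a submodule of W. Were it everything, it would contain [w0]; then (0, w0),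
    having the top eigenvalue of [d], would be b (v0, w0), and b v0 = 0 would give b = 0 and w0 =
    0. *)
Lemma hw_graph_inj w : hw_graph 0 w -> w = 0.
Proof.
have [sm _ [w0n _ s0]] := sigmaP; have [rm _ [v0n _ _]] := rhoP.
have dh := grading_homog gP.
case: (@irreducible_cases _ _ _ gP _ _ _ _ sigmaP (hw_graph 0)) => [|||H|H].
- exact: (generated0 prod_act (v0, w0)).
- move=> a u v gu gv; have := generated_lin a gu gv.
  by rewrite /hw_graph; congr generated; congr pair; rewrite /= scaler0 addr0.
- move=> k x v xk gv; have := generated_homog gP prod_module prod_hw xk gv.
  by rewrite /prod_act /= (lin0 (rho_lin rm xk)).
- exact: H.
have [] := generated_eigen gP prod_module prod_hw (H w0).
  by rewrite /prod_act /= s0 // (lin0 (rho_lin rm dh)); congr pair; rewrite scaler0.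
move=> b [/esym/eqP]; rewrite scaler_eq0 (negPf v0n) orbF => /eqP ->.
by rewrite scale0r => w00; move: w0n; rewrite w00 eqxx.
Qed.

Lemma hw_graph_uniq v w w' : hw_graph v w -> hw_graph v w' -> w = w'.
Proof.
move=> gw gw'; apply/eqP; rewrite eq_sym -subr_eq0; apply/eqP/hw_graph_inj.
have := generated_lin (-1) gw gw'.
by rewrite scaleN1r /hw_graph; congr generated; congr pair => /=; rewrite ?addNr 1?addrC.
Qed.

End ProductModule.

(** Generation by the pair is symmetric in the two factors, so the inverse map arises from the same
    construction. *)
Lemma prod_act_swap (V W : lmodType K) (rho : g -> V -> V) (sigma : g -> W -> W)
    (v0 : V) (w0 : W) (xi : g -> K) v w :
    irreducible_hw_module rho v0 xi -> irreducible_hw_module sigma w0 xi ->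
  hw_graph rho sigma v0 w0 v w -> hw_graph sigma rho w0 v0 w v.
Proof.
move=> rhoP sigmaP [b [u [bu e]]].
exists b, (u.2, u.1); split; last by case: e => -> ->.
elim: bu {e} => [|z {}u {}w0' z0 zu _ IH] /=; first exact: below_0.
have -> : ((u + w0').2, (u + w0').1) = (u.2, u.1) + (w0'.2, w0'.1) by [].
apply: (below_add z0) IH.
clear z0; elim: zu => {z u} [|z|z a u1 u2 _ IH1 _ IH2|z k x u k0 xk _ IH] /=.
- exact: depth_hw.
- exact: depth_0.
- exact: (depth_lin _ IH1 IH2).
exact: (depth_low k0 xk IH).
Qed.

Lemma highest_weight_iso (V W : lmodType K) (rho : g -> V -> V)
    (sigma : g -> W -> W) (v0 : V) (w0 : W) (xi : g -> K) :
    irreducible_hw_module rho v0 xi -> irreducible_hw_module sigma w0 xi ->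
  module_iso rho sigma.
Proof.
move=> rhoP sigmaP.
have [f fP] := choice (hw_graph_total rhoP sigmaP).
have [h hP] := choice (hw_graph_total sigmaP rhoP).
have fh : cancel f h.
  move=> v; apply: (hw_graph_uniq sigmaP rhoP (hP _)).
  exact: (prod_act_swap rhoP sigmaP (fP v)).
have hf : cancel h f.
  move=> w; apply: (hw_graph_uniq rhoP sigmaP (fP _)).
  exact: (prod_act_swap sigmaP rhoP (hP w)).
have f_lin : linear f.
  move=> a u v; apply: (hw_graph_uniq rhoP sigmaP (fP _)).
  exact: (generated_lin a (fP u) (fP v)).
have [F FE] := linear_bundle f_lin.
exists F; split; first by exists h => v; rewrite FE.
move=> x v xm; rewrite !FE; apply: (hw_graph_uniq rhoP sigmaP (fP _)).
exact: (generated_act gP (prod_module rhoP sigmaP) (prod_hw rhoP sigmaP) xm (fP v)).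
Qed.

End HighestWeightUniqueness.

(** * Tensor products *)

Section TensorProduct.
Variables (K : fieldType) (n : nat) (L : 'I_n -> lmodType K).
Variables (I : 'I_n -> Type) (lam : forall i, I i -> L i -> K).
Arguments lam {i}.
Hypothesis lam_lin : forall i (j : I i) a u v,
  lam j (a *: u + v) = a * lam j u + lam j v.
Hypothesis lam_sep : forall i v, (forall j : I i, lam j v = 0) -> v = 0.

Let lam0 i (j : I i) : lam j 0 = 0.
Proof. by have := lam_lin j (-1) 0 0; rewrite scaler0 addr0 mulN1r addNr. Qed.

Let lamB i (j : I i) u v : lam j (u - v) = lam j u - lam j v.
Proof. by rewrite addrC -scaleN1r lam_lin mulN1r addrC. Qed.

(** Finitely many vectors have a common finite expansion whose coordinates are functionals [lam];
    this replaces the choice of a basis. *)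
Lemma finite_rank_fix i (s : seq (L i)) :
  exists r : seq (I i * L i), forall v, v \in s ->
    v = \sum_(p <- r) lam p.1 v *: p.2.
Proof.
elim: s => [|v s [r rP]]; first by exists [::].
pose Pi w := \sum_(p <- r) lam p.1 w *: p.2.
have [vE|] := eqVneq (v - Pi v) 0.
  exists r => w; rewrite inE => /orP[/eqP ->|/rP //].
  by apply/eqP; rewrite -subr_eq0 vE.
move=> /eqP vN; have [j jN] : exists j, lam j (v - Pi v) != 0.
  apply: contrapT => H; apply: vN; apply: lam_sep => j.
  by apply: contrapT => /eqP jN; apply: H; exists j.
pose e := (lam j (v - Pi v))^-1 *: (v - Pi v).
(* to fix v too, add to Pi the rank one operator w |-> lam j (w - Pi w) e *)
exists (r ++ (j, e) :: [seq (p.1, - lam j p.2 *: e) | p <- r]) => w ws.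
rewrite big_cat big_cons /= big_map /= -/(Pi w).
have H r' x : \sum_(p <- r') lam p.1 w *: (- lam j p.2 *: x)
    = - (lam j (\sum_(p <- r') lam p.1 w *: p.2) *: x).
  elim: r' => [|p r' IH]; first by rewrite !big_nil lam0 scale0r oppr0.
  by rewrite !big_cons lam_lin IH scalerDl opprD scalerA mulrN scaleNr.
rewrite H -/(Pi w).
rewrite -scalerBl -lamB; move: ws; rewrite inE => /orP[/eqP ->|/rP wE].
  by rewrite /e scalerA divff // scale1r addrC subrK.
by rewrite -[Pi w]wE subrr lam0 scale0r addr0.
Qed.

Let J := forall i, I i.

Definition pure_fun (v : forall i, L i) : J -> K^o :=
  fun j => \prod_i lam (j i) (v i).

Let mix (q : nat) (u v : forall i, L i) : forall i, L i :=
  fun i => if (i < q)%N then u i else v i.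

Let mix_in (i : 'I_n) u v (x : L i) :
  eqtype.dfwith (mix i u v) x = mix i.+1 (eqtype.dfwith u x) v :> forall j, L j.
Proof.
apply: functional_extensionality_dep => k; rewrite /mix ltnS.
have [ik|ik] := eqVneq i k.
  by case: k / ik; rewrite !eqtype.dfwith_in leqnn.
rewrite !eqtype.dfwith_out // ltn_neqAle.
by rewrite [nat_of_ord k == i]eq_sym -[(_ == _ :> nat)]/(i == k) ik.
Qed.

Let mix_eq (i : 'I_n) u v : mix i u v = eqtype.dfwith (mix i u v) (v i).
Proof.
apply: functional_extensionality_dep => k.
have [ik|ik] := eqVneq i k.
  by case: k / ik; rewrite !eqtype.dfwith_in /mix ltnn.
by rewrite eqtype.dfwith_out.
Qed.

(** Expanding every slot by [finite_rank_fix] leaves the given vectors only inside scalars, and the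
    sum of these scalars is the hypothesis evaluated at an index [j]. Thus every multilinear map
    respects the relations between pure functions. *)
Lemma multilinear_pure_eq0 (W : lmodType K) (f : (forall i, L i) -> W)
    m (b : 'I_m -> K) (v : 'I_m -> forall i, L i) : multilinear f ->
  \sum_k b k *: pure_fun (v k) = 0 -> \sum_k b k *: f (v k) = 0.
Proof.
move=> f_lin v0.
have rP (i : 'I_n) := finite_rank_fix [seq v k i | k : 'I_m].
(* The first [q] slots have been replaced by fixed vectors [u] at the price of scalars [lam]: q = 0
   is the goal, q = n follows from the hypothesis, and the induction descends from n. *)
suff H q : (q <= n)%N -> forall (u : forall i, L i) (j : J),
    \sum_k (b k * \prod_(i : 'I_n | (i < q)%N) lam (j i) (v k i)) *:
      f (mix q u (v k)) = 0.
  have [J0|] := pselect (exists j : J, True).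
    case: J0 => j _; apply: etrans (H 0%N (leq0n _) (fun=> 0) j).
    by apply: eq_bigr => k _; rewrite big_pred0 ?mulr1.
  (* Without any index some [I i] is empty; by separation that factor is 0 and every term
     vanishes. *)
  move=> J0; have [i Ii] : exists i, ~ inhabited (I i).
    apply: contrapT => NI; apply: J0.
    suff F i : exists x : I i, True.
      by exists (fun i => projT1 (cid (F i))).
    apply: contrapT => Fi; apply: NI; exists i => -[x].
    by apply: Fi; exists x.
  apply: big1 => k _.
  have -> : v k = eqtype.dfwith (v k) (0 : L i).
    apply: functional_extensionality_dep => k'.
    have [ik|ik] := eqVneq i k'; last by rewrite eqtype.dfwith_out.
    case: k' / ik; rewrite eqtype.dfwith_in; apply: lam_sep => x.
    by case: Ii.
  by rewrite (lin0 (f_lin i (v k))) scaler0.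
move=> qn; have [p pE] : exists p, (p + q = n)%N by exists (n - q)%N; rewrite subnK.
elim: p q qn pE => [|p IH] q qn pE u j.
  have {pE}-> : q = n by rewrite -pE add0n.
  transitivity (\sum_k (b k * pure_fun (v k) j) *: f u).
    apply: eq_bigr => k _; rewrite (eq_bigl xpredT) => [|i]; last exact: ltn_ord.
    congr (_ *: f _); apply: functional_extensionality_dep => i.
    by rewrite /mix ltn_ord.
  rewrite -scaler_suml.
  have /(congr1 (fun t : J -> K^o => t j)) := v0.
  by rewrite fct_sumE /= => ->; rewrite scale0r.
have lt_qn : (q < n)%N by lia.
pose i := Ordinal lt_qn; have [r riP] := rP i.
transitivity (\sum_k \sum_(p <- r) (b k * \prod_(i0 : 'I_n | (i0 < q.+1)%N)
        lam (eqtype.dfwith j p.1 i0) (v k i0)) *: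
        f (mix q.+1 (eqtype.dfwith u p.2) (v k))).
  apply: eq_bigr => k _; rewrite -[q]/(nat_of_ord i) mix_eq {1}(riP (v k i)); last first.
    by apply/mapP; exists k; rewrite ?mem_enum.
  rewrite (lin_sum (f_lin i _)) scaler_sumr; apply: eq_bigr => p' _.
  rewrite (linZ (f_lin i _)) scalerA mix_in; congr (_ *: _).
  rewrite -mulrA; congr (_ * _); rewrite [RHS](bigD1 i) //= eqtype.dfwith_in mulrC.
  congr (_ * _); apply: eq_big => [l|l li].
    by rewrite ltnS [RHS]andbC ltn_neqAle.
  by rewrite eqtype.dfwith_out // -val_eqE /= gtn_eqF.
rewrite exchange_big big1 //= => p' _; apply: IH => //.
by rewrite addnS -addSn.
Qed.

(** The tensor product is realized inside the functions on index families, as the span of products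
    of coordinates; no quotient is formed, and equality is tested by evaluation. *)
Definition tensor_pred : {pred (J -> K^o)} :=
  fun t => `[< lspan (range pure_fun) t >].

Lemma lspan_pure (t : J -> K^o) : lspan (range pure_fun) t ->
  exists m (b : 'I_m -> K) (v : 'I_m -> forall i, L i),
    t = \sum_k b k *: pure_fun (v k).
Proof.
move=> [m [e [b [eR ->]]]].
have /choice[v vP] : forall k, exists v, pure_fun v = e k.
  by move=> k; have [v _ <-] := eR k; exists v.
by exists m, b, v; apply: eq_bigr => k _; rewrite vP.
Qed.

Lemma tensor_pred_closed : submod_closed tensor_pred.
Proof.
split=> [|a u v].
  apply/asboolP; exists 0%N, (fun=> 0), (fun=> 0); split; first by case.
  by rewrite big_ord0.
move=> /asboolP[m [e [b [eR ->]]]] /asboolP[m' [e' [b' [eR' ->]]]].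
apply/asboolP; exists (m + m')%N.
exists (fun k => match fintype.split k with inl i => e i | inr i => e' i end).
exists (fun k => match fintype.split k with inl i => a * b i | inr i => b' i end).
split=> [k|]; first by case: fintype.split.
rewrite big_split_ord /= scaler_sumr; congr (_ + _); apply: eq_bigr => i _.
  by rewrite (unsplitK (inl _ i)) scalerA.
by rewrite (unsplitK (inr _ i)).
Qed.

HB.instance Definition _ :=
  GRing.isSubmodClosed.Build K (J -> K^o) tensor_pred tensor_pred_closed.

Record tensor := Tensor { tensor_val :> J -> K^o; _ : tensor_val \in tensor_pred }.

HB.instance Definition _ := [isSub for tensor_val].
HB.instance Definition _ := [Choice of tensor by <:].
HB.instance Definition _ := [SubChoice_isSubLmodule of tensor by <:].

Lemma pure_tensor_proof v : pure_fun v \in tensor_pred.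
Proof.
apply/asboolP; exists 1%N, (fun=> pure_fun v), (fun=> 1); split=> [_|].
  by exists v.
by rewrite big_ord1 scale1r.
Qed.

Definition pure_tensor v : tensor := Tensor (pure_tensor_proof v).

Lemma tensor_sum m (b : 'I_m -> K) (v : 'I_m -> forall i, L i) :
  \sum_k b k *: pure_tensor (v k) = \sum_k b k *: pure_fun (v k) :> (J -> K^o).
Proof.
rewrite -[tensor_val _]/(val _) raddf_sum.
by apply: eq_bigr.
Qed.

Lemma tensor_span (t : tensor) : exists m (b : 'I_m -> K) (v : 'I_m -> forall i, L i),
  t = \sum_k b k *: pure_tensor (v k).
Proof.
have /asboolP/lspan_pure[m [b [v tE]]] := valP t.
by exists m, b, v; apply: val_inj; rewrite /= tensor_sum.
Qed.

Lemma pure_multilinear : multilinear pure_tensor.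
Proof.
move=> i v a x y; apply: val_inj; apply/funext => j /=.
rewrite -[RHS]/(a * pure_fun _ j + pure_fun _ j) /pure_fun.
rewrite !(bigD1 (P := xpredT) i) //= !eqtype.dfwith_in lam_lin mulrDl mulrA.
by congr (_ * _ + _ * _); apply: eq_bigr => k; rewrite eq_sym => ik;
  rewrite !eqtype.dfwith_out.
Qed.

Lemma pure_is_tensor : is_tensor_product pure_tensor.
Proof.
split; first exact: pure_multilinear.
move=> W f f_lin.
have wd m (b : 'I_m -> K) v m' (b' : 'I_m' -> K) v' a :
    a *: (\sum_k b k *: pure_tensor (v k)) = \sum_k b' k *: pure_tensor (v' k) ->
    a *: (\sum_k b k *: f (v k)) = \sum_k b' k *: f (v' k).
  move=> e; apply/eqP; rewrite -subr_eq0; apply/eqP.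
  pose B (k : 'I_(m + m')) :=
    match fintype.split k with inl i => a * b i | inr i => - b' i end.
  pose U (k : 'I_(m + m')) :=
    match fintype.split k with inl i => v i | inr i => v' i end.
  have sumE (X : lmodType K) (F : (forall i, L i) -> X) :
      \sum_k B k *: F (U k) =
      a *: (\sum_k b k *: F (v k)) - \sum_k b' k *: F (v' k).
    rewrite big_split_ord /= scaler_sumr -sumrN.
    congr (_ + _); apply: eq_bigr => i _.
      by rewrite /B /U (unsplitK (inl _ i)) scalerA.
    by rewrite /B /U (unsplitK (inr _ i)) scaleNr.
  rewrite -sumE; apply: multilinear_pure_eq0 => //.
  by rewrite -tensor_sum sumE e subrr.
(* Graph of the induced map: total because pure tensors span, single-valued by
   [multilinear_pure_eq0]. *)
pose good (t : tensor) (w : W) := exists m (b : 'I_m -> K) v,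
  t = \sum_k b k *: pure_tensor (v k) /\ w = \sum_k b k *: f (v k).
have [h hP] : {h : tensor -> W & forall t, good t (h t)}.
  apply: (@choice _ _ good) => t; have [m [b [v tE]]] := tensor_span t.
  by exists (\sum_k b k *: f (v k)), m, b, v.
have goodD a t t' w w' : good t w -> good t' w' -> good (a *: t + t') (a *: w + w').
  move=> [m [b [v [-> ->]]]] [m' [b' [v' [-> ->]]]].
  exists (m + m')%N.
  exists (fun k => match fintype.split k with inl i => a * b i | inr i => b' i end).
  exists (fun k => match fintype.split k with inl i => v i | inr i => v' i end).
  by split; rewrite big_split_ord /= scaler_sumr; congr (_ + _);
    apply: eq_bigr => i _; rewrite ?(unsplitK (inl _ i)) ?(unsplitK (inr _ i)) ?scalerA.
have good_uniq t w w' : good t w -> good t w' -> w = w'.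
  move=> [m [b [v [tE ->]]]] [m' [b' [v' [tE' ->]]]].
  rewrite -[LHS]scale1r; apply: wd.
  by rewrite scale1r -tE.
have h_lin : linear h.
  move=> a u v; apply: good_uniq (hP _) _; exact: goodD.
have [H HE] := linear_bundle h_lin; exists H; split.
  move=> v; rewrite HE; apply: good_uniq (hP _) _.
  by exists 1%N, (fun=> 1), (fun=> v); rewrite !big_ord1 !scale1r.
move=> h' h'P t; rewrite HE; have [m [b [v [-> ->]]]] := hP t.
by rewrite linear_sum; apply: eq_bigr => k _; rewrite linearZ /= h'P.
Qed.

Lemma tensor_product_exists : exists (T : lmodType K) (tau : (forall i, L i) -> T)
    (ev : J -> T -> K),
  [/\ is_tensor_product tau,
      forall t, exists m (b : 'I_m -> K) (v : 'I_m -> forall i, L i),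
        t = \sum_k b k *: tau (v k),
      forall j a t t', ev j (a *: t + t') = a * ev j t + ev j t',
      forall j v, ev j (tau v) = \prod_i lam (j i) (v i)
    & forall t, (forall j, ev j t = 0) -> t = 0].
Proof.
exists tensor, pure_tensor, (fun j t => tensor_val t j); split => //.
- exact: pure_is_tensor.
- exact: tensor_span.
by move=> t t0; apply: val_inj; apply/funext => j; apply: t0.
Qed.

End TensorProduct.

(** * Tensor products of irreducible modules under a dense subalgebra *)

Section Replace.
Variables (n : nat) (L : 'I_n -> Type).
Implicit Types v : forall i, L i.

Lemma dfwith_id v i : eqtype.dfwith v (v i) = v.
Proof.
apply: functional_extensionality_dep => k; have [ik|ik] := eqVneq i k.
  by case: k / ik; rewrite eqtype.dfwith_in.
by rewrite eqtype.dfwith_out.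
Qed.

Lemma dfwith_twice v i (x y : L i) :
  eqtype.dfwith (eqtype.dfwith v x) y = eqtype.dfwith v y.
Proof.
apply: functional_extensionality_dep => k; have [ik|ik] := eqVneq i k.
  by case: k / ik; rewrite !eqtype.dfwith_in.
by rewrite !eqtype.dfwith_out.
Qed.

Lemma dfwith_swap v i l (x : L i) (y : L l) : i != l ->
  eqtype.dfwith (eqtype.dfwith v x) y = eqtype.dfwith (eqtype.dfwith v y) x.
Proof.
move=> il; apply: functional_extensionality_dep => k.
have [ik|ik] := eqVneq i k.
  by case: k / ik; rewrite eqtype.dfwith_in eqtype.dfwith_out 1?eq_sym // eqtype.dfwith_in.
have [lk|lk] := eqVneq l k.
  by case: k / lk ik => ik; rewrite eqtype.dfwith_in eqtype.dfwith_out // eqtype.dfwith_in.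
by rewrite !eqtype.dfwith_out.
Qed.

End Replace.

Lemma leibniz_multilinear (K : fieldType) n (L : 'I_n -> lmodType K)
    (T : lmodType K) (tau : (forall i, L i) -> T) (A : forall i, L i -> L i) :
    multilinear tau -> (forall i, linear (A i)) ->
  multilinear (fun v => \sum_i tau (eqtype.dfwith v (A i (v i)))).
Proof.
move=> tau_lin A_lin l v a x y; rewrite scaler_sumr -big_split.
apply: eq_bigr => i _ /=; have [li|il] := eqVneq l i.
  case: i / li.
  by rewrite !eqtype.dfwith_in !dfwith_twice A_lin tau_lin.
rewrite !(dfwith_swap _ _ _ il) !(eqtype.dfwith_out _ _ il).
exact: tau_lin.
Qed.

Section TensorIrreducible.
Variables (K : numFieldType) (D : graded_lie K) (dD : D).
Hypothesis DP : graded_closed dD.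
Variables (n : nat) (g : 'I_n -> graded_lie K) (d : forall i, g i).
Hypothesis gP : forall i, graded_closed (d i).
Variables (L : 'I_n -> lmodType K) (rho : forall i, g i -> L i -> L i).
Variables (w0 : forall i, L i) (Lam : forall i, g i -> K).
Hypothesis irrL : forall i, irreducible_hw_module (@rho i) (w0 i) (@Lam i).
Variable phi : forall i, D -> g i.
Hypothesis phi_homog : forall i k (x : D), lie_homog k x -> lie_homog k (phi i x).
Hypothesis phi_lin : forall i a (x y : D), lie_mem x -> lie_mem y ->
  phi i (a *: x + y) = a *: phi i x + phi i y.
Hypothesis phi_br : forall i (x y : D), lie_mem x -> lie_mem y ->
  phi i (lie_br x y) = lie_br (phi i x) (phi i y).
Hypothesis phi_dense : forall i k (X : g i) m (v : 'I_m -> forall i, L i),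
  k != 0 -> lie_homog k X -> exists y : D, [/\ lie_homog k y,
    forall p, rho (phi i y) (v p i) = rho X (v p i)
  & forall l p, l != i -> rho (phi l y) (v p l) = 0].
Variable xi : D -> K.
Hypothesis xiE : forall x : D, lie_homog 0 x -> xi x = \sum_i Lam (phi i x).

Let rhoP i : is_module (@rho i). Proof. by case: (irrL i). Qed.
Let hwP i : highest_weight_vector (@rho i) (w0 i) (@Lam i).
Proof. by case: (irrL i). Qed.

Let phi_mem i (x : D) : lie_mem x -> lie_mem (phi i x).
Proof.
move=> /(mem_homog DP)[m [k [e [eh ->]]]].
have em j : lie_mem (e j) := homog_mem (eh j).
suff -> : phi i (\sum_j e j) = \sum_j phi i (e j).
  by apply: (lie_mem_sum (gP i)) => j; apply: homog_mem (phi_homog i (eh j)).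
have phi0 : phi i 0 = 0.
  have m0 := lie_mem0 DP; have := phi_lin i (-1) m0 m0.
  by rewrite scaler0 addr0 scaleN1r addNr.
elim: m e k {eh} em => [|m IH] e k em; first by rewrite !big_ord0.
rewrite !big_ord_recl -[e ord0]scale1r phi_lin ?scale1r ?(IH _ (fun=> 0)) //.
exact: (lie_mem_sum DP).
Qed.

Let J := forall i, {w : seq (g i) | pos_word w}.

Section WithTensor.
Variables (T : lmodType K) (tau : (forall i, L i) -> T) (ev : J -> T -> K).
Hypothesis tauP : is_tensor_product tau.
Hypothesis tau_span : forall t, exists m (b : 'I_m -> K) (v : 'I_m -> forall i, L i),
  t = \sum_k b k *: tau (v k).
Hypothesis ev_lin : forall j a t t', ev j (a *: t + t') = a * ev j t + ev j t'.
Hypothesis evE : forall j v,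
  ev j (tau v) = \prod_i word_coef (@rho i) (w0 i) (sval (j i)) (v i).
Hypothesis ev_sep : forall t, (forall j, ev j t = 0) -> t = 0.

Let tau_lin : multilinear tau. Proof. by case: tauP. Qed.

Lemma tensor_eq (W : lmodType K) (f h : T -> W) : linear f -> linear h ->
  (forall v, f (tau v) = h (tau v)) -> forall t, f t = h t.
Proof.
move=> fl hl fh t; have [m [b [v ->]]] := tau_span t.
rewrite (lin_sum fl) (lin_sum hl); apply: eq_bigr => k _.
by rewrite (linZ fl) (linZ hl) fh.
Qed.

Lemma tensor_action_exists : exists rhoT : D -> T -> T,
  forall x, (forall i, linear (rho (phi i x))) -> linear (rhoT x) /\
    forall v, rhoT x (tau v) =
      \sum_i tau (eqtype.dfwith v (rho (phi i x) (v i))).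
Proof.
suff /choice[r rP] : forall x : D, exists h : T -> T,
    (forall i, linear (rho (phi i x))) -> linear h /\
    forall v, h (tau v) = \sum_i tau (eqtype.dfwith v (rho (phi i x) (v i))).
  by exists r.
move=> x; have [xl|Nxl] := pselect (forall i, linear (rho (phi i x))).
  have [_ /(_ _ _ (leibniz_multilinear tau_lin xl))[h [hE _]]] := tauP.
  by exists h => _; split=> // a u v; rewrite linearP.
(* This default can only be reached outside the subalgebra, where nothing is asked of the action. *)
by exists (fun=> 0).
Qed.

Variable rhoT : D -> T -> T.
Hypothesis rhoTP : forall x, (forall i, linear (rho (phi i x))) ->
  linear (rhoT x) /\ forall v, rhoT x (tau v) =
    \sum_i tau (eqtype.dfwith v (rho (phi i x) (v i))).

Let phi_act_lin i (x : D) : lie_mem x -> linear (rho (phi i x)).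
Proof. by move=> /(phi_mem i) xm; case: (rhoP i) => + _ _; apply. Qed.

Let rhoT_lin (x : D) : lie_mem x -> linear (rhoT x).
Proof. by move=> xm; case: (@rhoTP x) => // i; apply: phi_act_lin. Qed.

Let rhoTE (x : D) v : lie_mem x ->
  rhoT x (tau v) = \sum_i tau (eqtype.dfwith v (rho (phi i x) (v i))).
Proof. by move=> xm; case: (@rhoTP x) => // i; apply: phi_act_lin. Qed.

Let tau_replace i v (a : K) x y :
  tau (eqtype.dfwith v (a *: x + y : L i)) =
  a *: tau (eqtype.dfwith v x) + tau (eqtype.dfwith v y).
Proof. exact: tau_lin. Qed.

Let tau_replace0 i v : tau (eqtype.dfwith v (0 : L i)) = 0.
Proof. by rewrite (lin0 (@tau_lin i v)). Qed.

Let tau_replaceZ i v a : tau (eqtype.dfwith v (a *: v i : L i)) = a *: tau v.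
Proof. by rewrite (linZ (@tau_lin i v)) dfwith_id. Qed.

Lemma tensor_comp (x y : D) v : lie_mem x -> lie_mem y ->
  rhoT x (rhoT y (tau v)) =
  \sum_i tau (eqtype.dfwith v (rho (phi i x) (rho (phi i y) (v i)))) +
  \sum_i \sum_(l | l != i) tau (eqtype.dfwith
     (eqtype.dfwith v (rho (phi i y) (v i))) (rho (phi l x) (v l))).
Proof.
move=> xm ym; rewrite rhoTE // (lin_sum (rhoT_lin xm)) -big_split.
apply: eq_bigr => i _ /=; rewrite rhoTE // (bigD1 i) //=.
rewrite eqtype.dfwith_in dfwith_twice; congr (_ + _).
by apply: eq_bigr => l li; rewrite eqtype.dfwith_out // eq_sym.
Qed.

Lemma tensor_module : is_module rhoT.
Proof.
split=> [|a x y t xm ym|x y t xm ym]; first exact: rhoT_lin.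
  have xym := mem_lin DP a xm ym; move: t; apply: tensor_eq => [|b u v|v].
  - exact: rhoT_lin.
  - by rewrite (rhoT_lin xm) (rhoT_lin ym) !scalerDr !scalerA addrACA [a * b]mulrC.
  rewrite !rhoTE // scaler_sumr -big_split; apply: eq_bigr => i _ /=.
  rewrite -tau_replace; congr (tau (eqtype.dfwith _ _)).
  case: (rhoP i) => _ H _; rewrite phi_lin // H //; exact: phi_mem.
have brE i u : rho (phi i (lie_br x y)) u =
    rho (phi i x) (rho (phi i y) u) - rho (phi i y) (rho (phi i x) u).
  by case: (rhoP i) => _ _ H; rewrite phi_br // H //; apply: phi_mem.
have [brl brT] : linear (rhoT (lie_br x y)) /\ forall v, rhoT (lie_br x y) (tau v) =
    \sum_i tau (eqtype.dfwith v (rho (phi i (lie_br x y)) (v i))).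
  apply: rhoTP => i a u v; rewrite !brE.
  have xl := @phi_act_lin i _ xm; have yl := @phi_act_lin i _ ym.
  by rewrite !(xl, yl) scalerBr opprD addrACA.
move: t; apply: tensor_eq => [//|a u v|v].
  by rewrite !(rhoT_lin xm, rhoT_lin ym) scalerBr opprD addrACA.
rewrite brT !tensor_comp //.
(* The terms acting in two different slots coincide after the two slots are exchanged, so they
   cancel in the commutator. *)
rewrite [X in _ = _ - (_ + X)](exchange_big_dep xpredT) //=.
rewrite [X in _ = _ + X - _](_ : _ = \sum_i \sum_(l | i != l) tau (eqtype.dfwith
     (eqtype.dfwith v (rho (phi l x) (v l))) (rho (phi i y) (v i)))); last first.
  apply: eq_bigr => i _; apply: eq_big => [l|l li]; first by rewrite eq_sym.
  by rewrite dfwith_swap // eq_sym.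
rewrite opprD addrACA subrr addr0 -sumrB; apply: eq_bigr => i _.
by rewrite brE (linB (@tau_lin i v)).
Qed.

Lemma tensor_hw : highest_weight_vector rhoT (tau w0) xi.
Proof.
split=> [|k x k0 xk|x x0].
- pose j : J := fun i => exist _ [::] (@pos_word_nil K (g i)).
  have : ev j (tau w0) = 1.
    by rewrite evE big1 // => i _; apply: (word_coef_nil_hw (gP i) (irrL i)).
  apply: contra_eqN => /eqP ->; have := ev_lin j (-1) 0 0.
  rewrite scaler0 addr0 mulN1r addNr => ->; by rewrite eq_sym oner_eq0.
- rewrite rhoTE ?big1 // => [i _|]; last exact: homog_mem xk.
  by case: (hwP i) => _ /(_ k (phi i x)) -> //; apply: phi_homog.
rewrite rhoTE; last exact: homog_mem x0.
rewrite xiE // scaler_suml; apply: eq_bigr => i _.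
by case: (hwP i) => _ _ ->; [apply: tau_replaceZ | apply: phi_homog].
Qed.

(** In each summand a raising element acts on a single slot and lowers the bound of that slot by
    one, so the sum of the bounds drops. *)
Lemma tensor_nilpotent_pure m (N : 'I_n -> nat) v : (\sum_i N i < m)%N ->
    (forall i, pos_nilpotent (@rho i) (N i) (v i)) ->
  pos_nilpotent rhoT m (tau v).
Proof.
elim: m N v => [//|m IH] N v Nm vN k x k0 xk.
rewrite rhoTE; last exact: homog_mem xk.
elim/big_ind: _ => [|t t' tn tn'|i _].
- exact: (pos_nilpotent0 tensor_module).
- by rewrite -[t]scale1r; apply: (pos_nilpotent_lin tensor_module).
case Ni : (N i) => [|p]; have := vN i; rewrite Ni /=.
  move=> ->; rewrite (lin0 (@phi_act_lin i _ (homog_mem xk))) tau_replace0.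
  exact: (pos_nilpotent0 tensor_module).
move=> /(_ k _ k0 (phi_homog i xk)) xv.
apply: (IH (fun l => if l == i then p else N l)).
  move: Nm; rewrite ltnS (bigD1 i) //= Ni => Nm; rewrite (bigD1 i) //= eqxx.
  by rewrite (eq_bigr N) // => l /negPf ->.
move=> l; have [li|li] := eqVneq i l.
  by case: l / li; rewrite eqtype.dfwith_in.
by rewrite eqtype.dfwith_out.
Qed.

Lemma tensor_nilpotent t : exists N, pos_nilpotent rhoT N t.
Proof.
have tm := tensor_module.
have [m [b [v ->]]] := tau_span t; elim/big_ind: _ => [|u w [N Nu] [N' N'w]|k _].
- by exists 0%N.
- exists (maxn N N'); rewrite -[u]scale1r; apply: (pos_nilpotent_lin tm).
    exact: (pos_nilpotentW tm (leq_maxl _ _) Nu).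
  exact: (pos_nilpotentW tm (leq_maxr _ _) N'w).
have /choice[N NP] : forall i, exists N, pos_nilpotent (@rho i) N (v k i).
  by move=> i; apply: irreducible_nilpotent (irrL i) _.
exists (\sum_i N i).+1; rewrite -[_ *: _]addr0; apply: (pos_nilpotent_lin tm).
  exact: tensor_nilpotent_pure NP.
exact: (pos_nilpotent0 tm).
Qed.

(** A nonempty word in slot [i] ends with a raising element [x]. On the finitely many vectors
    composing [t] it is imitated by a raising [y] of [D], and y t = 0. Only the functional with all
    words empty survives on [t], exactly as on multiples of tau w0. *)
Lemma tensor_singular t : (forall k x, 0 < k -> lie_homog k x -> rhoT x t = 0) ->
  exists c, t = c *: tau w0.
Proof.
move=> t_sing.
have ev0 j : ev j 0 = 0.
  by have := ev_lin j (-1) 0 0; rewrite scaler0 addr0 mulN1r addNr.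
have evZ j a u : ev j (a *: u) = a * ev j u.
  by have := ev_lin j a u 0; rewrite ev0 !addr0.
have ev_sum j m (b : 'I_m -> K) (u : 'I_m -> T) :
    ev j (\sum_k b k *: u k) = \sum_k b k * ev j (u k).
  elim: m b u => [|m IH] b u; first by rewrite !big_ord0.
  by rewrite !big_ord_recl ev_lin IH.
pose j0 : J := fun i => exist _ [::] (@pos_word_nil K (g i)).
exists (ev j0 t); apply/eqP; rewrite -subr_eq0; apply/eqP/ev_sep => j.
rewrite addrC -scaleNr ev_lin mulNr.
have [jE|Nj] := pselect (forall i, sval (j i) = [::]).
  have -> : j = j0.
    apply: functional_extensionality_dep => i.
    by have := jE i; rewrite /j0; case: (j i) => w wp /= w0E; apply: eq_exist.
  rewrite [X in _ * X]evE big1 ?mulr1 ?addNr // => i _.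
  exact: (word_coef_nil_hw (gP i) (irrL i)).
have [i ji0] : exists i, sval (j i) <> [::].
  apply: contrapT => H; apply: Nj => i; apply: contrapT => Hi.
  by apply: H; exists i.
move: ji0; case ji: (j i) => [w wp] /=.
case/lastP: w wp ji => [//|w x] wp ji _.
have [k k0 xk] : exists2 k, 0 < k & lie_homog k x.
  by apply/wp; rewrite mem_rcons mem_head.
have wp' : pos_word w by move=> z zs; apply/wp; rewrite mem_rcons inE zs orbT.
(* Dropping the last letter of the i-th word trades it for an action of [x] on slot [i]. *)
pose j' : J := eqtype.dfwith j (exist _ w wp').
have ev_j v : ev j (tau v) = ev j' (tau (eqtype.dfwith v (rho x (v i)))).
  rewrite !evE !(bigD1 (P := xpredT) i) //= /j' !eqtype.dfwith_in ji /=.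
  rewrite word_coef_rcons; congr (_ * _); apply: eq_bigr => l li.
  by rewrite !eqtype.dfwith_out // eq_sym.
have -> : ev j (tau w0) = 0.
  case: (hwP i) => _ H _; rewrite ev_j (H k) // tau_replace0; exact: ev0.
have [m [b [v tE]]] := tau_span t.
have [|y [yk yi yl]] := phi_dense v _ xk; first by rewrite gt_eqF.
rewrite mulr0 oppr0 add0r tE ev_sum.
transitivity (ev j' (rhoT y t)); last by rewrite (t_sing k).
rewrite tE (lin_sum (rhoT_lin (homog_mem yk))).
transitivity (ev j' (\sum_k0 b k0 *: tau (eqtype.dfwith (v k0) (rho x (v k0 i))))).
  by rewrite ev_sum; apply: eq_bigr => p _; rewrite ev_j.
congr (ev j' _); apply: eq_bigr => p _.
rewrite (linZ (rhoT_lin (homog_mem yk))) rhoTE; last exact: homog_mem yk.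
rewrite (bigD1 i) //= yi big1 ?addr0 // => l li.
by rewrite yl // tau_replace0.
Qed.

(** Starting from [w0], the slots are filled one after another: a lowering element acting in one
    slot is imitated by [D], and lowering elements produce every vector of an irreducible factor. *)
Lemma tensor_generated (P : T -> Prop) : P 0 ->
    (forall a u v, P u -> P v -> P (a *: u + v)) ->
    (forall k x v, lie_homog k x -> P v -> P (rhoT x v)) ->
  P (tau w0) -> forall t, P t.
Proof.
move=> P0 Plin Phom Pw0.
have slot v i : v i = w0 i -> P (tau v) -> forall u : L i, P (tau (eqtype.dfwith v u)).
  move=> vi Pv.
  have Qd z u : depth (@rho i) (w0 i) z u -> P (tau (eqtype.dfwith v u)).
    elim=> {z u} [|z|z a u1 u2 _ IH1 _ IH2|z k X u k0 Xk _ IH].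
    - by rewrite -vi dfwith_id.
    - by rewrite tau_replace0.
    - by rewrite tau_replace; apply: (Plin).
    have kN : - k != 0 by rewrite oppr_eq0 gt_eqF.
    have [y [yk yi yl]] := phi_dense (fun _ : 'I_1 => eqtype.dfwith v u) kN Xk.
    have := Phom _ _ _ yk IH; rewrite rhoTE; last exact: homog_mem yk.
    rewrite (bigD1 i) //= (yi ord0) big1 ?addr0 => [|l li].
      by rewrite eqtype.dfwith_in dfwith_twice.
    by rewrite (yl l ord0) // tau_replace0.
  move=> u; have [b [u' [bu ->]]] := irreducible_generated (gP i) (irrL i) u.
  rewrite tau_replace -vi dfwith_id; apply: (Plin) => //.
  elim: bu => [|z {}u w z0 zu _ IH]; first by rewrite tau_replace0.
  by rewrite -[u]scale1r tau_replace; apply: (Plin _ _ _ _ IH); apply: Qd zu.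
have Pq q v : (forall i : 'I_n, (q <= i)%N -> v i = w0 i) -> P (tau v).
  elim: q v => [|q IH] v vE.
    suff -> : v = w0 by [].
    by apply: functional_extensionality_dep => i; apply: vE.
  have [nq|qn] := leqP n q.
    apply: IH => i qi; apply: vE; have := ltn_ord i; lia.
  pose i := Ordinal qn.
  rewrite -(dfwith_id v i) -(dfwith_twice v (w0 i)).
  apply: slot; first by rewrite eqtype.dfwith_in.
  apply: IH => l; rewrite leq_eqVlt => /orP[/eqP il|il].
    have {il}il : i = l by apply: val_inj.
    by case: l / il; rewrite eqtype.dfwith_in.
  rewrite eqtype.dfwith_out ?vE //.
  by rewrite -val_eqE /=; lia.
move=> t; have [m [b [v ->]]] := tau_span t.
elim/big_ind: _ => [//|u w Pu Pw|k _]; first by rewrite -[u]scale1r; apply: (Plin).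
rewrite -[_ *: _]addr0; apply: (Plin) => //; apply: (Pq n) => i.
by rewrite leqNgt ltn_ord.
Qed.

(** A nonzero vector of a submodule is raised until it is singular and still nonzero; it is then a
    multiple of tau w0, which generates everything. *)
Lemma tensor_irreducible : irreducible_hw_module rhoT (tau w0) xi.
Proof.
have tm := tensor_module; have th := tensor_hw.
split=> //; split; first by exists (tau w0); case: th.
move=> W [W0 Wlin] Wact.
have [W_0|] := pselect (forall t, t \in W -> t = 0); first by left.
move=> /existsNP[t /not_implyP[tW /eqP tN]]; right.
apply: (tensor_generated (P := fun t => t \in W)) => //.
  by move=> k x v /homog_mem; apply: Wact.
have [N tn] := tensor_nilpotent t.
elim: N t tW tN tn => [t _ /eqP //|N IH t tW tN tn].
have [t_sing|] := pselect (forall k x, 0 < k -> lie_homog k x -> rhoT x t = 0).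
  have [c tE] := tensor_singular t_sing.
  have c0 : c != 0 by apply: contraNneq tN => c0; rewrite tE c0 scale0r.
  have := Wlin c^-1 t 0 tW W0.
  by rewrite addr0 tE scalerA mulVf // scale1r.
move=> /existsNP[k /existsNP[x /not_implyP[k0 /not_implyP[xk /eqP xt]]]].
apply: (IH (rhoT x t)) (Wact _ _ (homog_mem xk) tW) xt _; exact: tn xk.
Qed.

Lemma tensor_is_module :
  is_tensor_module (fun i x => @rho i (phi i x)) rhoT tau.
Proof. by split; [exact: tauP | exact: tensor_module | move=> x v; apply: rhoTE]. Qed.

End WithTensor.

Theorem irreducible_tensor_exists : exists (T : lmodType K) (rhoT : D -> T -> T)
    (tau : (forall i, L i) -> T),
  is_tensor_module (fun i x => @rho i (phi i x)) rhoT tau /\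
  irreducible_hw_module rhoT (tau w0) xi.
Proof.
pose lam i (j : {w : seq (g i) | pos_word w}) := word_coef (@rho i) (w0 i) (sval j).
have [||T [tau [ev [tauP tau_span ev_lin evE ev_sep]]]] :=
    @tensor_product_exists K n L _ lam.
- by move=> i [w wp] a u v; apply: (word_coef_lin (gP i) (irrL i)).
- move=> i v H; apply: (word_coef_sep (gP i) (irrL i)) => w wp.
  exact: (H (exist _ w wp)).
have [rhoT rhoTP] := tensor_action_exists tauP.
exists T, rhoT, tau; split; first exact: (tensor_is_module tauP tau_span rhoTP).
exact: (tensor_irreducible tauP tau_span ev_lin evE ev_sep rhoTP).
Qed.

End TensorIrreducible.

(** * The algebras of differential operators *)

Section FiniteSums.
Variables (T : choiceType) (V : nmodType).

Lemma fsum_seqE (A : set T) (r : seq T) (f : T -> V) : uniq r ->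
    (forall i, A i -> i \notin r -> f i = 0) ->
  \sum_(i \in A) f i = \sum_(i <- r | i \in A) f i.
Proof.
move=> ur fr; rewrite (@bigfs _ _ _ _ r (fun i => i \in A)) //.
  by apply: eq_fsbigl; apply/seteqP; split=> i /=; [move/mem_set|move/set_mem].
by move=> i /set_mem; apply: fr.
Qed.

Lemma fsumT_seqE (r : seq T) (f : T -> V) : uniq r ->
  (forall i, i \notin r -> f i = 0) -> \sum_(i \in [set: T]) f i = \sum_(i <- r) f i.
Proof.
move=> ur fr; rewrite (fsum_seqE ur) => [|i _]; last exact: fr.
by apply: eq_bigl => i; rewrite mem_setT.
Qed.

Lemma fsumT1 (x : T) (f : T -> V) : (forall i, i != x -> f i = 0) ->
  \sum_(i \in [set: T]) f i = f x.
Proof.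
move=> fx; rewrite (@fsumT_seqE [:: x]) ?big_seq1 // => i.
by rewrite inE; apply: fx.
Qed.

End FiniteSums.

Lemma finite_uniq_seq (T : choiceType) (A : set T) : finite_set A ->
  exists2 s : seq T, uniq s & forall x, x \in s <-> A x.
Proof.
move=> /finite_seqP[s ->]; exists (undup s); rewrite ?undup_uniq // => x.
by rewrite mem_undup.
Qed.

Lemma poly_ext (K : numFieldType) (p q : {poly K}) :
  (forall x, p.[x] = q.[x]) -> p = q.
Proof.
move=> pq; apply/eqP; rewrite -subr_eq0; apply/negPn/negP => pq0.
pose s : seq K := [seq i%:R | i <- iota 0 (size (p - q))].
have su : uniq s by rewrite map_inj_uniq ?iota_uniq // => i j /eqP; rewrite eqr_nat => /eqP.
have sr : all (root (p - q)) s.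
  by apply/allP => x _; rewrite rootE hornerD hornerN pq subrr.
by have := max_poly_roots pq0 sr su; rewrite size_map size_iota ltnn.
Qed.

Lemma horner_pshift (K : fieldType) (a : K) f x : (pshift a f).[x] = f.[x + a].
Proof. by rewrite /pshift horner_comp !hornerE. Qed.

Lemma pshift_linear (K : fieldType) (a : K) : linear (pshift a).
Proof. by move=> b f h; rewrite /pshift comp_polyD comp_polyZ. Qed.

Lemma pshiftM (K : fieldType) (a : K) f h : pshift a (f * h) = pshift a f * pshift a h.
Proof. by rewrite /pshift rmorphM. Qed.

Lemma pshift0 (K : fieldType) (a : K) : pshift a 0 = 0.
Proof. exact: lin0 (pshift_linear a). Qed.

Section HomogeneousSeq.
Variables (K : numFieldType) (g : graded_lie K).

Lemma homog_seq (x : g) (s : seq (int * g)) :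
    (forall p, p \in s -> lie_homog p.1 p.2) -> x = \sum_(p <- s) p.2 ->
  exists n (k : 'I_n -> int) (e : 'I_n -> g),
    (forall i, lie_homog (k i) (e i)) /\ x = \sum_i e i.
Proof.
move=> sh ->; exists (size s), (fun i => (tnth (in_tuple s) i).1).
exists (fun i => (tnth (in_tuple s) i).2); split; last by rewrite big_tnth.
by move=> i; apply: sh; rewrite mem_tnth.
Qed.

End HomogeneousSeq.

Section DhatGraded.
Variable K : numFieldType.
Implicit Types (f h : {poly K}) (x y : Dhat K).

(* t^k f(D) lies in the subalgebra iff f(-w - kappa) = sg * f(w) *)
Definition kappa (eps : dsign) (k : int) : K :=
  match eps with Dminus => k%:~R | Dplus => (k + 1)%:~R end.

Definition sg (eps : dsign) (k : int) : K :=
  match eps with Dminus => - (-1) ^ k | Dplus => -1 end.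

Lemma signz_odd (k : int) : (-1 : K) ^ k = if odd `|k|%N then -1 else 1.
Proof.
case: k => k; first by rewrite -exprnP -signr_odd; case: (odd k).
rewrite NegzE -exprz_inv invrN invr1 -exprnP -signr_odd abszN /=.
by case: (odd k).
Qed.

Lemma sgD eps k l : sg eps (k + l) = - (sg eps k * sg eps l).
Proof.
by case: eps; rewrite /= ?mulrNN ?mulr1 // expfzDr ?oppr_eq0 ?oner_eq0.
Qed.

Lemma sg_sqr eps k : sg eps k * sg eps k = 1.
Proof.
case: eps; rewrite /= ?mulrNN ?mulr1 // signz_odd.
by case: odd; rewrite ?mulrNN mulr1.
Qed.

Definition twisted eps k f := forall z, f.[- z - kappa eps k] = sg eps k * f.[z].

Lemma even_odd_twisted (c e : K) f : (exists h, f = pshift (c / 2) h /\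
    h \Po (- 'X) = e *: h) <-> (forall z, f.[- z - c] = e * f.[z]).
Proof.
split=> [[h [-> hE]] z|fE].
  rewrite !horner_pshift -hornerZ -hE horner_comp !hornerE.
  by congr h.[_]; field.
exists (pshift (- (c / 2)) f); split.
  by apply: poly_ext => z; rewrite !horner_pshift addrK.
apply: poly_ext => z; rewrite horner_comp hornerZ !horner_pshift -fE !hornerE.
by congr f.[_]; field.
Qed.

Lemma DhatP eps x : Dhat_mem eps x <->
  finite_set [set k : int | x.1 k != 0] /\ forall k, twisted eps k (x.1 k).
Proof.
have E k f : (exists h, match eps with
       | Dminus => f = pshift (k%:~R / 2) h /\
                   (if odd `|k|%N then even_fun h else odd_fun h)
       | Dplus => f = pshift ((k + 1)%:~R / 2) h /\ odd_fun h
       end) <-> twisted eps k f.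
  rewrite /twisted -(even_odd_twisted (kappa eps k)).
  case: eps; rewrite /= /even_fun /odd_fun; last first.
    by split=> -[h [-> hE]]; exists h; split=> //; rewrite hE scaleN1r.
  rewrite signz_odd; case: odd; rewrite ?opprK.
    by split=> -[h [-> hE]]; exists h; split=> //; rewrite hE scale1r.
  by split=> -[h [-> hE]]; exists h; split=> //; rewrite hE scaleN1r.
by split=> -[fx xE]; split=> // k; apply/E/xE.
Qed.

Lemma Psi0_nat (r : nat) f h :
  Psi0 r f h = \sum_(l < r) f.[l%:R - r%:R] * h.[l%:R].
Proof.
rewrite /Psi0 (@fsum_seqE _ _ _ [seq l%:Z - r%:Z | l <- iota 0 r]); last 2 first.
- by rewrite map_inj_uniq ?iota_uniq // => i j; lia.
- move=> i /= ir /mapP; case; exists (absz (i + r%:Z)); last by lia.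
  by rewrite mem_iota; lia.
rewrite big_map big_mkcond /= -(big_mkord xpredT (fun l => f.[l%:R - r%:R] * h.[l%:R])).
rewrite /index_iota subn0 big_seq [RHS]big_seq; apply: eq_bigr => l.
rewrite mem_iota add0n => /andP[_ lr]; rewrite ifT; last first.
  by apply/mem_set => /=; lia.
by rewrite subrK rmorphB.
Qed.

Lemma Psi_r0 r f : Psi r f 0 = 0.
Proof.
by rewrite /Psi /Psi0; case: ifP => _; rewrite fsbig1 ?oppr0 // => j _;
  rewrite !hornerE.
Qed.

Lemma Psi_0r r f : Psi r 0 f = 0.
Proof.
by rewrite /Psi /Psi0; case: ifP => _; rewrite fsbig1 ?oppr0 // => j _;
  rewrite !hornerE.
Qed.

Lemma Dhat_br1 k x y n : (forall r, r != k -> x.1 r = 0) ->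
  (Dhat_br x y).1 n =
  pshift (n - k)%:~R (x.1 k) * y.1 (n - k) - x.1 k * pshift k%:~R (y.1 (n - k)).
Proof.
by move=> xk; rewrite /Dhat_br /= (fsumT1 (x := k)) // => r /xk ->;
  rewrite pshift0 !mul0r subr0.
Qed.

Lemma Dhat_br2 k x y : (forall r, r != k -> x.1 r = 0) ->
  (Dhat_br x y).2 = Psi k (x.1 k) (y.1 (- k)).
Proof.
by move=> xk; rewrite /Dhat_br /= (fsumT1 (x := k)) // => r /xk ->;
  rewrite Psi_0r.
Qed.

(** In the + case D itself lies outside the subalgebra; adding 1/2 brings it inside without changing
    its brackets. *)
Definition Dhat_grading (eps : dsign) : Dhat K :=
  Dhat_poly (match eps with Dminus => 'X | Dplus => 'X + (2^-1)%:P end).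

Lemma Dhat_deg_finite k x : Dhat_deg k x -> finite_set [set n : int | x.1 n != 0].
Proof.
move=> [xk _]; apply: (@sub_finite_set _ _ [set k]); last exact: finite_set1.
by move=> n /= xn; apply: contrapT => /eqP /xk x0; rewrite x0 eqxx in xn.
Qed.

Lemma Dhat_mem_lin eps a x y : Dhat_mem eps x -> Dhat_mem eps y ->
  Dhat_mem eps (a *: x + y).
Proof.
move=> /DhatP[fx xE] /DhatP[fy yE]; apply/DhatP; split.
  apply: (@sub_finite_set _ _ ([set k : int | x.1 k != 0] `|` [set k : int | y.1 k != 0])).
    move=> k xyk; have {xyk} : a *: x.1 k + y.1 k != 0 := xyk.
    have [->|xk _] := eqVneq (x.1 k) 0; last by left.
    by rewrite scaler0 add0r; right.
  by rewrite finite_setU.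
move=> k z; rewrite -[(_ + _).1 k]/(a *: x.1 k + y.1 k).
by rewrite !hornerE xE yE; ring.
Qed.

Lemma Dhat_eq x y : x.1 = y.1 -> x.2 = y.2 -> x = y.
Proof. by case: x y => [? ?] [? ?] /= -> ->. Qed.

Lemma Dhat_graded eps : @graded_closed K (Dhat_lie K eps) (Dhat_grading eps).
Proof.
split.
- exact: Dhat_mem_lin.
- move=> k l x y [/DhatP[fx xE] [xk _]] [/DhatP[fy yE] [yl _]].
  have br_deg : Dhat_deg (k + l) (Dhat_br x y).
    split=> [n nkl|kl0].
      by rewrite (Dhat_br1 _ _ xk) yl ?pshift0 ?mulr0 ?subr0 //; lia.
    by rewrite (Dhat_br2 _ xk) yl ?Psi_r0 //; lia.
  split=> //; apply/DhatP; split; first exact: Dhat_deg_finite br_deg.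
  move=> n z; have [->|nkl] := eqVneq n (k + l); last first.
    by case: br_deg => -> // _; rewrite !horner0 mulr0.
  rewrite (Dhat_br1 _ _ xk) addrAC subrr add0r !hornerE !horner_pshift sgD.
  (* The reflection for degree k + l followed by a shift by [l] or [k] is the reflection for degree
     [k] or [l], so it exchanges the two terms of the bracket. *)
  have kD : kappa eps (k + l) = kappa eps k + l%:~R /\
            kappa eps (k + l) = kappa eps l + k%:~R.
    by case: (eps); rewrite /= !rmorphD /=; split; ring.
  have -> : - z - kappa eps (k + l) + l%:~R = - z - kappa eps k by case: kD => -> _; ring.
  have -> : - z - kappa eps (k + l) + k%:~R = - z - kappa eps l by case: kD => _ ->; ring.
  have e1 : - z - kappa eps (k + l) = - (z + l%:~R) - kappa eps k by case: kD => -> _; ring.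
  have e2 : - z - kappa eps (k + l) = - (z + k%:~R) - kappa eps l by case: kD => _ ->; ring.
  rewrite [in X in _ * X - _]e2 [in X in _ - X * _]e1 !xE !yE; ring.
- move=> x /= /DhatP[fx xE].
  have [r ru rE] := finite_uniq_seq fx.
  pose c (k : int) : Dhat K := (fun n : int => if n == k then x.1 n else 0, 0).
  pose s := (0, (0, x.2) : Dhat K) :: [seq (k, c k) | k <- r].
  apply: (@homog_seq K (Dhat_lie K eps) x s).
    move=> p; rewrite inE => /orP[/eqP ->|/mapP[k _ ->]] /=.
      split; last by split.
      apply/DhatP; split=> [|k z]; last by rewrite !horner0 mulr0.
      by apply: (@sub_finite_set _ _ set0) => // k /=; rewrite eqxx.
    have cd : Dhat_deg k (c k) by split=> // n /negPf; rewrite /c /= => ->.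
    split=> //; apply/DhatP; split; first exact: Dhat_deg_finite cd.
    move=> n z; rewrite /c /=; case: eqP => [_|_]; first exact: xE.
    by rewrite !horner0 mulr0.
  rewrite /s big_cons big_map /=.
  have sE (q : seq int) : \sum_(k <- q) c k = (\sum_(k <- q) (c k).1, 0).
    elim: q => [|k q IH]; first by rewrite !big_nil.
    by rewrite !big_cons IH; congr pair; rewrite addr0.
  rewrite sE; apply: Dhat_eq; last by rewrite /= addr0.
  apply/funext => n; rewrite /= add0r fct_sumE /c /= -big_mkcond /=.
  have [xn0|xn0] := eqVneq (x.1 n) 0.
    by rewrite big1 // => k /eqP <-.
  rewrite -big_filter (_ : [seq k <- _ | n == k] = [:: n]) ?big_seq1 //.
  rewrite (eq_filter (a2 := pred1 n)) => [|k]; last by rewrite /= eq_sym.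
  by rewrite filter_pred1_uniq //; apply/rE.
- split; last first.
    split=> //= n; rewrite /Dhat_grading /Dhat_poly /=; by case: eqP.
  apply/DhatP; split.
    apply: (@sub_finite_set _ _ [set 0]); last exact: finite_set1.
    move=> n /=; apply: contraNeq => /negPf n0.
    by rewrite /Dhat_grading /Dhat_poly /= n0.
  move=> k z; rewrite /Dhat_grading /Dhat_poly /=; case: eqP => [->|_]; last first.
    by rewrite !horner0 mulr0.
  case: eps; rewrite /= !hornerE /=; last by field.
  by rewrite expr0z; ring.
move=> k x [_ [xk x2]].
have dk (r : int) : r != 0 -> (Dhat_grading eps).1 r = 0.
  by rewrite /Dhat_grading /Dhat_poly /= => /negPf ->.
apply: Dhat_eq.
  apply/funext => n; rewrite (Dhat_br1 _ _ dk) subr0 -[RHS]/(k%:~R *: x.1 n).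
  have [->|nk] := eqVneq n k; last by rewrite xk // pshift0 !mulr0 subr0 scaler0.
  apply: poly_ext => z; rewrite /Dhat_grading /Dhat_poly /=.
  by case: (eps); rewrite !hornerE !horner_pshift !hornerE; ring.
rewrite (Dhat_br2 _ dk) oppr0 /Psi lexx (Psi0_nat 0) big_ord0.
rewrite -[RHS]/(k%:~R * x.2).
have [->|k0] := eqVneq k 0; first by rewrite mul0r.
by rewrite x2 // mulr0.
Qed.

End DhatGraded.

(** * The matrix algebras *)

Section TruncatedPolynomials.
Variables (K : fieldType) (m : nat).
Local Notation inR := (@in_Rm K m).
Implicit Types (p q : {poly K}) (a b : Rm K m).

Lemma coef_in_Rm p j : (inR p : {poly K})`_j = if (j < m.+1)%N then p`_j else 0.
Proof.
rewrite /in_Rm /= mk_monic_Xn /=.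
rewrite -[in LHS](poly_take_drop m.+1 p) addrC.
rewrite Pdiv.RingMonic.rmodp_addl_mul_small ?monicXn //; last first.
  by rewrite size_polyXn ltnS size_take_poly.
by rewrite coef_take_poly.
Qed.

Lemma Rm_eqP a b : (forall j, (j < m.+1)%N -> (a : {poly K})`_j = (b : {poly K})`_j) -> a = b.
Proof.
have size_le (c : Rm K m) : (size (c : {poly K}) <= m.+1)%N.
  rewrite -ltnS; apply: leq_trans (size_mk_monic c) _.
  by rewrite mk_monic_Xn size_polyXn.
move=> ab; apply: val_inj; apply/polyP => j.
have [/ab//|mj] := ltnP j m.+1.
by rewrite !nth_default // (leq_trans (size_le _)).
Qed.

Lemma in_RmK a : inR (a : {poly K}) = a.
Proof. by apply: Rm_eqP => j jm; rewrite coef_in_Rm jm. Qed.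

Lemma in_Rm_eq p q : (forall j, (j < m.+1)%N -> p`_j = q`_j) -> inR p = inR q.
Proof. by move=> pq; apply: Rm_eqP => j jm; rewrite !coef_in_Rm jm pq. Qed.

Lemma in_RmD p q : inR (p + q) = inR p + inR q.
Proof. exact: in_qpolyD. Qed.

Lemma in_RmZ c p : inR (c *: p) = c *: inR p.
Proof. exact: in_qpolyZ. Qed.

Lemma in_RmM p q : inR (p * q) = inR p * inR q.
Proof. exact: in_qpolyM. Qed.

Lemma in_Rm1 : inR 1 = 1.
Proof. exact: in_qpoly1. Qed.

Lemma in_Rm0 : inR 0 = 0.
Proof. exact: in_qpoly0. Qed.

Lemma in_RmB p q : inR (p - q) = inR p - inR q.
Proof. by rewrite in_RmD -scaleN1r in_RmZ scaleN1r. Qed.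

Lemma coef_compN p j : (p \Po (- 'X))`_j = (-1) ^+ j * p`_j.
Proof.
elim/poly_ind: p j => [|p c IH] j; first by rewrite comp_poly0 !coef0 mulr0.
rewrite comp_polyD comp_polyM comp_polyX comp_polyC mulrN !coefD coefN !coefMX !coefC.
case: j => [|j] /=; first by rewrite oppr0 mul1r.
by rewrite IH !addr0 exprS mulN1r mulNr.
Qed.

Lemma Rm_neg_in p : Rm_neg (inR p) = inR (p \Po (- 'X)).
Proof. by apply: in_Rm_eq => j jm; rewrite !coef_compN coef_in_Rm jm. Qed.

Lemma Rm_neg_linear : linear (@Rm_neg K m).
Proof.
move=> c a b; rewrite -(in_RmK a) -(in_RmK b) -in_RmZ -in_RmD !Rm_neg_in.
by rewrite comp_polyD comp_polyZ in_RmD in_RmZ.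
Qed.

Lemma Rm_negM a b : Rm_neg (a * b) = Rm_neg a * Rm_neg b.
Proof.
rewrite -(in_RmK a) -(in_RmK b) -in_RmM !Rm_neg_in.
by rewrite comp_polyM in_RmM.
Qed.

Lemma Rm_neg1 : Rm_neg 1 = 1 :> Rm K m.
Proof. by rewrite -in_Rm1 Rm_neg_in comp_polyC. Qed.

Lemma Rm_neg0 : Rm_neg 0 = 0 :> Rm K m.
Proof. exact: lin0 Rm_neg_linear. Qed.

End TruncatedPolynomials.

Section GlhatGraded.
Variables (K : numFieldType) (m : nat).
Implicit Types (A B : imx K m) (X Y : glhat K m) (ty : infty_type).

Lemma imx_mull k A B i j : (forall i j, j - i != k -> A i j = 0) ->
  imx_mul A B i j = A i (i + k) * B (i + k) j.
Proof.
move=> Ak; rewrite /imx_mul (fsumT1 (x := i + k)) // => p pk.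
by rewrite Ak ?mul0r //; lia.
Qed.

Lemma imx_mulr k A B i j : (forall i j, j - i != k -> B i j = 0) ->
  imx_mul A B i j = A i (j - k) * B (j - k) j.
Proof.
move=> Bk; rewrite /imx_mul (fsumT1 (x := j - k)) // => p pk.
by rewrite Bk ?mulr0 //; lia.
Qed.

Lemma imx_commE k A B i j : (forall i j, j - i != k -> A i j = 0) ->
  imx_comm A B i j = A i (i + k) * B (i + k) j - B i (j - k) * A (j - k) j.
Proof.
by move=> Ak; rewrite -(imx_mull _ _ _ Ak) -(imx_mulr _ _ _ Ak).
Qed.

Lemma imx_commJ A i j : imx_comm (imx_J K m) A i j =
  ((i <= 0)%R%:R - (j <= 0)%R%:R) * A i j.
Proof.
rewrite (@imx_commE 0) => [|p q]; last first.
  by rewrite /imx_J; case: (p =P q) => [->|//]; rewrite subrr eqxx.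
by rewrite !addr0 ?subr0 /imx_J !eqxx mulrBl [A i j * _]mulrC.
Qed.

(** The difference of indicators is nonzero at only |k| indices, which makes the trace finite for
    infinite matrices. *)
Lemma imx_trJ k A B : (forall i j, j - i != k -> A i j = 0) ->
  imx_tr (imx_mul (imx_comm (imx_J K m) A) B) =
  \sum_(i \in [set: int]) ((i <= 0)%R%:R - (i + k <= 0)%R%:R) * A i (i + k) * B (i + k) i.
Proof.
move=> Ak; rewrite /imx_tr; apply: eq_fsbigr => i _.
rewrite (@imx_mull k) ?imx_commJ // => p q pq.
by rewrite imx_commJ Ak ?mulr0.
Qed.

(** The four classical subalgebras are fixed by one kind of involution sigma: reflect both indices
    by [flip], transpose, replace u by -u, multiply by [flip_sign]. *)
Definition flip ty (i : int) : int :=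
  match ty with c_infty | d_infty => 1 - i | _ => - i end.

Definition flip_sign ty (i j : int) : K :=
  match ty with b_infty | c_infty => (-1) ^ (i + j + 1) | _ => -1 end.

Lemma signz_sqr (k : int) : (-1 : K) ^ k * (-1) ^ k = 1.
Proof. by rewrite signz_odd; case: odd; rewrite ?mulrNN mulr1. Qed.

(** Gives sigma(AB) = -sigma(B) sigma(A), so the fixed matrices are closed under commutators. *)
Lemma flip_signM ty i p j : flip_sign ty i p * flip_sign ty p j = - flip_sign ty i j.
Proof.
have N1 : (-1 : K) != 0 by rewrite oppr_eq0 oner_eq0.
have E (x y z : K) : y * y = 1 -> x * y * -1 * (y * z * -1) = - (x * z * -1).
  by move=> yy; transitivity (x * z * (y * y)); [ring | rewrite yy; ring].
by case: ty; rewrite /= ?mulrNN ?mulr1 ?opprK // !expfzDr // E // signz_sqr.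
Qed.

Lemma imx_symP ty A : imx_sym ty A <-> (ty = gl_infty \/
  forall i j, A i j = flip_sign ty i j *: Rm_neg (A (flip ty j) (flip ty i))).
Proof.
case: ty => /=; split=> //; try (by left); try (by right); try (by case);
  try (by move=> AE; right=> i j; rewrite AE scaleN1r);
  by case=> // AE i j; rewrite AE scaleN1r.
Qed.

Lemma glhat_deg_fin k X : glhat_deg k X -> fin_diag X.1.
Proof.
move=> [Xk _]; apply: (@sub_finite_set _ _ [set k]); last exact: finite_set1.
move=> l /= [i Xil]; apply: contrapT => /eqP lk; move/eqP: Xil; apply.
by apply: Xk; rewrite addrC addKr.
Qed.

(** Diagonal entries -j, moved by 1/2 when the reflection is centred at 1/2, so that the matrix
    changes sign under [flip] and lies in the subalgebra. *)
Definition gl_grading ty : glhat K m :=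
  (fun i j => if i == j then
     ((match ty with c_infty | d_infty => 2^-1 | _ => 0 end) - j%:~R) *: 1 else 0, 0).

Lemma glhat_eq X Y : (forall i j, X.1 i j = Y.1 i j) -> X.2 = Y.2 -> X = Y.
Proof.
case: X Y => [A z] [B w] /= AB ->; congr pair.
by apply/funext => i; apply/funext => j.
Qed.

Lemma flipD ty i k : flip ty (i + k) = flip ty i - k.
Proof. by case: ty => /=; lia. Qed.

Lemma flipB ty i k : flip ty (i - k) = flip ty i + k.
Proof. by case: ty => /=; lia. Qed.

Lemma flip_sub ty i j : flip ty i - flip ty j = j - i.
Proof. by case: ty => /=; lia. Qed.

Lemma glhat_sum1 (I : Type) (r : seq I) (F : I -> glhat K m) i j :
  (\sum_(k <- r) F k).1 i j = \sum_(k <- r) (F k).1 i j.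
Proof. by elim: r => [|k r IH]; rewrite ?big_nil // !big_cons -IH. Qed.

Lemma glhat_sum2 (I : Type) (r : seq I) (F : I -> glhat K m) :
  (\sum_(k <- r) F k).2 = \sum_(k <- r) (F k).2.
Proof. by elim: r => [|k r IH]; rewrite ?big_nil // !big_cons -IH. Qed.

Lemma glhat_graded ty : @graded_closed K (infty_lie K m ty) (gl_grading ty).
Proof.
split.
- move=> a X Y [fX /imx_symP sX] [fY /imx_symP sY].
  have E i j : (a *: X + Y).1 i j = a *: X.1 i j + Y.1 i j by [].
  split.
    apply: (@sub_finite_set _ _ ([set k : int | exists i, X.1 i (i + k) != 0] `|`
        [set k : int | exists i, Y.1 i (i + k) != 0])); last by rewrite finite_setU.
    move=> k [i Xi]; move: Xi; rewrite E; have [->|Xi _] := eqVneq (X.1 i (i + k)) 0.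
      by rewrite scaler0 add0r => Yi; right; exists i.
    by left; exists i.
  apply/imx_symP; case: sX => [->|sX]; first by left.
  case: sY => [->|sY]; first by left.
  right=> i j; rewrite !E sX sY Rm_neg_linear scalerDr !scalerA.
  by rewrite [a * _]mulrC.
- move=> k l X Y [[fX /imx_symP sX] [Xk X2]] [[fY /imx_symP sY] [Yl Y2]].
  have dXY : glhat_deg (k + l) (glhat_br X Y).
    split=> [i j ijkl|kl0].
      rewrite /glhat_br /= (imx_commE _ _ _ Xk).
      by rewrite Yl ?[Y.1 i _]Yl ?mulr0 ?mul0r ?subrr //; lia.
    rewrite /glhat_br /= (imx_trJ _ Xk) fsbig1 // => i _.
    by rewrite Yl ?mulr0 //; lia.
  split=> //; split; first exact: glhat_deg_fin dXY.
  apply/imx_symP; case: sX => [->|sX]; first by left.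
  case: sY => [->|sY]; first by left.
  right=> i j; rewrite /glhat_br /= !(imx_commE _ _ _ Xk).
  rewrite (sX i (i + k)) (sY (i + k) j) (sY i (j - k)) (sX (j - k) j).
  rewrite -!scalerAl -!scalerAr !scalerA !flip_signM -!Rm_negM flipD flipB.
  rewrite -scalerBr -(linB (@Rm_neg_linear _ _)) scaleNr -scalerN.
  congr (_ *: _).
  by rewrite -scaleN1r -(linZ (@Rm_neg_linear _ _)) scaleN1r opprB ![_ * X.1 _ _]mulrC.
- move=> X [fX /imx_symP sX].
  have [r ru rE] := finite_uniq_seq fX.
  pose c (k : int) : glhat K m := (fun i j => if j - i == k then X.1 i j else 0, 0).
  pose s := (0, (0, X.2) : glhat K m) :: [seq (k, c k) | k <- r].
  apply: (@homog_seq K (infty_lie K m ty) X s).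
    move=> p; rewrite inE => /orP[/eqP ->|/mapP[k _ ->]] /=.
      have d0 : glhat_deg 0 ((0, X.2) : glhat K m) by split.
      split=> //; split; first exact: glhat_deg_fin d0.
      apply/imx_symP; right=> i j /=.
      by rewrite -[(0 : imx K m) _ _]/(0 : Rm K m) -[(0 : imx K m) (flip _ _) _]/(0 : Rm K m) Rm_neg0 scaler0.
    have dc : glhat_deg k (c k) by split=> // i j /negPf; rewrite /c /= => ->.
    split=> //; split; first exact: glhat_deg_fin dc.
    apply/imx_symP; case: sX => [->|sX]; [by left|right=> i j].
    rewrite /c /= flip_sub; case: eqP => _; first exact: sX.
    by rewrite Rm_neg0 scaler0.
  rewrite /s big_cons big_map /=; apply: glhat_eq => [i j|] /=.
    rewrite -[RHS]/(0 + (\sum_(k <- r) c k).1 i j) add0r glhat_sum1 /c /= -big_mkcond /=.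
    have [x0|xn0] := eqVneq (X.1 i j) 0; first by rewrite x0 big1.
    rewrite -big_filter (eq_filter (a2 := pred1 (j - i))) => [|k]; last by rewrite /= eq_sym.
    rewrite filter_pred1_uniq ?big_seq1 //; apply/rE; exists i.
    by rewrite addrC subrK.
  by rewrite -[RHS]/(X.2 + (\sum_(k <- r) c k).2) glhat_sum2 big1 ?addr0.
- have d0 : glhat_deg 0 (gl_grading ty).
    split=> // i j ij; rewrite /gl_grading /= ifF //; apply/negP => /eqP e.
    by rewrite e subrr eqxx in ij.
  split=> //; split; first exact: glhat_deg_fin d0.
  apply/imx_symP; right=> i j; rewrite /gl_grading /=.
  have -> : (flip ty j == flip ty i) = (i == j) by case: (ty) => /=; lia.
  case: eqP => [->|_]; last by rewrite Rm_neg0 scaler0.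
  rewrite (linZ (@Rm_neg_linear _ _)) Rm_neg1 scalerA; congr (_ *: _).
  have -> : flip_sign ty j j = -1.
    by case: (ty) => //=; rewrite !expfzDr ?oppr_eq0 ?oner_eq0 // signz_sqr mul1r.
  by case: (ty) => /=; rewrite ?rmorphB ?rmorphN /=; field.
move=> k X [_ [Xk X2]]; have dE (i j : int) : j - i != 0 -> (gl_grading ty).1 i j = 0.
  move=> ij; rewrite /gl_grading /= ifF //; apply/negP => /eqP e.
  by rewrite e subrr eqxx in ij.
apply: glhat_eq => [i j|] /=.
  rewrite (imx_commE _ _ _ dE) addr0 ?subr0 /gl_grading /= !eqxx.
  rewrite -[RHS]/(k%:~R *: X.1 i j).
  have [<-|ijk] := eqVneq (j - i) k; last by rewrite Xk // mulr0 mul0r subrr scaler0.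
  rewrite -scalerAl mul1r -scalerAr mulr1 -scalerBl rmorphB; congr (_ *: _); ring.
rewrite (imx_trJ _ dE) fsbig1 => [|i _]; last by rewrite addr0 subrr !mul0r.
rewrite -[RHS]/(k%:~R *: X.2).
have [->|k0] := eqVneq k 0; first by rewrite scale0r.
by rewrite X2 // scaler0.
Qed.

End GlhatGraded.

(** * The homomorphisms *)

Section Pairing.
Variable K : numFieldType.
Implicit Types (f h : fps K) (p q : {poly K}).

(* <f, p> = p(d/dx) f at x = 0, so that <f, w^n> is n! times the n-th         *)
(* coefficient; multiplication by e^{ax} is adjoint to the shift by a.        *)
Definition pairing f p : K := \sum_(n < size p) p`_n * n`!%:R * f n.

Lemma pairingE N f p : (size p <= N)%N ->
  pairing f p = \sum_(n < N) p`_n * n`!%:R * f n.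
Proof.
move=> pN; rewrite /pairing (big_ord_widen _ (fun n => p`_n * n`!%:R * f n) pN).
rewrite big_mkcond; apply: eq_bigr => i _; case: ltnP => // pi.
by rewrite nth_default // !mul0r.
Qed.

Lemma pairing_linear f : linear (pairing f : {poly K} -> K^o).
Proof.
move=> a p q; have := leq_maxl (size p) (size q); have := leq_maxr (size p) (size q).
set N := maxn _ _ => qN pN.
have pqN : (size (a *: p + q)%R <= N)%N.
  by rewrite (leq_trans (size_polyD _ _)) // geq_max qN (leq_trans (size_scale_leq _ _)).
rewrite (pairingE f pqN) (pairingE f pN) (pairingE f qN) scaler_sumr -big_split.
apply: eq_bigr => i _ /=; rewrite coefD coefZ -[RHS]/(a * _ + _); ring.
Qed.

Lemma pairing_lincomb a f h p : pairing (a *: f + h) p = a * pairing f p + pairing h p.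
Proof.
rewrite /pairing mulr_sumr -big_split; apply: eq_bigr => i _ /=.
by rewrite -[LHS]/(p`_i * i`!%:R * (a * f i + h i)); ring.
Qed.

Lemma pairingB f h p : pairing (f - h) p = pairing f p - pairing h p.
Proof. by rewrite addrC -scaleN1r pairing_lincomb mulN1r addrC. Qed.

Lemma pairingZ a f p : pairing (a *: f) p = a * pairing f p.
Proof. by rewrite /pairing mulr_sumr; apply: eq_bigr => i _; rewrite mulrCA. Qed.

Lemma pairingXn f n : pairing f 'X^n = n`!%:R * f n.
Proof.
rewrite /pairing size_polyXn (bigD1 ord_max) //= coefXn eqxx mul1r big1 ?addr0 //.
move=> i; rewrite -val_eqE /= => /negPf ni.
by rewrite coefXn ni !mul0r.
Qed.

Lemma poly_linear_ext (V : lmodType K) (F G : {poly K} -> V) :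
  linear F -> linear G -> (forall n, F 'X^n = G 'X^n) -> forall p, F p = G p.
Proof.
move=> Fl Gl FG p; rewrite -[p]coefK poly_def.
rewrite (lin_sum Fl) (lin_sum Gl); apply: eq_bigr => i _.
by rewrite (linZ Fl) (linZ Gl) FG.
Qed.

Lemma pairing_exp f a p :
  pairing (fps_mul f (fps_exp a)) p = pairing f (pshift a p).
Proof.
move: p; apply: (poly_linear_ext (V := K^o)) => [||n].
- exact: pairing_linear.
- by move=> b p q; rewrite pshift_linear pairing_linear.
rewrite pairingXn /pshift comp_Xn_poly addrC exprDn.
rewrite (lin_sum (pairing_linear f)) /fps_mul mulr_sumr; apply: eq_bigr => i _.
have ni : (i <= n)%N by rewrite -ltnS.
have -> : a%:P ^+ (n - i) * 'X^i *+ 'C(n, i) = (a ^+ (n - i) *+ 'C(n, i)) *: 'X^i.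
  by rewrite -rmorphXn /= mul_polyC scalerMnl.
rewrite (linZ (pairing_linear f)) pairingXn -[RHS]/(_ * _) -mulr_natr /fps_exp.
have fn0 : ((n - i)`!%:R : K) != 0 by rewrite pnatr_eq0 -lt0n fact_gt0.
have -> : n`!%:R = 'C(n, i)%:R * i`!%:R * (n - i)`!%:R :> K.
  by rewrite -!natrM -mulnA bin_fact.
by field.
Qed.

Lemma pairing_fps_Xn j p : pairing (fps_Xn K j) p = j`!%:R * p`_j.
Proof.
have jS : (size p <= maxn (size p) j.+1)%N by exact: leq_maxl.
rewrite (pairingE _ jS).
have jN : (j < maxn (size p) j.+1)%N by exact: leq_maxr.
rewrite (bigD1 (Ordinal jN)) //= /fps_Xn eqxx mulr1 big1 ?addr0 => [|i]; last first.
  by rewrite -val_eqE /= => /negPf ->; rewrite mulr0.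
by rewrite mulrC.
Qed.

Lemma fps_1mul f : fps_mul (fps1 K) f = f.
Proof.
apply/funext => n; rewrite /fps_mul big_ord_recl /= /fps1 eqxx mul1r subn0.
by rewrite big1 ?addr0 // => i _; rewrite mul0r.
Qed.

Lemma fps1_exp : fps1 K = fps_exp 0.
Proof.
apply/funext => n; rewrite /fps1 /fps_exp; case: n => [|n].
  by rewrite expr0 fact0 divr1.
by rewrite expr0n /= mul0r.
Qed.

Lemma pshift_id p : pshift 0 p = p.
Proof. by apply: poly_ext => z; rewrite horner_pshift addr0. Qed.

Lemma pshiftD a b p : pshift a (pshift b p) = pshift (a + b) p.
Proof. by apply: poly_ext => z; rewrite !horner_pshift addrA. Qed.

Lemma fps_mulBr f h1 h2 : fps_mul f (h1 - h2) = fps_mul f h1 - fps_mul f h2.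
Proof.
apply/funext => n; rewrite -[RHS]/(_ - _) /fps_mul -sumrB; apply: eq_bigr => i _.
by rewrite -mulrBr.
Qed.

Lemma fps_mulDr f h1 h2 : fps_mul f (h1 + h2) = fps_mul f h1 + fps_mul f h2.
Proof.
apply/funext => n; rewrite -[RHS]/(_ + _) /fps_mul -big_split; apply: eq_bigr => i _ /=.
by rewrite -mulrDr.
Qed.

Lemma fps_mulZr f a h : fps_mul f (a *: h) = a *: fps_mul f h.
Proof.
apply/funext => n; rewrite -[RHS]/(a * _) /fps_mul mulr_sumr; apply: eq_bigr => i _.
by rewrite mulrCA.
Qed.

Lemma pairing_fps_exp a p : pairing (fps_exp a) p = p.[a].
Proof.
rewrite -(fps_1mul (fps_exp a)) pairing_exp (pairing_fps_Xn 0) mul1r.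
by rewrite -horner_coef0 horner_pshift add0r.
Qed.

Lemma pairing_fps1 p : pairing (fps1 K) p = p.[0].
Proof. by rewrite fps1_exp pairing_fps_exp. Qed.

(** Multiplication by e^x - 1 is adjoint to q(w + 1) - q(w), so the denominator of [phi_corr]
    disappears on differences. *)
Lemma pairing_phi_corr s i q :
  pairing (phi_corr s i) (pshift 1 q - q) = (pshift s q)`_i - (i == 0%N)%:R * q.[0].
Proof.
have e0 (a : K) : fps_exp a 0%N = 1 by rewrite /fps_exp expr0 fact0 divr1.
have : fps_mul (phi_corr s i) (fps_exp 1 - fps1 K) =
    if i == 0%N then fps_exp s - fps1 K
     else (i`!%:R)^-1 *: fps_mul (fps_Xn K i) (fps_exp s).
  apply: fps_divK.
  - case: eqP => [_|/eqP/negPf i0]; first by rewrite -[LHS]/(_ - _) e0 /fps1 subrr.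
    rewrite -[LHS]/(_ * _) /fps_mul big_ord_recl big_ord0 /fps_Xn eq_sym i0.
    by rewrite mul0r addr0 mulr0.
  - by rewrite -[LHS]/(_ - _) e0 /fps1 subrr.
  by rewrite -[X in X != 0]/(_ - _) /fps_exp /fps1 expr1 subr0 divr1 oner_eq0.
move=> /(congr1 (fun f => pairing f q)).
rewrite fps_mulBr pairingB pairing_exp fps1_exp pairing_exp pshift_id.
rewrite -(linB (pairing_linear _)) => ->.
case: eqP => [->|_]; last first.
  rewrite pairingZ pairing_exp pairing_fps_Xn mul0r subr0 mulKf //.
  by rewrite pnatr_eq0 -lt0n fact_gt0.
rewrite pairingB !pairing_fps_exp mul1r; congr (_ - _).
by rewrite -horner_coef0 horner_pshift add0r.
Qed.

End Pairing.

(** * Compatibility of [phihat] with brackets, grading and symmetry *)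

Section PhiHat.
Variables (K : numFieldType) (m : nat) (s : K).
Implicit Types (f h p q : {poly K}) (x y : Dhat K).

Definition phi_central p : Rm K m :=
  \sum_(i < m.+1) pairing (phi_corr s i) p *: 'qX ^+ i.

Lemma sum_qX (c : nat -> K) :
  \sum_(i < m.+1) c i *: 'qX ^+ i = @in_Rm K m (\poly_(i < m.+1) c i).
Proof.
rewrite poly_def /in_Rm raddf_sum; apply: eq_bigr => i _.
by rewrite -[LHS]/(_ *: in_qpoly _ _ ^+ i) -rmorphXn /= in_qpolyZ.
Qed.

Lemma coef_phi_central p j : (phi_central p : {poly K})`_j =
  if (j < m.+1)%N then pairing (phi_corr s j) p else 0.
Proof.
by rewrite /phi_central (sum_qX (fun i => pairing (phi_corr s i) p)) coef_in_Rm coef_poly; case: (j < m.+1)%N.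
Qed.

Lemma phi_central_linear : linear phi_central.
Proof.
move=> a p q; rewrite /phi_central scaler_sumr -big_split; apply: eq_bigr => i _ /=.
by rewrite (pairing_linear _ a) scalerDl scalerA.
Qed.

(* up to a constant, phi_central p is the discrete antiderivative of p at s + u *)
Lemma phi_central_diff q :
  phi_central (pshift 1 q - q) = in_Rm m (pshift s q) - q.[0] *: 1.
Proof.
have -> : in_Rm m (pshift s q) - q.[0] *: 1 = in_Rm m (pshift s q - q.[0] *: 1).
  by rewrite in_RmB in_RmZ in_Rm1.
apply: Rm_eqP => j jm; rewrite coef_phi_central coef_in_Rm jm pairing_phi_corr.
by rewrite coefB coefZ coef1 mulrC.
Qed.

Lemma phihat2 x : (phihat m s x).2 = x.2 *: 1 - phi_central (x.1 0).
Proof.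
rewrite /phihat /phi_central /=; congr (_ - _).
under eq_bigr do rewrite scaler_sumr.
rewrite exchange_big; apply: eq_bigr => i _ /=.
by rewrite /pairing scaler_suml; apply: eq_bigr => k _; rewrite scalerA.
Qed.

Lemma phi_linear a x y i j :
  phi m s (a *: x + y).1 i j = a *: phi m s x.1 i j + phi m s y.1 i j.
Proof.
rewrite /phi -in_RmZ -in_RmD; congr in_Rm.
by rewrite -pshift_linear.
Qed.

Lemma phihat_linear : linear (@phihat K m s : Dhat K -> glhat K m).
Proof.
move=> a x y; apply: glhat_eq => [i j|]; first exact: phi_linear.
rewrite -[RHS]/(a *: (phihat m s x).2 + (phihat m s y).2) !phihat2.
rewrite -[(_ + _).2]/(a * x.2 + y.2) -[(_ + _).1 0]/(a *: x.1 0 + y.1 0).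
rewrite phi_central_linear scalerDl scalerBr scalerA; ring.
Qed.

Lemma phihat_deg k x : Dhat_deg k x -> glhat_deg k (phihat m s x).
Proof.
move=> [xk x2]; split=> [i j ij|k0].
  by rewrite /phihat /= /phi xk // pshift0 in_Rm0.
by rewrite phihat2 x2 // xk 1?eq_sym // (lin0 phi_central_linear) scale0r subr0.
Qed.

Lemma trace_term_range (k : int) (h : {poly K}) :
  \sum_(i \in [set: int]) ((i <= 0)%R%:R - (i + k <= 0)%R%:R) *
     in_Rm m (pshift (s - i%:~R) h) =
  if 0 <= k then \sum_(l < `|k|%N) in_Rm m (pshift (s + l%:R) h)
  else - \sum_(l < `|k|%N) in_Rm m (pshift (s - `|k|%N%:R + l%:R) h).
Proof.
case: ifP => k0.
  rewrite (fsumT_seqE (r := [seq - l%:Z | l <- iota 0 `|k|%N])).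
  - rewrite big_map -(big_mkord xpredT (fun l => in_Rm m (pshift (s + l%:R) h))).
    rewrite /index_iota subn0 big_seq [RHS]big_seq; apply: eq_bigr => l.
    rewrite mem_iota => lk.
    have -> : (- l%:Z <= 0)%R = true by lia.
    have -> : (- l%:Z + k <= 0)%R = false by lia.
    by rewrite subr0 mul1r rmorphN opprK.
  - by rewrite map_inj_uniq ?iota_uniq // => i j; lia.
  move=> i /mapP ir; suff -> : (i <= 0)%R = (i + k <= 0)%R by rewrite subrr mul0r.
  apply/idP/idP; last by lia.
  move=> i0; apply: contrapT => /negP ik; apply: ir; exists (absz i); last by lia.
  by rewrite mem_iota; lia.
rewrite (fsumT_seqE (r := [seq `|k|%N%:Z - l%:Z | l <- iota 0 `|k|%N])).
- rewrite big_map -(big_mkord xpredT (fun l => in_Rm m (pshift (s - `|k|%N%:R + l%:R) h))).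
  rewrite /index_iota subn0 -sumrN big_seq [RHS]big_seq; apply: eq_bigr => l.
  rewrite mem_iota => lk.
  have -> : (`|k|%N%:Z - l%:Z <= 0)%R = false by lia.
  have -> : (`|k|%N%:Z - l%:Z + k <= 0)%R = true by lia.
  by rewrite sub0r mulN1r rmorphB /= opprB addrA addrAC.
- by rewrite map_inj_uniq ?iota_uniq // => i j; lia.
move=> i /mapP ir; suff -> : (i <= 0)%R = (i + k <= 0)%R by rewrite subrr mul0r.
apply/idP/idP; first by lia.
move=> i0; apply: contrapT => /negP ik; apply: ir; exists (absz k - absz i)%N; last by lia.
by rewrite mem_iota; lia.
Qed.

(** A difference of step [r] telescopes into unit differences, to which [phi_central_diff]
    applies. *)
Lemma phi_central_telescope (r : nat) h :
  phi_central (pshift r%:R h - h) =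
  \sum_(l < r) in_Rm m (pshift (s + l%:R) h) - (\sum_(l < r) h.[l%:R]) *: 1.
Proof.
pose Q := \sum_(l < r) pshift l%:R h.
have -> : pshift r%:R h - h = pshift 1 Q - Q.
  rewrite /Q (lin_sum (pshift_linear 1)).
  rewrite -sumrB (eq_bigr (fun l : 'I_r => pshift l.+1%:R h - pshift l%:R h)).
    rewrite -(big_mkord xpredT (fun l => pshift l.+1%:R h - pshift l%:R h)).
    by rewrite telescope_sumr // pshift_id.
  by move=> l _; rewrite pshiftD -natr1 [1 + _]addrC.
rewrite phi_central_diff /Q (lin_sum (pshift_linear s)) horner_sum.
rewrite /in_Rm raddf_sum; congr (_ - _ *: _); apply: eq_bigr => l _.
  by rewrite pshiftD.
by rewrite horner_pshift add0r.
Qed.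

(** With F(w) = f(w - k) h(w) the commutator is F(w) - F(w + k), whose discrete antiderivative is,
    up to sign, a sum of |k| shifts of F. Their values at s + u form the trace cocycle; the
    constants they leave are cancelled by [Psi]. *)
Lemma phihat_cocycle k f h :
  Psi k f h *: 1 - phi_central (pshift (- k)%:~R f * h - f * pshift k%:~R h) =
  \sum_(i \in [set: int]) ((i <= 0)%R%:R - (i + k <= 0)%R%:R) *
     in_Rm m (pshift (s - (i + k)%:~R) f) * in_Rm m (pshift (s - i%:~R) h).
Proof.
pose F := pshift (- k)%:~R f * h.
transitivity (\sum_(i \in [set: int]) ((i <= 0)%R%:R - (i + k <= 0)%R%:R) *
     in_Rm m (pshift (s - i%:~R) F)); last first.
  apply: eq_fsbigr => i _; rewrite /F pshiftM in_RmM mulrA pshiftD.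
  by rewrite intrD mulrNz opprD addrA.
have -> : f * pshift k%:~R h = pshift k%:~R F.
  by rewrite /F pshiftM pshiftD rmorphN subrr pshift_id.
rewrite -/F trace_term_range /Psi.
have FE z : F.[z] = f.[z - k%:~R] * h.[z] by rewrite hornerM horner_pshift mulrNz.
move: F FE => F FE; case: ifP => k0.
  have kE : k = `|k|%N%:Z by lia.
  move: (`|k|%N) kE => r kE; rewrite kE Psi0_nat.
  have -> : F - pshift r%:~R F = - (pshift r%:R F - F) by rewrite opprB.
  rewrite (linN phi_central_linear) phi_central_telescope opprK addrCA.
  rewrite -[RHS]addr0; congr (_ + _); apply/eqP; rewrite subr_eq0; apply/eqP.
  by congr (_ *: _); apply: eq_bigr => l _; rewrite FE kE.
have kE : k = - `|k|%N%:Z by lia.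
move: (`|k|%N) kE => r kE; rewrite kE opprK Psi0_nat.
have -> : F - pshift (- r%:Z)%:~R F = pshift r%:R (pshift (- r%:R) F) - pshift (- r%:R) F.
  by rewrite pshiftD subrr pshift_id mulrNz.
rewrite phi_central_telescope opprB scaleNr addrC -addrA -[RHS]addr0 addrCA.
congr (_ + _); first by congr (- _); apply: eq_bigr => l _; rewrite pshiftD addrAC.
apply/eqP; rewrite subr_eq0; apply/eqP; congr (_ *: _); apply: eq_bigr => l _.
by rewrite horner_pshift FE kE mulrNz opprK subrK mulrC.
Qed.

End PhiHat.

Section PhiHatMorphism.
Variables (K : numFieldType) (m : nat) (s : K).
Implicit Types (f h p q : {poly K}) (x y : Dhat K).

Definition zrange (B : nat) : seq int := [seq l%:Z - B%:Z | l <- iota 0 (B + B).+1].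

Lemma zrange_uniq B : uniq (zrange B).
Proof. by rewrite map_inj_uniq ?iota_uniq // => i j; lia. Qed.

Lemma mem_zrange B (k : int) : (k \in zrange B) = (`|k| <= B)%N.
Proof.
apply/mapP/idP => [[l]|kB]; first by rewrite mem_iota; lia.
by exists (absz (k + B%:Z)); rewrite ?mem_iota; lia.
Qed.

Lemma phi_zero x i j : x.1 (j - i) = 0 -> phi m s x.1 i j = 0.
Proof. by move=> x0; rewrite /phi x0 pshift0 in_Rm0. Qed.

Lemma phihat_br x y : finite_set [set k : int | x.1 k != 0] ->
  phihat m s (Dhat_br x y) = glhat_br (phihat m s x) (phihat m s y).
Proof.
move=> /finite_uniq_seq[r ru rE].
have xr k : k \notin r -> x.1 k = 0.
  by move=> kr; apply/eqP; apply: contraNT kr => /rE.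
have brE n : (Dhat_br x y).1 n = \sum_(k <- r)
    (pshift (n - k)%:~R (x.1 k) * y.1 (n - k) - x.1 k * pshift k%:~R (y.1 (n - k))).
  rewrite /Dhat_br /= (fsumT_seqE ru) // => k /xr ->.
  by rewrite pshift0 !mul0r subrr.
have mull i j : imx_mul (phi m s x.1) (phi m s y.1) i j =
    \sum_(k <- r) phi m s x.1 i (i + k) * phi m s y.1 (i + k) j.
  rewrite /imx_mul (fsumT_seqE (r := [seq i + k | k <- r])) ?big_map //.
    by rewrite map_inj_uniq // => k l /addrI.
  move=> p pr; rewrite phi_zero ?mul0r //; apply: xr; apply: contra pr => pr.
  by apply/mapP; exists (p - i); rewrite // addrC subrK.
have mulr i j : imx_mul (phi m s y.1) (phi m s x.1) i j =
    \sum_(k <- r) phi m s y.1 i (j - k) * phi m s x.1 (j - k) j.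
  rewrite /imx_mul (fsumT_seqE (r := [seq j - k | k <- r])) ?big_map //.
    by rewrite map_inj_uniq // => k l /addrI/oppr_inj.
  move=> p pr; rewrite [phi m s x.1 _ _]phi_zero ?mulr0 //; apply: xr; apply: contra pr => pr.
  by apply/mapP; exists (j - p); rewrite // subKr.
apply: glhat_eq => [i j|].
  rewrite -[LHS]/(in_Rm m (pshift (s - j%:~R) ((Dhat_br x y).1 (j - i)))) brE.
  rewrite -[RHS]/(imx_mul (phi m s x.1) (phi m s y.1) i j -
    imx_mul (phi m s y.1) (phi m s x.1) i j) mull mulr -sumrB /phi.
  rewrite (lin_sum (pshift_linear _)) /in_Rm raddf_sum; apply: eq_bigr => k _.
  rewrite -!in_qpolyM -[RHS]in_RmB; congr in_Rm.
  rewrite (linB (pshift_linear _)) !pshiftM !pshiftD.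
  have -> : i + k - i = k by lia.
  have -> : j - (i + k) = j - i - k by lia.
  have -> : j - k - i = j - i - k by lia.
  have -> : j - (j - k) = k by lia.
  have -> : s - (i + k)%:~R = s - j%:~R + (j - i - k)%:~R by rewrite !intrD !mulrNz; ring.
  have -> : s - (j - k)%:~R = s - j%:~R + k%:~R by rewrite !intrD !mulrNz; ring.
  by rewrite [X in _ = _ - X]mulrC.
rewrite phihat2 brE /= (lin_sum (phi_central_linear _ _)).
rewrite (fsumT_seqE ru) => [|k /xr ->]; last by rewrite Psi_0r.
rewrite scaler_suml -sumrB.
(* Beyond the largest |k| the conditions i <= 0 and i + k <= 0 agree, so one window [zrange B]
   serves all degrees of [x]. *)
have [B rB] : exists B, forall k, k \in r -> (`|k| <= B)%N.
  by exists (\max_(k <- r) `|k|)%N => k kr; apply: leq_bigmax_seq.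
rewrite /imx_tr.
transitivity (\sum_(i <- zrange B) \sum_(k <- r)
   ((i <= 0)%R%:R - (i + k <= 0)%R%:R) *
     in_Rm m (pshift (s - (i + k)%:~R) (x.1 k)) * in_Rm m (pshift (s - i%:~R) (y.1 (- k)))).
  rewrite exchange_big big_seq [RHS]big_seq; apply: eq_bigr => k kr /=.
  have := phihat_cocycle m s k (x.1 k) (y.1 (- k)).
  rewrite !sub0r => ->; rewrite (fsumT_seqE (zrange_uniq B)) // => i.
  rewrite mem_zrange => iB; suff -> : (i <= 0)%R = (i + k <= 0)%R by rewrite subrr !mul0r.
  by have kB := rB k kr; apply/idP/idP; lia.
have innerE i : imx_mul (imx_comm (imx_J K m) (phi m s x.1)) (phi m s y.1) i i =
   \sum_(k <- r) ((i <= 0)%R%:R - (i + k <= 0)%R%:R) *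
     in_Rm m (pshift (s - (i + k)%:~R) (x.1 k)) * in_Rm m (pshift (s - i%:~R) (y.1 (- k))).
  rewrite /imx_mul (fsumT_seqE (r := [seq i + k | k <- r])) ?big_map //.
  - apply: eq_bigr => k _; rewrite imx_commJ /phi.
    have -> : i + k - i = k by lia.
    by have -> : i - (i + k) = - k by lia.
  - by rewrite map_inj_uniq // => k l /addrI.
  move=> p pr; rewrite imx_commJ phi_zero ?mulr0 ?mul0r //; apply: xr; apply: contra pr => pr.
  by apply/mapP; exists (p - i); rewrite // addrC subrK.
rewrite (fsumT_seqE (zrange_uniq B)); first by apply: eq_bigr => i _; rewrite innerE.
move=> i; rewrite mem_zrange => iB; rewrite innerE big_seq big1 // => k kr.
suff -> : (i <= 0)%R = (i + k <= 0)%R by rewrite subrr !mul0r.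
by have kB := rB k kr; apply/idP/idP; lia.
Qed.

(* the index reflection [flip] corresponds to w |-> - w - kappa at w = s - j *)
Definition compatible (eps : dsign) (ty : infty_type) : Prop :=
  ty = gl_infty \/ forall i j : int,
    kappa K eps (j - i) = j%:~R + (flip ty i)%:~R - s *+ 2 /\
    sg K eps (j - i) * flip_sign K ty i j = 1.

Lemma compatibleP eps ty :
  [\/ ty = gl_infty, eps = Dminus /\ (ty = b_infty /\ s = 0 \/ ty = c_infty /\ s = 2^-1)
    | eps = Dplus /\ (ty = d_infty /\ s = 0 \/ ty = bt_infty /\ s = - 2^-1)] ->
  compatible eps ty.
Proof.
have sgE i j : - (-1 : K) ^ (j - i) * (-1) ^ (i + j + 1) = 1.
  have N1 : (-1 : K) != 0 by rewrite oppr_eq0 oner_eq0.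
  rewrite (_ : i + j + 1 = (j - i) + (i + i + 1)); last by lia.
  rewrite [in X in _ * X]expfzDr // mulrA mulNr signz_sqr.
  by rewrite !expfzDr // signz_sqr mul1r mulrNN mulr1.
have h2 : (2^-1 : K) *+ 2 = 1 by field.
rewrite /compatible; case=> [->|[-> [[-> ->]|[-> ->]]]|[-> [[-> ->]|[-> ->]]]]; [by left|..]; right=> i j;
  split; rewrite /= ?sgE ?mulrNN ?mulr1 //; rewrite ?mulNrn ?h2 ?mul0rn;
  by rewrite !(rmorphD, rmorphB, rmorphN) /=; ring.
Qed.

Lemma twisted_reflect eps ty k f i j : compatible eps ty -> ty <> gl_infty ->
    twisted eps k f -> j - i = k ->
  in_Rm m (pshift (s - j%:~R) f) =
  flip_sign K ty i j *: Rm_neg (in_Rm m (pshift (s - (flip ty i)%:~R) f)).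
Proof.
move=> [//|cP] _ fE ijk; have [kE sE] := cP i j; rewrite ijk in kE sE.
rewrite Rm_neg_in -in_RmZ; congr in_Rm; apply: poly_ext => z.
rewrite horner_pshift hornerZ horner_comp horner_pshift hornerN hornerX.
have -> : - z + (s - (flip ty i)%:~R) = - (z + (s - j%:~R)) - kappa K eps k.
  by rewrite kE; ring.
by rewrite fE mulrA [_ * sg _ _ _]mulrC sE mul1r.
Qed.

Lemma phihat_homog eps ty k x : compatible eps ty ->
  @lie_homog _ (Dhat_lie K eps) k x -> @lie_homog _ (infty_lie K m ty) k (phihat m s x).
Proof.
move=> cP [/DhatP[_ xE] xk]; have dx := phihat_deg m s xk; split=> //.
split; first exact: glhat_deg_fin dx.
apply/imx_symP; have [|tyN] := pselect (ty = gl_infty); [by left|right=> i j].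
rewrite /phihat /= /phi flip_sub.
exact: (twisted_reflect cP tyN (xE (j - i))).
Qed.

End PhiHatMorphism.

(** * Density of the image *)

Section Interpolation.
Variable K : numFieldType.
Implicit Types (f p : {poly K}).

Lemma invert_mod_Xn M (p t : {poly K}) : p.[0] != 0 ->
  exists q, forall j, (j < M)%N -> (p * q)`_j = t`_j.
Proof.
move=> p0; have cop : coprimep p 'X^M.
  apply: coprimep_expr.
  have := @coprimep_XsubC _ p 0; rewrite subr0 => ->.
  by rewrite rootE.
have [[u v] /= uvE] := Bezout_coprimepP _ _ cop.
have /eqP/size_poly1P[c c0 cE] : size (u * p + v * 'X^M) = 1%N.
  by rewrite (eqp_size uvE) size_poly1.
exists (c^-1 *: (u * t)) => j jM.
have -> : p * (c^-1 *: (u * t)) = t - (c^-1 *: (v * t)) * 'X^M.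
  rewrite -scalerAl -scalerAr; apply: (scalerI c0).
  rewrite scalerBr !scalerA divff // !scale1r -[c *: t]mul_polyC -cE; ring.
by rewrite coefB coefMXn jM subr0.
Qed.

(** Points are added one by one: the correction is a multiple of a polynomial that vanishes to order
    [M] at the earlier points and is invertible near the new one. *)
Lemma hermite_interpolation M (s : seq K) (A : K -> {poly K}) :
  exists f, forall z, z \in s -> forall j, (j < M)%N -> (pshift z f)`_j = (A z)`_j.
Proof.
elim: s => [|z0 s [f fE]]; first by exists 0.
have [z0s|z0s] := boolP (z0 \in s).
  by exists f => z; rewrite inE => /orP[/eqP ->|]; apply: fE.
pose P := \prod_(z <- s) ('X - z%:P) ^+ M.
have P0 : (pshift z0 P).[0] != 0.
  rewrite horner_pshift add0r /P horner_prod prodf_seq_neq0; apply/allP => z zs /=.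
  rewrite horner_exp hornerXsubC expf_eq0 negb_and subr_eq0; apply/orP; right.
  by apply: contraNneq z0s => ->.
have [q qE] := invert_mod_Xn M (A z0 - pshift z0 f) P0.
exists (f + P * pshift (- z0) q) => z zs j jM.
rewrite -[f]scale1r (pshift_linear z) scale1r coefD pshiftM.
move: zs; rewrite inE => /orP[/eqP ->|zs].
  by rewrite pshiftD subrr pshift_id qE // coefB addrC subrK.
rewrite fE // /P (big_rem z) //= !pshiftM -mulrA.
have -> : pshift z (('X - z%:P) ^+ M) = 'X^M.
  by apply: poly_ext => x; rewrite horner_pshift horner_exp hornerXsubC addrK hornerXn.
by rewrite coefXnM jM addr0.
Qed.

(** Symmetrizing adds to the jet at z the signed jet at the mirror point -z - kappa. *)
Lemma coef_twisted_sum eps k f z j :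
  let f' := f + sg K eps k *: (f \Po (- 'X - (kappa K eps k)%:P)) in
  (pshift z f')`_j =
  (pshift z f)`_j + sg K eps k * ((-1) ^+ j * (pshift (- z - kappa K eps k) f)`_j).
Proof.
move=> f'; rewrite -coef_compN -coefZ -coefD; congr (nth 0 (polyseq _) j); apply: poly_ext => x.
rewrite [LHS]horner_pshift /f' /pshift !(hornerD, hornerZ) !horner_comp.
rewrite !(hornerD, hornerN, hornerX, hornerC).
by congr (_ + _ * f.[_]); ring.
Qed.

Lemma twisted_sum eps k f :
  twisted eps k (f + sg K eps k *: (f \Po (- 'X - (kappa K eps k)%:P))).
Proof.
move=> z; rewrite !hornerD !hornerZ !horner_comp !hornerE.
have -> : - (- z - kappa K eps k) - kappa K eps k = z by ring.
by rewrite mulrDr mulrA sg_sqr mul1r addrC.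
Qed.

Section Density.
Variables (eps : dsign) (n : nat) (s : 'I_n -> K) (ms : 'I_n -> nat).
Variable ty : 'I_n -> infty_type.
Hypothesis ty_compatible : forall i, compatible (s i) eps (ty i).
Hypothesis sN : forall i l (c : int), i != l -> s i - s l != c%:~R.
Hypothesis sD : forall i l (c : int), i != l -> s i + s l != c%:~R.
Hypothesis s_gl : forall i (c : int), ty i = gl_infty -> s i *+ 2 != c%:~R.

Lemma kappa_int k : exists c : int, kappa K eps k = c%:~R.
Proof. by case: eps; [exists k | exists (k + 1)]. Qed.

(** Interpolate the entries of [X] at the points s_i - q and 0 elsewhere, then symmetrize. By [sD]
    and [s_gl] the mirror images of the points of other slots, or of a [gl_infty] slot, never meet
    these points; in a classical slot they do, and the symmetry of [X] makes the data agree. *)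
Lemma imitate_window i k (X : infty_lie K (ms i) (ty i)) N : lie_homog k X ->
  exists f, [/\ twisted eps k f,
    forall q, (`|q| <= N)%N -> in_Rm (ms i) (pshift (s i - q%:~R) f) = X.1 (q - k) q
  & forall l q, l != i -> (`|q| <= N)%N ->
      in_Rm (ms l) (pshift (s l - q%:~R) f) = 0].
Proof.
move=> [[_ /imx_symP symX] _].
(* In a classical slot a point and its mirror image contribute equally, hence the factor 1/2. *)
pose c : K := if `[< ty i = gl_infty >] then 1 else 2^-1.
(* The prescribed jet depends on the point alone; [q] is recovered from z = s_i - q, uniquely in
   characteristic 0. *)
pose A z : {poly K} := match pselect (exists q : int, z = s i - q%:~R) with
  | left H => c *: (X.1 (projT1 (cid H) - k) (projT1 (cid H)) : {poly K})
  | right _ => 0 end.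
have AE (q : int) : A (s i - q%:~R) = c *: (X.1 (q - k) q : {poly K}).
  rewrite /A; case: pselect => [H|[]]; last by exists q.
  case: cid => /= q' /addrI/oppr_inj/intr_inj <- //.
have A0 z : (forall q : int, z <> s i - q%:~R) -> A z = 0.
  by move=> zN; rewrite /A; case: pselect => // zq; have [q /zN] := zq.
pose M := (\max_l ms l).+1.
pose kap := kappa K eps k.
pose pts := [seq s l - q%:~R | l <- enum 'I_n, q <- zrange N].
have ptsP l (q : int) : (`|q| <= N)%N -> s l - q%:~R \in pts.
  by move=> qN; apply/allpairsP; exists (l, q); rewrite mem_enum mem_zrange.
have [f0 f0E] := hermite_interpolation M (pts ++ [seq - z - kap | z <- pts]) A.
exists (f0 + sg K eps k *: (f0 \Po (- 'X - kap%:P))).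
have coefE l (q : int) j : (`|q| <= N)%N -> (j < (ms l).+1)%N ->
    (pshift (s l - q%:~R) (f0 + sg K eps k *: (f0 \Po (- 'X - kap%:P))))`_j =
    (A (s l - q%:~R))`_j + sg K eps k * ((-1) ^+ j * (A (- (s l - q%:~R) - kap))`_j).
  move=> qN jm; have jM : (j < M)%N.
    by apply: leq_trans jm _; rewrite ltnS; apply: leq_bigmax.
  rewrite coef_twisted_sum !f0E // mem_cat ?ptsP //.
  by apply/orP; right; apply/map_f/ptsP.
have [kz kzE] := kappa_int k.
split; first exact: twisted_sum.
  move=> q qN; rewrite -[RHS]in_RmK; apply: in_Rm_eq => j jm.
  rewrite coefE // AE coefZ; have [tyi|tyN] := pselect (ty i = gl_infty).
    rewrite A0 ?coef0 ?mulr0 ?addr0 => [|q' /eqP]; last first.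
      rewrite /kap kzE -subr_eq0 => /eqP e.
      have /eqP[] := s_gl (q + q' - kz) tyi.
      by rewrite intrB intrD -[LHS]addr0 -[X in _ + X]e; ring.
    by rewrite /c ifT ?mul1r //; apply/asboolP.
  case: (symX) => [//|XE]; case: (ty_compatible i) => [//|cP].
  have [kE sE] := cP (q - k) q; rewrite subKr in kE sE.
  have -> : - (s i - q%:~R) - kap = s i - (flip (ty i) (q - k))%:~R.
    by rewrite /kap kE; ring.
  rewrite AE flipB addrK coefZ.
  have := XE (q - k) q; rewrite flipB => XqE.
  have Xj : (X.1 (q - k) q : {poly K})`_j = flip_sign K (ty i) (q - k) q *
      ((-1) ^+ j * (X.1 (flip (ty i) q) (flip (ty i) q + k) : {poly K})`_j).
    by rewrite XqE /= coefZ /Rm_neg coef_in_Rm jm coef_compN.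
  have c2 : c = 2^-1 by rewrite /c ifF //; apply/asboolP.
  have {Xj}Xj : sg K eps k * (X.1 (q - k) q : {poly K})`_j =
      (-1) ^+ j * (X.1 (flip (ty i) q) (flip (ty i) q + k) : {poly K})`_j.
    by rewrite Xj mulrA sE mul1r.
  move: Xj (sg_sqr K eps k); rewrite c2.
  move: (_`_j) (_`_j) (sg K eps k) ((-1) ^+ j) => b a g e gE gg.
  have -> : g * (e * (2^-1 * b)) = 2^-1 * (g * (e * b)) by ring.
  by rewrite -gE mulrA gg mul1r; field.
move=> l q li qN; rewrite -[RHS]in_Rm0; apply: in_Rm_eq => j jm.
rewrite coefE // !A0 ?coef0 ?mulr0 ?addr0 // => q' /eqP.
  rewrite /kap kzE -subr_eq0 => /eqP e.
  have /eqP[] := sD (q + q' - kz) li.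
  by rewrite intrB intrD -[LHS]addr0 -[X in _ + X]e; ring.
rewrite -subr_eq0 => /eqP e; have /eqP[] := sN (q - q') li.
by rewrite intrB -[RHS]addr0 -[X in _ = _ + X]e; ring.
Qed.

End Density.
End Interpolation.

Section GlhatLinear.
Variables (K : fieldType) (m : nat).
Implicit Types X Y : glhat K m.

Lemma glhat_lin1 a X Y i j : (a *: X + Y).1 i j = a *: X.1 i j + Y.1 i j.
Proof. by []. Qed.

Lemma glhat_lin2 a X Y : (a *: X + Y).2 = a *: X.2 + Y.2.
Proof. by []. Qed.

Lemma glhat_deg_lin k a X Y : glhat_deg k X -> glhat_deg k Y ->
  glhat_deg k (a *: X + Y).
Proof.
move=> [Xk X2] [Yk Y2]; split=> [i j ij|k0].
  by rewrite glhat_lin1 Xk // Yk // scaler0 addr0.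
by rewrite glhat_lin2 X2 // Y2 // scaler0 addr0.
Qed.

End GlhatLinear.

(** * Dependence of the action on finitely many matrix columns *)

Section FiniteSupport.
Variables (K : numFieldType) (m : nat) (ty : infty_type).
Variables (L : lmodType K) (rho : infty_lie K m ty -> L -> L).
Variables (w0 : L) (Lam : infty_lie K m ty -> K).
Hypothesis irrL : irreducible_hw_module rho w0 Lam.

Definition vanishes (N : nat) (X : glhat K m) : Prop :=
  X.2 = 0 /\ forall i j, (`|j| <= N)%N -> X.1 i j = 0.

Hypothesis Lam_finite : exists N, forall X : infty_lie K m ty, lie_homog 0 X ->
  vanishes N X -> Lam X = 0.

Let gP : @graded_closed K (infty_lie K m ty) (gl_grading K m ty) := glhat_graded K m ty.
Let rhoP : is_module rho. Proof. by case: irrL. Qed.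
Let w0P : highest_weight_vector rho w0 Lam. Proof. by case: irrL. Qed.

Lemma vanishesW M N X : (M <= N)%N -> vanishes N X -> vanishes M X.
Proof. by move=> MN [X2 X1]; split=> // i j jM; apply: X1; apply: leq_trans jM MN. Qed.

(** A bracket with an element of degree [l] costs at most |l| columns; the bound on [k] keeps the
    cocycle inside the window. *)
Lemma vanishes_br k l N (X Y : infty_lie K m ty) :
    lie_homog k X -> lie_homog l Y -> (`|k| <= N + `|l|)%N ->
  vanishes (N + `|l|)%N X -> vanishes N (lie_br X Y).
Proof.
move=> [_ [Xk _]] [_ [Yl _]] kN [X2 X1]; split=> [|i j jN].
  rewrite /= /glhat_br /= (imx_trJ _ Xk) fsbig1 // => i _.
  have [ik|ik] := leqP (absz (i + k)) (N + absz l)%N; first by rewrite X1 // mulr0 mul0r.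
  suff -> : (i <= 0)%R = (i + k <= 0)%R by rewrite subrr !mul0r.
  by apply/idP/idP; lia.
rewrite /= /glhat_br /= (imx_commE _ _ _ Xk).
rewrite (X1 (j - k) j) ?mulr0 ?subr0; last by lia.
have [ikj|ikj] := eqVneq (j - (i + k)) l; last by rewrite Yl // mulr0.
by rewrite X1 ?mul0r //; lia.
Qed.

(** By induction on [e], X w0 is singular: for a raising Y, Y X w0 = -[X, Y] w0, and [X, Y] either
    raises or has smaller depth and still vanishes on a sufficient window. A singular vector of
    negative degree is 0. *)
Lemma hw_finite_support : exists N0, forall (e : nat) (X : infty_lie K m ty),
  lie_homog (- e%:Z) X -> vanishes (N0 + e) X -> rho X w0 = 0.
Proof.
have [N0 N0P] := Lam_finite; exists N0 => e.
have [_ w0pos w0zero] := w0P.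
elim/ltn_ind: e => -[|e] IH X Xe Xv.
  by rewrite oppr0 addn0 in Xe Xv; rewrite w0zero // (N0P _ Xe Xv) scale0r.
apply: (singular_below_eq0 gP irrL _ Xe) => // l Y l0 Yl.
have -> : rho Y (rho X w0) = - rho (lie_br X Y) w0.
  have := rho_br rhoP w0 Xe Yl.
  rewrite (w0pos _ _ l0 Yl) (lin0 (rho_lin rhoP Xe)) => /esym/eqP.
  by rewrite addr_eq0 => /eqP.
have XY := homog_br gP Xe Yl.
have [le|el] := leqP `|l|%N e.+1; last first.
  by rewrite (w0pos _ _ _ XY) ?oppr0 //; lia.
rewrite (IH (e.+1 - `|l|)%N) ?oppr0 //; first by lia.
  by rewrite (_ : - (e.+1 - `|l|)%N%:Z = - e.+1%:Z + l) //; lia.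
by apply: (vanishes_br Xe Yl); [lia | apply: vanishesW Xv; lia].
Qed.

(** On a vector Y v the element is commuted past Y; both it and its bracket with Y vanish on large
    windows. *)
Lemma finite_support k (v : L) : exists N, forall X : infty_lie K m ty,
  lie_homog k X -> vanishes N X -> rho X v = 0.
Proof.
move: k; have [N0 N0P] := hw_finite_support.
move: v; apply: (irreducible_ind gP irrL) => [k|a u v IHu IHv k|l Y v Yl IH k].
- have [k0|k0] := ltP 0 k.
    by exists 0%N => X Xk _; case: w0P => _ w0pos _; apply: w0pos Xk.
  exists (N0 + `|k|)%N => X Xk Xv; apply: (N0P `|k|%N) => //.
  by rewrite (_ : - `|k|%N%:Z = k) //; lia.
- have [N NP] := IHu k; have [N' N'P] := IHv k.
  exists (maxn N N') => X Xk Xv; rewrite (rho_lin rhoP Xk).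
  rewrite (NP _ Xk) ?(N'P _ Xk) ?scaler0 ?addr0 //; apply: vanishesW Xv.
    exact: leq_maxr.
  exact: leq_maxl.
have [N NP] := IH k; have [N' N'P] := IH (k + l).
exists (N + N' + `|k| + `|l|)%N => X Xk Xv; rewrite (rho_br rhoP _ Xk Yl).
rewrite (NP _ Xk) ?(lin0 (rho_lin rhoP Yl)) ?add0r; last by apply: vanishesW Xv; lia.
apply: (N'P _ (homog_br gP Xk Yl)).
apply: (@vanishesW _ (N' + absz k)%N); first exact: leq_addr.
by apply: (vanishes_br Xk Yl); [lia | apply: vanishesW Xv; lia].
Qed.

Lemma agree_window k (v : L) : exists N, forall X Y : infty_lie K m ty,
  lie_homog k X -> lie_homog k Y -> X.2 = Y.2 ->
  (forall i j, (`|j| <= N)%N -> X.1 i j = Y.1 i j) -> rho X v = rho Y v.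
Proof.
have [N NP] := finite_support k v; exists N => X Y Xk Yk XY2 XY1.
have [_ rho_l _] := rhoP.
have XYk : lie_homog k ((-1) *: X + Y : infty_lie K m ty).
  case: Xk Yk => Xm Xd [Ym Yd]; split; first exact: (mem_lin gP).
  exact: glhat_deg_lin.
have XYv : vanishes N ((-1) *: X + Y).
  by split=> [|i j jN]; rewrite ?glhat_lin2 ?glhat_lin1 ?XY2 ?XY1 // scaleN1r addNr.
have := NP _ XYk XYv; rewrite rho_l; [|by case: Xk | by case: Yk].
by rewrite scaleN1r addrC => /eqP; rewrite subr_eq0 => /eqP.
Qed.

End FiniteSupport.

Section Dense.
Variables (K : numFieldType) (eps : dsign) (n : nat) (s : 'I_n -> K) (ms : 'I_n -> nat).
Variable ty : 'I_n -> infty_type.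
Hypothesis ty_compatible : forall i, compatible (s i) eps (ty i).
Hypothesis sN : forall i l (c : int), i != l -> s i - s l != c%:~R.
Hypothesis sD : forall i l (c : int), i != l -> s i + s l != c%:~R.
Hypothesis s_gl : forall i (c : int), ty i = gl_infty -> s i *+ 2 != c%:~R.
Variables (L : 'I_n -> lmodType K) (rho : forall i, infty_lie K (ms i) (ty i) -> L i -> L i).
Variables (w0 : forall i, L i) (Lam : forall i, infty_lie K (ms i) (ty i) -> K).
Hypothesis irrL : forall i, irreducible_hw_module (@rho i) (w0 i) (@Lam i).
Hypothesis Lam_finite : forall i, exists N, forall X : infty_lie K (ms i) (ty i),
  lie_homog 0 X -> vanishes N X -> Lam X = 0.

(** The windows of [agree_window] for all vectors and slots have a common bound [M];
    [imitate_window] for that bound provides the coefficient of t^k. *)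
Lemma phihat_dense i k (X : infty_lie K (ms i) (ty i)) p (v : 'I_p -> forall i, L i) :
    k != 0 -> lie_homog k X ->
  exists y : Dhat_lie K eps, [/\ lie_homog k y,
    forall q, rho (phihat (ms i) (s i) y : infty_lie K (ms i) (ty i)) (v q i) = rho X (v q i)
  & forall l q, l != i ->
      rho (phihat (ms l) (s l) y : infty_lie K (ms l) (ty l)) (v q l) = 0].
Proof.
move=> k0 Xk.
have /choice[N NP] : forall c : 'I_p * 'I_n, exists N,
    forall X Y : infty_lie K (ms c.2) (ty c.2),
    lie_homog k X -> lie_homog k Y -> X.2 = Y.2 ->
    (forall i j, (`|j| <= N)%N -> X.1 i j = Y.1 i j) ->
    rho X (v c.1 c.2) = rho Y (v c.1 c.2).
  by move=> [q l]; apply: (agree_window (irrL l) (Lam_finite l)).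
pose M := \max_c N c.
have [f [f_tw fi fl]] := imitate_window ty_compatible sN sD s_gl M Xk.
pose y : Dhat K := (fun j => if j == k then f else 0, 0).
have yk : @lie_homog _ (Dhat_lie K eps) k y.
  have yd : Dhat_deg k y by split=> // j /negPf; rewrite /y /= => ->.
  split=> //; apply/DhatP; split; first exact: Dhat_deg_finite yd.
  move=> j z; rewrite /y /=; case: eqP => [->|_]; first exact: f_tw.
  by rewrite !horner0 mulr0.
have phik l := @phihat_homog K (ms l) (s l) eps (ty l) k y (ty_compatible l) yk.
have phi2 l : (phihat (ms l) (s l) y).2 = 0.
  by case: (phik l) => _ [_]; apply.
have phi1 l a b : (phihat (ms l) (s l) y).1 a b =
    if b - a == k then in_Rm (ms l) (pshift (s l - b%:~R) f) else 0.
  by rewrite /phihat /= /phi /y /=; case: eqP => // _; rewrite pshift0 in_Rm0.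
exists y; split=> // [q|l q li].
  apply: (NP (q, i)) => // [|a b bN].
    by rewrite phi2; case: Xk => _ [_ ->].
  have bM : (`|b| <= M)%N by apply: leq_trans bN _; apply: (leq_bigmax (q, i)).
  rewrite phi1; case: eqP => [bak|/eqP bak]; last by case: Xk => _ [-> //].
  by rewrite fi // -bak subKr.
have [rhoP _ _] := irrL l; have gl0 := lie_mem0 (glhat_graded K (ms l) (ty l)).
rewrite -(rho0 (glhat_graded K (ms l) (ty l)) rhoP (v q l)).
apply: (NP (q, l) _ 0 (phik l) _ (phi2 l)) => [|a b bN]; first by split.
have bM : (`|b| <= M)%N by apply: leq_trans bN _; apply: (leq_bigmax (q, l)).
by rewrite phi1 fl //; case: eqP.
Qed.

End Dense.

(** * Highest weights *)

Section SummationByParts.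
Variable K : fieldType.
Implicit Types (b q : int -> K).

Lemma ray_sum b (p : int) (P : nat) : (forall k, p + P%:Z <= k -> b k = 0) ->
  \sum_(k \in [set k : int | p <= k]) b k = \sum_(l < P) b (p + l%:Z).
Proof.
move=> b0; rewrite (@fsum_seqE _ _ _ [seq p + l%:Z | l <- iota 0 P]).
- rewrite big_map big_mkcond /= -(big_mkord xpredT (fun l => b (p + l%:Z))).
  rewrite /index_iota subn0; apply: eq_bigr => l _; rewrite ifT //.
  by apply/mem_set => /=; lia.
- by rewrite map_inj_uniq ?iota_uniq // => i j; lia.
move=> k /= pk /mapP kr; apply: b0; apply: contrapT => kP; apply: kr.
by exists (absz (k - p)); [rewrite mem_iota; lia | lia].
Qed.

Variables (b : int -> K) (B : nat).
Hypothesis bB : forall k : int, (B < `|k|)%N -> b k = 0.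

Definition tail (i : int) : K := \sum_(k \in [set k : int | i <= k]) b k.

Lemma tail_step i : tail i = b i + tail (i + 1).
Proof.
have P0 k : i + (absz i + B).+2%:Z <= k -> b k = 0 by move=> ik; apply: bB; lia.
rewrite /tail (ray_sum P0) (ray_sum (p := i + 1) (P := (absz i + B).+1)) => [|k ik].
  rewrite big_ord_recl /= addr0; congr (_ + _); apply: eq_bigr => l _.
  by congr b; rewrite /bump /=; lia.
by apply: bB; lia.
Qed.

Lemma tail_gt i : B%:Z < i -> tail i = 0.
Proof.
by move=> iB; rewrite /tail fsbig1 // => k /= ik; apply: bB; lia.
Qed.

Lemma sum_by_parts q (p : int) :
  \sum_(i \in [set i : int | p + 1 <= i]) (q (i - 1) - q i) * tail i =
  q p * tail p - \sum_(i \in [set i : int | p <= i]) q i * b i.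
Proof.
pose P := (absz p + B).+1.
rewrite (ray_sum (P := P)); last by move=> k pk; rewrite tail_gt ?mulr0 //; lia.
rewrite (ray_sum (P := P)); last by move=> k pk; rewrite bB ?mulr0 //; lia.
have H P' : \sum_(l < P') (q (p + 1 + l%:Z - 1) - q (p + 1 + l%:Z)) * tail (p + 1 + l%:Z) =
    q p * tail p - \sum_(l < P') q (p + l%:Z) * b (p + l%:Z) - q (p + P'%:Z) * tail (p + P'%:Z).
  elim: P' => [|P' IH]; first by rewrite !big_ord0 addr0; ring.
  rewrite !big_ord_recr /= IH.
  have -> : p + 1 + P'%:Z - 1 = p + P'%:Z by lia.
  have -> : p + 1 + P'%:Z = p + P'.+1%:Z by lia.
  rewrite (tail_step (p + P'%:Z)).
  have -> : p + P'%:Z + 1 = p + P'.+1%:Z by lia.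
  ring.
by rewrite H (tail_gt (i := p + P%:Z)) ?mulr0 ?subr0 //; lia.
Qed.

Lemma tail_lt i : i < - B%:Z -> tail i = \sum_(k \in [set: int]) b k.
Proof.
move=> iB; rewrite /tail (@fsum_seqE _ _ _ (zrange B)) ?zrange_uniq //.
  rewrite (@fsumT_seqE _ _ (zrange B)) ?zrange_uniq // => [|k].
    rewrite big_seq_cond [RHS]big_seq; apply: eq_bigl => k.
    rewrite mem_zrange; have [kB|//] := leqP; rewrite andTb.
    by apply/mem_set => /=; lia.
  by rewrite mem_zrange -ltnNge; apply: bB.
by move=> k _; rewrite mem_zrange -ltnNge; apply: bB.
Qed.

(** When the total is 0 the tails vanish at both ends, so no boundary term remains. *)
Lemma sum_by_parts_total q : \sum_(k \in [set: int]) b k = 0 ->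
  \sum_(i \in [set: int]) (q (i - 1) - q i) * tail i =
  - \sum_(i \in [set: int]) q i * b i.
Proof.
move=> b_tot; pose p : int := - B.+1%:Z.
have tail_le i : i <= p -> tail i = 0 by move=> ip; rewrite tail_lt ?b_tot //; lia.
have wide (f : int -> K) (p' : int) : (forall i, i < p' -> f i = 0) ->
    \sum_(i \in [set: int]) f i = \sum_(i \in [set i : int | p' <= i]) f i.
  move=> f0; apply/esym/fsbig_widen => // i [_ /= ip]; apply: f0.
  by rewrite ltNge; apply/negP.
rewrite (wide _ (p + 1)) => [|i ip]; last by rewrite tail_le ?mulr0 //; lia.
rewrite sum_by_parts tail_le // mulr0 sub0r; congr (- _).
by apply/esym/wide => i ip; rewrite bB ?mulr0 //; lia.
Qed.

End SummationByParts.

Lemma fsum_exchange (V : nmodType) (A : set int) m (G : int -> 'I_m -> V) B :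
  (forall i j, A i -> (B < `|i|)%N -> G i j = 0) ->
  \sum_(i \in A) \sum_(j < m) G i j = \sum_(j < m) \sum_(i \in A) G i j.
Proof.
move=> G0; rewrite (fsum_seqE (zrange_uniq B)) => [|i iA]; last first.
  by rewrite mem_zrange -ltnNge => iB; rewrite big1 // => j _; apply: G0.
rewrite exchange_big; apply: eq_bigr => j _.
rewrite (fsum_seqE (zrange_uniq B)) => // i iA.
by rewrite mem_zrange -ltnNge => iB; apply: G0.
Qed.

Lemma sum_zrange0 (K : fieldType) B (f : int -> K) :
  \sum_(k <- zrange B) f k * (k == 0)%:R = f 0.
Proof.
rewrite (bigD1_seq 0) ?mem_zrange ?zrange_uniq // big1 => [|k /negPf ->].
  by rewrite mulr1 /= addr0.
by rewrite mulr0.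
Qed.

Section Differences.
Variable K : numFieldType.
Implicit Types p q : {poly K}.

(** Induction on the size: a multiple of (w + 1)^(n+1) - w^(n+1) removes the coefficient of degree
    n. *)
Lemma difference_onto p : exists q, pshift 1 q - q = p.
Proof.
elim: (size p) {-2}p (leqnn (size p)) => [|n IH] {}p pn.
  exists 0; rewrite pshift0 subr0; apply/esym/eqP.
  by rewrite -size_poly_leq0.
pose c := p`_n / n.+1%:R; pose d : {poly K} := pshift 1 'X^(n.+1) - 'X^(n.+1).
have dE i : d`_i = 'C(n.+1, i)%:R - (i == n.+1)%:R.
  rewrite coefB coefXn /pshift comp_Xn_poly polyC1 exprD1n coef_sum; congr (_ - _).
  have [ni|ni] := ltnP i n.+2.
    rewrite (bigD1 (Ordinal ni)) //= coefMn coefXn eqxx big1 ?addr0 // => k.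
    by rewrite -val_eqE /= => ik; rewrite coefMn coefXn eq_sym (negPf ik) mul0rn.
  rewrite bin_small // big1 // => k _.
  have := ltn_ord k => kn; rewrite coefMn coefXn gtn_eqF ?mul0rn //.
  exact: leq_trans kn ni.
have [|q qE] := IH (p - c *: d).
  apply/leq_sizeP => i; rewrite leq_eqVlt coefB coefZ dE => /orP[/eqP <-|ni].
    by rewrite binSn ltn_eqF // subr0 /c divfK ?subrr ?pnatr_eq0.
  have -> : p`_i = 0 by apply: nth_default; apply: leq_trans pn ni.
  have [->|ni1] := eqVneq i n.+1; first by rewrite binn subrr mulr0 subr0.
  by rewrite bin_small ?subrr ?mulr0 ?subr0 // ltn_neqAle eq_sym ni1.
exists (q + c *: 'X^(n.+1)).
rewrite (linD (pshift_linear 1)) (linZ (pshift_linear 1)) opprD addrACA qE.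
by rewrite -scalerBr subrK.
Qed.

(** An antiderivative for the central difference exists by [difference_onto]; since [p] is odd, its
    even part is one as well. *)
Lemma even_central_difference p : (forall z, p.[- z] = - p.[z]) ->
  exists2 e : {poly K}, (forall z, e.[- z] = e.[z]) &
    pshift 2^-1 e - pshift (- 2^-1) e = p.
Proof.
move=> p_odd; have [q qE] := difference_onto (pshift 2^-1 p).
exists (2^-1 *: (q + (q \Po (- 'X)))) => [z|].
  by rewrite !hornerZ !hornerD !horner_comp !hornerN !hornerX opprK [in RHS]addrC.
have qz z : q.[z + 1] - q.[z] = p.[z + 2^-1].
  by have /(congr1 (horner^~ z)) := qE; rewrite hornerD hornerN !horner_pshift.
apply: poly_ext => z; rewrite hornerD hornerN !horner_pshift !hornerZ !hornerD.
rewrite !horner_comp !hornerN !hornerX.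
have q1 := qz (z - 2^-1); rewrite subrK in q1.
have q2 := qz (- z - 2^-1); rewrite subrK p_odd in q2.
have e1 : z - 2^-1 + 1 = z + 2^-1 by field.
have e2 : - z - 2^-1 + 1 = - z + 2^-1 by field.
rewrite e1 in q1; rewrite e2 in q2.
rewrite [- (z + _)]opprD [- (z - _)]opprB [2^-1 - z]addrC.
have -> : p.[z] = 2^-1 * (p.[z] - (- p.[z])) by field.
by rewrite -q2 -{1}q1; ring.
Qed.

Lemma even_coef (e : {poly K}) z j : (forall z, e.[- z] = e.[z]) ->
  (pshift (- z) e)`_j = (-1) ^+ j * (pshift z e)`_j.
Proof.
move=> e_even; rewrite -coef_compN; congr (nth 0 (polyseq _) j); apply: poly_ext => x.
rewrite horner_pshift horner_comp horner_pshift hornerN hornerX -e_even.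
by congr e.[_]; ring.
Qed.

End Differences.

Lemma phihat_central_diff (K : numFieldType) m (s : K) (Q : {poly K}) :
  (phihat m s (Dhat_poly (pshift 1 Q - Q))).2 = in_Rm m (Q.[0] *: 1 - pshift s Q).
Proof.
rewrite phihat2 -[(Dhat_poly _).1 0]/(pshift 1 Q - Q) phi_central_diff.
by rewrite scale0r sub0r opprB in_RmB in_RmZ in_Rm1.
Qed.

(** * Values of Lambda_S on the image of degree 0 *)

Section WeightValues.
Variable R : realType.
Local Notation C := R[i].
Variables (eps : dsign) (a : C -> nat -> C).
Hypothesis a_fin : finite_set [set p : C * nat | a p.1 p.2 != 0].
Implicit Types (s : C) (Q : {poly C}).

Lemma support_bound s : exists B, forall (k : int) j, (B < `|k|)%N -> a (s - k%:~R) j = 0.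
Proof.
pose f (p : int * nat) : C * nat := (s - p.1%:~R, p.2).
have f_inj : injective f.
  by move=> [k j] [l j'] [/addrI/oppr_inj/intr_inj -> ->].
have /finite_uniq_seq[r _ rE] : finite_set (f @^-1` [set p : C * nat | a p.1 p.2 != 0]).
  by apply: finite_preimage => // x y _ _; apply: f_inj.
exists (\max_(p <- r) `|p.1|)%N => k j kB; apply/eqP/negPn/negP => akj.
have kr : (k, j) \in r by apply/rE.
have := @leq_bigmax_seq _ r xpredT (fun p : int * nat => `|p.1|)%N _ kr isT.
by rewrite leqNgt kB.
Qed.

(** The [k] for which s - k may lie in the class represented by [s]; when 2s is an integer,
    normalization excludes negative [k] ([class_index]). *)
Definition index_dom (ty : infty_type) : set int :=
  match ty with gl_infty => [set: int] | _ => [set k : int | 0 <= k] end.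

Definition has00 (ty : infty_type) : bool :=
  match ty with b_infty | bt_infty => true | _ => false end.

Lemma LambdaSE s m (X : glhat C m) : LambdaS eps a s X =
  if rep_type eps s is gl_infty then LambdaS_gl a s X
  else LambdaS_half a (has00 (rep_type eps s)) s X.
Proof. by rewrite /LambdaS; case: rep_type. Qed.

Section Values.
Variables (s : C) (m : nat).

Lemma phihat_diff1 Q (i : int) j : (j < m.+1)%N ->
  ((phihat m s (Dhat_poly (pshift 1 Q - Q))).1 i i : {poly C})`_j =
  (pshift (s - (i - 1)%:~R) Q)`_j - (pshift (s - i%:~R) Q)`_j.
Proof.
move=> jm; rewrite /phihat /= /phi subrr eqxx coef_in_Rm jm.
rewrite (linB (pshift_linear _)) pshiftD coefB.
by congr ((pshift _ _)`_j - _); rewrite intrB opprB addrA [RHS]addrAC.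
Qed.

Lemma phihat_diff2 Q j : (j < m.+1)%N ->
  ((phihat m s (Dhat_poly (pshift 1 Q - Q))).2 : {poly C})`_j =
  (j == 0%N)%:R * Q.[0] - (pshift s Q)`_j.
Proof.
by move=> jm; rewrite phihat_central_diff coef_in_Rm jm coefB coefZ coef1 mulrC.
Qed.

(** The weights of u^j E_ii are tails of a_{s-k,j} - c_j delta_{k,0}, whose total is 0. After
    summation by parts the delta term cancels the jet of Q at s in the central part, leaving c_0
    Q(0). *)
Lemma LambdaS_gl_diff Q :
  LambdaS_gl a s (phihat m s (Dhat_poly (pshift 1 Q - Q))) =
  \sum_(j < m.+1) \sum_(k \in [set: int])
     a (s - k%:~R) j * ((j == 0%N :> nat)%:R * Q.[0] - (pshift (s - k%:~R) Q)`_j).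
Proof.
have [B aB] := support_bound s.
pose b (j : nat) (k : int) := a (s - k%:~R) j - cS_gl a s j * (k == 0)%:R.
have bB j (k : int) : (B < `|k|)%N -> b j k = 0.
  by move=> kB; rewrite /b aB // (_ : (k == 0) = false) ?mulr0 ?subrr //; lia.
have cE j : cS_gl a s j = \sum_(k <- zrange B) a (s - k%:~R) j.
  rewrite /cS_gl (fsumT_seqE (zrange_uniq B)) // => k.
  by rewrite mem_zrange -ltnNge => /aB.
have b_tot j : \sum_(k \in [set: int]) b j k = 0.
  rewrite (fsumT_seqE (zrange_uniq B)) => [|k]; last by rewrite mem_zrange -ltnNge => /bB.
  by rewrite sumrB -cE (sum_zrange0 B (fun=> cS_gl a s j)) subrr.
pose q (j : nat) (i : int) := (pshift (s - i%:~R) Q)`_j.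
rewrite /LambdaS_gl.
have -> : \sum_(i \in [set: int]) \sum_(j < m.+1)
    ((phihat m s (Dhat_poly (pshift 1 Q - Q))).1 i i : {poly C})`_j *
     (\sum_(k \in [set k : int | i <= k])
        (a (s - k%:~R) j - cS_gl a s j * (k == 0)%:R)) =
   \sum_(i \in [set: int]) \sum_(j < m.+1) (q j (i - 1) - q j i) * tail (b j) i.
  by apply: eq_fsbigr => i _; apply: eq_bigr => j _; rewrite phihat_diff1.
rewrite (fsum_exchange (B := B)) => [|i j _ iB]; last first.
  have [i0|i0] := ltP 0 i; first by rewrite (tail_gt (bB j)) ?mulr0 //; lia.
  by rewrite (tail_lt (bB j)) ?b_tot ?mulr0 //; lia.
rewrite -big_split; apply: eq_bigr => j _ /=.
rewrite (sum_by_parts_total (bB j)) // phihat_diff2 //.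
rewrite !(fsumT_seqE (zrange_uniq B)) => [|k|k]; first last.
- by rewrite mem_zrange -ltnNge => /bB ->; rewrite mulr0.
- by rewrite mem_zrange -ltnNge => /aB ->; rewrite mul0r.
have -> : \sum_(i <- zrange B) q j i * b j i =
    \sum_(i <- zrange B) a (s - i%:~R) j * q j i - cS_gl a s j * q j 0.
  rewrite -(sum_zrange0 B (fun k => cS_gl a s j * q j k)) -sumrB; apply: eq_bigr => i _.
  by rewrite /b; ring.
under [RHS]eq_bigr do rewrite mulrBr.
rewrite sumrB -mulr_suml -cE /q subr0; ring.
Qed.

(** Summation by parts over i >= 1 leaves a boundary term, [u^j] Q(s + u) times the full tail. For
    even j the central part cancels it. For odd j, where c_j = 0, it must vanish or be cancelled by
    the E_00 part, which is the hypothesis. *)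
Lemma LambdaS_half_diff Q w :
    (forall j, odd j -> (pshift s Q)`_j +
       (if w then ((pshift (s + 1) Q)`_j - (pshift s Q)`_j) / 2 else 0) = 0) ->
  LambdaS_half a w s (phihat m s (Dhat_poly (pshift 1 Q - Q))) =
  \sum_(j < m.+1) \sum_(k \in [set k : int | 0 <= k])
     a (s - k%:~R) j * ((j == 0%N :> nat)%:R * Q.[0] - (pshift (s - k%:~R) Q)`_j).
Proof.
move=> Q_odd; have [B aB] := support_bound s.
pose b (j : nat) (k : int) := a (s - k%:~R) j.
have bB j (k : int) : (B < `|k|)%N -> b j k = 0 by move=> kB; apply: aB.
pose q (j : nat) (i : int) := (pshift (s - i%:~R) Q)`_j.
rewrite /LambdaS_half.
have -> : \sum_(i \in [set i : int | 1 <= i]) \sum_(j < m.+1)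
    ((phihat m s (Dhat_poly (pshift 1 Q - Q))).1 i i : {poly C})`_j * tailS a s i j =
   \sum_(i \in [set i : int | 0 + 1 <= i]) \sum_(j < m.+1) (q j (i - 1) - q j i) * tail (b j) i.
  rewrite add0r.
  by apply: eq_fsbigr => i _; apply: eq_bigr => j _; rewrite phihat_diff1.
have -> : (if w then \sum_(j < m.+1 | odd j)
     ((phihat m s (Dhat_poly (pshift 1 Q - Q))).1 0 0 : {poly C})`_j * (tailS a s 0 j / 2)
   else 0) = \sum_(j < m.+1) (if odd j && w then
      ((pshift (s + 1) Q)`_j - (pshift s Q)`_j) / 2 * tail (b j) 0 else 0).
  case: (w); last by rewrite big1 // => j _; rewrite andbF.
  rewrite big_mkcond; apply: eq_bigr => j _; rewrite andbT; case: odd => //.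
  rewrite phihat_diff1 // sub0r mulrNz opprK subr0 -[tailS _ _ _ _]/(tail (b j) 0); ring.
rewrite (fsum_exchange (B := B)) => [|i j /= i1 iB]; last first.
  by rewrite (tail_gt (bB j)) ?mulr0 //; lia.
rewrite -!big_split; apply: eq_bigr => j _ /=.
rewrite (sum_by_parts (bB j)) phihat_diff2 //.
rewrite !(ray_sum (p := 0) (P := B.+1)) => [|k k0|k k0]; first last.
- by rewrite bB ?mulr0 //; lia.
- by rewrite aB ?mul0r //; lia.
have tailE : tail (b j) 0 = \sum_(l < B.+1) b j (0 + l%:Z).
  by rewrite /tail (ray_sum (P := B.+1)) // => k k0; apply: bB; lia.
under [RHS]eq_bigr do rewrite mulrBr.
rewrite sumrB -mulr_suml -[\sum_(_ < _) a _ _]/(\sum_(l < B.+1) b j (0 + l%:Z)) -tailE.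
have -> : \sum_(l < B.+1) q j (0 + l%:Z) * b j (0 + l%:Z) =
    \sum_(l < B.+1) a (s - (0 + l%:Z)%:~R) j * (pshift (s - (0 + l%:Z)%:~R) Q)`_j.
  by apply: eq_bigr => l _; rewrite mulrC.
rewrite /cS_half -[tailS _ _ _ _]/(tail (b j) 0).
have Qj := Q_odd j.
have qj : (pshift s Q)`_j = q j 0 by rewrite /q subr0.
rewrite qj in Qj *.
have [oj|_] /= := boolP (odd j); last by ring.
move: (Qj oj).
have -> : (j == 0%N :> nat) = false by apply/eqP => j0; rewrite j0 in oj.
move: (q j 0) ((pshift (s + 1) Q)`_j) => q0 q1.
case: (w) => [H|]; last by rewrite addr0 => -> /=; ring.
have -> : q1 = - q0.
  apply/eqP; rewrite -addr_eq0; apply/eqP.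
  by transitivity (2 * (q0 + (q1 - q0) / 2)); [field | rewrite H mulr0].
by rewrite /=; field.
Qed.

End Values.
End WeightValues.

Section WeightFiniteness.
Variable R : realType.
Local Notation C := R[i].
Variables (eps : dsign) (a : C -> nat -> C).
Hypothesis a_fin : finite_set [set p : C * nat | a p.1 p.2 != 0].
Variables (s : C) (m : nat).

Lemma LambdaS_C : LambdaS eps a s (phihat m s (Dhat_C C)) =
  \sum_(k \in index_dom (rep_type eps s)) a (s - k%:~R) 0%N.
Proof.
have X1 i j : (phihat m s (Dhat_C C)).1 i j = 0.
  exact: (@phi_zero _ m s (Dhat_C C)).
have X2 : (phihat m s (Dhat_C C)).2 = in_Rm m 1.
  rewrite phihat2 -[(Dhat_C C).1 0]/(0 : {poly C}) (lin0 (@phi_central_linear _ _ _)).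
  by rewrite subr0 scale1r in_Rm1.
have X2E (h : nat -> C) : \sum_(j < m.+1) ((phihat m s (Dhat_C C)).2 : {poly C})`_j * h j = h 0%N.
  rewrite big_ord_recl X2 coef_in_Rm coef1 mul1r big1 ?addr0 // => j _.
  by rewrite coef_in_Rm ltn_ord coef1 mul0r.
rewrite LambdaSE.
suff H w : LambdaS_half a w s (phihat m s (Dhat_C C)) =
    \sum_(k \in [set k : int | 0 <= k]) a (s - k%:~R) 0%N.
  case: (rep_type eps s) => //; rewrite /LambdaS_gl X2E fsbig1 ?add0r // => i _.
  by rewrite big1 // => j _; rewrite X1 coef0 mul0r.
rewrite /LambdaS_half X2E fsbig1 ?add0r => [|i _]; last first.
  by rewrite big1 // => j _; rewrite X1 coef0 mul0r.
case: w; last by rewrite add0r.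
by rewrite big1 ?add0r // => j _; rewrite X1 coef0 mul0r.
Qed.

(** Only finitely many of the tails involved are nonzero; for [LambdaS_gl] this holds also towards
    minus infinity because the total is 0. *)
Lemma LambdaS_finite : exists N, forall X : glhat C m, vanishes N X ->
  LambdaS eps a s X = 0.
Proof.
have [B aB] := support_bound a_fin s; exists B => X [X2 X1].
have X2E (h : nat -> C) : \sum_(j < m.+1) (X.2 : {poly C})`_j * h j = 0.
  by rewrite X2 big1 // => j _; rewrite coef0 mul0r.
rewrite LambdaSE; suff H w : LambdaS_half a w s X = 0.
  case: (rep_type eps s) => //; rewrite /LambdaS_gl X2E addr0 fsbig1 // => i _.
  have [iB|iB] := leqP (absz i) B; first by rewrite big1 // => j _; rewrite X1 // coef0 mul0r.
  apply: big1 => j _.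
  have bB (k : int) : (B < `|k|)%N -> a (s - k%:~R) j - cS_gl a s j * (k == 0)%:R = 0.
    by move=> kB; rewrite aB // (_ : (k == 0) = false) ?mulr0 ?subrr //; lia.
  rewrite -[X in _ * X]/(tail (fun k => a (s - k%:~R) j - cS_gl a s j * (k == 0)%:R) i).
  have [i0|i0] := ltP 0 i; first by rewrite (tail_gt bB) ?mulr0 //; lia.
  rewrite (tail_lt bB); last by lia.
  rewrite (fsumT_seqE (zrange_uniq B)) => [|k]; last first.
    by rewrite mem_zrange -ltnNge => /bB.
  rewrite sumrB /cS_gl (fsumT_seqE (zrange_uniq B)) => [|k]; last first.
    by rewrite mem_zrange -ltnNge => /aB.
  by rewrite (sum_zrange0 B (fun=> \sum_(k <- zrange B) a (s - k%:~R) j)) subrr mulr0.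
rewrite /LambdaS_half X2E addr0 fsbig1 ?add0r => [|i i1].
  by case: w => //; rewrite big1 // => j _; rewrite X1 // coef0 mul0r.
have [iB|iB] := leqP (absz i) B; first by rewrite big1 // => j _; rewrite X1 // coef0 mul0r.
apply: big1 => j _; rewrite /tailS fsbig1 ?mulr0 // => k /= ik.
by apply: aB; move: i1 => /=; lia.
Qed.

End WeightFiniteness.

(** * Equivalence classes of indices and regrouping of sums *)

Section EquivalenceClasses.
Variable R : realType.
Local Notation C := R[i].
Implicit Types s t z : C.

Lemma equiv_pmZ_sym s t : equiv_pmZ s t -> equiv_pmZ t s.
Proof.
move=> [c [->|->]]; [exists (- c); left | exists c; right]; rewrite ?mulrNz; ring.
Qed.

Lemma equiv_pmZ_trans s t z : equiv_pmZ s t -> equiv_pmZ t z -> equiv_pmZ s z.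
Proof.
move=> [c cE] [d [tE|tE]]; case: cE => ->; rewrite tE.
- by exists (c + d); left; rewrite intrD; ring.
- by exists (c - d); right; rewrite intrB; ring.
- by exists (c + d); right; rewrite intrD; ring.
by exists (c - d); left; rewrite intrB; ring.
Qed.

Lemma is_integer_equiv s t : equiv_pmZ s t -> is_integer t -> is_integer s.
Proof.
move=> [c [->|->]] [d ->]; [exists (d + c) | exists (c - d)];
by rewrite ?intrD ?intrB; ring.
Qed.

Lemma is_half_odd_equiv s t : equiv_pmZ s t -> is_half_odd t -> is_half_odd s.
Proof.
move=> [c [->|->]] [d ->]; [exists (d + c) | exists (c - d - 1)];
by rewrite ?intrD ?intrB; field.
Qed.

(** If z = -s + c, the imaginary parts are opposite, hence both 0. Then the two fractional parts,
    each below 1/2, have an integral sum, which must be 0, and s would be an integer. *)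
Lemma not_opposite_normalized eps s z (c : int) : normalized eps s -> normalized eps z ->
  ~ is_integer s -> ~ is_half_odd s -> z <> - s + c%:~R.
Proof.
move=> [_ _ sn] [_ _ zn] sI sH zE.
have zs : equiv_pmZ s z by apply: equiv_pmZ_sym; exists c; right.
have zI : ~ is_integer z by move/(is_integer_equiv zs).
have zH : ~ is_half_odd z by move/(is_half_odd_equiv zs).
have [s1 s2] := sn sI sH; have [z1 z2] := zn zI zH.
have zsum : z + s = c%:~R by rewrite zE; ring.
have cE : c%:~R = (c%:~R : R)%:C%C by rewrite rmorph_int.
have imE : complex.Im z = - complex.Im s.
  have /(congr1 (@complex.Im R)) := zsum; rewrite cE.
  by case: (z) (s) => [? ?] [? ?] /= /eqP; rewrite addr_eq0 => /eqP.
have reE : complex.Re z + complex.Re s = c%:~R.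
  have /(congr1 (@complex.Re R)) := zsum; rewrite cE.
  by case: (z) (s) => [? ?] [? ?].
have [s0|s0] := eqVneq (complex.Im s) 0; last first.
  by have := s1 s0; have := z1; rewrite imE oppr_eq0 => /(_ s0); lra.
have sf := s2 s0; have zf : complex.Re z - (Num.floor (complex.Re z))%:~R < 2^-1.
  by apply: z2; rewrite imE s0 oppr0.
have fs := floor_le (complex.Re s).
have fz := floor_le (complex.Re z).
have c0 : c - Num.floor (complex.Re s) - Num.floor (complex.Re z) = 0.
  have lb : (0 : R) <= (c - Num.floor (complex.Re s) - Num.floor (complex.Re z))%:~R.
    by rewrite !intrB -reE; lra.
  have ub : (c - Num.floor (complex.Re s) - Num.floor (complex.Re z))%:~R < (1 : R).
    by rewrite !intrB -reE; lra.
  by move: lb ub; rewrite ler0z ltrz1; lia.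
apply: sI; exists (Num.floor (complex.Re s)).
have reS : complex.Re s = (Num.floor (complex.Re s))%:~R.
  have := congr1 (fun n : int => (n%:~R : R)) c0.
  by rewrite /= !intrB -reE; lra.
have -> : (Num.floor (complex.Re s))%:~R = ((Num.floor (complex.Re s))%:~R : R)%:C%C.
  by rewrite rmorph_int.
by rewrite -reS; case: (s) s0 => x y /= ->.
Qed.

End EquivalenceClasses.

Lemma sum_uniq_restrict (T : eqType) (V : nmodType) (r q : seq T) (f : T -> V) :
  uniq r -> uniq q -> (forall p, p \notin q -> f p = 0) ->
  \sum_(p <- r) f p = \sum_(p <- q | p \in r) f p.
Proof.
move=> ur uq f0; rewrite (bigID [in q]) /= [X in _ + X]big1 ?addr0; last first.
  by move=> p /f0.
rewrite -big_filter -[RHS]big_filter; apply: perm_big; apply: uniq_perm.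
- exact: filter_uniq.
- exact: filter_uniq.
by move=> p; rewrite !mem_filter andbC.
Qed.

Section ClassSum.
Variable R : realType.
Local Notation C := R[i].
Variables (eps : dsign) (a : C -> nat -> C).
Hypothesis a_fin : finite_set [set p : C * nat | a p.1 p.2 != 0].
Hypothesis a_norm : forall s, in_supp a s -> normalized eps s.
Variables (n : nat) (s : 'I_n -> C).
Hypothesis s_rep : representatives eps a s.

Definition half_rep : C := match eps with Dminus => 2^-1 | Dplus => - 2^-1 end.

Let half_rep_neq0 : (half_rep == 0) = false.
Proof. by rewrite /half_rep; case: eps; rewrite ?oppr_eq0 invr_eq0 pnatr_eq0. Qed.

Lemma half_rep_half_odd : is_half_odd half_rep.
Proof.
rewrite /half_rep; case: eps; [exists 0; rewrite add0r // | exists (-1)].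
by rewrite mulrNz; field.
Qed.

Variant rep_spec (i : 'I_n) : infty_type -> Prop :=
| RepGl of ~ is_integer (s i) & ~ is_half_odd (s i) & in_supp a (s i) :
    rep_spec i gl_infty
| RepInt of s i = 0 :
    rep_spec i (match eps with Dminus => b_infty | Dplus => d_infty end)
| RepHalf of s i = half_rep :
    rep_spec i (match eps with Dminus => c_infty | Dplus => bt_infty end).

Lemma repP i : rep_spec i (rep_type eps (s i)).
Proof.
have [/(_ i)[t _ [st [sI sH sG]]] _ _] := s_rep.
have [tI|tI] := pselect (is_integer t).
  have s0 := sI tI; rewrite /rep_type s0 eqxx.
  by case: (eps) (@RepInt i s0).
have [tH|tH] := pselect (is_half_odd t).
  have sh : s i = half_rep := sH tH.
  have := RepHalf sh; have := half_rep_neq0; rewrite /rep_type sh /half_rep.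
  by case: (eps) => ->; rewrite eqxx.
have sNI : ~ is_integer (s i) by move/(is_integer_equiv (equiv_pmZ_sym st)).
have sNH : ~ is_half_odd (s i) by move/(is_half_odd_equiv (equiv_pmZ_sym st)).
have s0 : (s i == 0) = false by apply/eqP => s0; apply: sNI; exists 0; rewrite s0.
have sh : (s i == half_rep) = false.
  by apply/eqP => sh; apply: sNH; rewrite sh; apply: half_rep_half_odd.
have -> : rep_type eps (s i) = gl_infty.
  by rewrite /rep_type s0; move: sh; rewrite /half_rep; case: (eps) => ->.
by apply: RepGl => //; apply: sG.
Qed.

(** Generically the alternative z = -s + c is excluded by [not_opposite_normalized]. When 2s is an
    integer, the upper bound imposed by normalization forces k >= 0. *)
Lemma class_index i z : in_supp a z -> equiv_pmZ z (s i) ->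
  exists2 k : int, index_dom (rep_type eps (s i)) k & z = s i - k%:~R.
Proof.
move=> za zs; have zn := a_norm za.
case: repP => [sI sH sa|s0|sh].
- have [c [zE|zE]] := zs; first by exists (- c); rewrite // mulrNz opprK.
  by have := not_opposite_normalized (a_norm sa) zn sI sH zE.
- have [c zc] : is_integer z by apply: (is_integer_equiv zs); exists 0.
  exists (- c); last by rewrite s0 zc mulrNz opprK add0r.
  case: zn => /(_ (ex_intro _ c zc)) z0 _ _; move: z0; rewrite zc lerz0 => c0.
  by case: (eps) => /=; lia.
have [c zc] : is_half_odd z.
  by apply: (is_half_odd_equiv zs); rewrite sh; apply: half_rep_half_odd.
case: zn => _ /(_ (ex_intro _ c zc)) z0 _; move: z0; rewrite sh /half_rep zc.
case: (eps) => /= z0.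
  exists (- c); last by rewrite mulrNz opprK addrC.
  by move: z0; rewrite gerDr lerz0 /=; lia.
exists (- c - 1); last by rewrite intrB mulrNz; field.
have : (c + 1)%:~R <= (0 : C).
  rewrite intrD; have -> : c%:~R + 1%:~R = c%:~R + 2^-1 - (- 2^-1) :> C by field.
  by rewrite subr_le0.
by rewrite lerz0 /=; lia.
Qed.

Lemma mS_ge i z j : a z j != 0 -> equiv_pmZ z (s i) -> (j <= mS a (s i))%N.
Proof.
move=> azj zs; set A := [set p : C * nat | a p.1 p.2 != 0 /\ equiv_pmZ p.1 (s i)].
have /finite_uniq_seq[r ur rE] : finite_set A.
  by apply: sub_finite_set a_fin => p [].
rewrite /mS -/A.
have -> : \big[maxn/0%N]_(p \in A) p.2 = \big[maxn/0%N]_(p <- r) p.2.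
  have -> : A = [set` r] by apply/seteqP; split=> p /rE.
  by rewrite -fsbig_seq.
by apply: (@leq_bigmax_seq _ r xpredT snd (z, j)) => //; apply/rE.
Qed.

Lemma class_exists z : in_supp a z -> exists i, equiv_pmZ z (s i).
Proof.
case: s_rep => _ H _ /H[i [sz _]]; exists i; exact: equiv_pmZ_sym.
Qed.

Lemma class_uniq z i l : equiv_pmZ z (s i) -> equiv_pmZ z (s l) -> i = l.
Proof.
case: s_rep => _ _ H zi zl; apply: H.
exact: equiv_pmZ_trans (equiv_pmZ_sym zi) zl.
Qed.

(** The support splits into classes; the pairs (s_i - k, j) with j at most [mS] and k in [index_dom]
    cover the i-th one without repetition. *)
Lemma class_sum (G : C -> nat -> C) :
  \sum_(p \in [set: C * nat]) a p.1 p.2 * G p.1 p.2 =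
  \sum_(i < n) \sum_(j < (mS a (s i)).+1)
    \sum_(k \in index_dom (rep_type eps (s i)))
      a (s i - k%:~R) j * G (s i - k%:~R) j.
Proof.
have [r ur rE] := finite_uniq_seq a_fin.
pose f (p : C * nat) := a p.1 p.2 * G p.1 p.2.
have f0 p : p \notin r -> f p = 0.
  move=> pr; rewrite /f (_ : a p.1 p.2 = 0) ?mul0r //.
  by apply/eqP; apply: contraNT pr => /rE.
rewrite (fsumT_seqE ur) //.
pose cls i (p : C * nat) := `[< equiv_pmZ p.1 (s i) >].
transitivity (\sum_(i < n) \sum_(p <- r | cls i p) f p).
  rewrite (exchange_big_dep xpredT) //= big_seq [RHS]big_seq.
  apply: eq_bigr => p /rE ap.
  have [i pi] : exists i, equiv_pmZ p.1 (s i) by apply: class_exists; exists p.2.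
  rewrite (big_pred1 i) // => l; apply/asboolP/eqP => [pl|-> //].
  exact: class_uniq pl pi.
apply: eq_bigr => i _.
have [B aB] := support_bound a_fin (s i).
pose dom := [seq k <- zrange B | k \in index_dom (rep_type eps (s i))].
have -> : \sum_(j < (mS a (s i)).+1) \sum_(k \in index_dom (rep_type eps (s i)))
      a (s i - k%:~R) j * G (s i - k%:~R) j =
    \sum_(p <- [seq (s i - k%:~R, j) | j <- iota 0 (mS a (s i)).+1, k <- dom]) f p.
  rewrite big_allpairs_dep /= -[in LHS](big_mkord xpredT (fun j =>
    \sum_(k \in index_dom (rep_type eps (s i))) a (s i - k%:~R) j * G (s i - k%:~R) j)).
  rewrite /index_iota subn0; apply: eq_bigr => j _.
  rewrite (fsum_seqE (zrange_uniq B)) => [|k _]; last first.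
    by rewrite mem_zrange -ltnNge => /aB ->; rewrite mul0r.
  by rewrite big_filter.
rewrite (sum_uniq_restrict _ ur f0); last first.
  apply: allpairs_uniq; [exact: iota_uniq|exact/filter_uniq/zrange_uniq|].
  by move=> [j k] [j' k'] _ _ [/addrI/oppr_inj/intr_inj -> ->].
rewrite big_seq_cond [RHS]big_seq_cond; apply: eq_bigl => p.
have [pr|//] := boolP (p \in r); rewrite !andTb.
have ap : a p.1 p.2 != 0 by apply/rE.
apply/asboolP/allpairsP => [pi|[[j k] /= [_ _ ->]]]; last first.
  by exists (- k); left; rewrite mulrNz.
have [|k kd pk] := class_index _ pi; first by exists p.2.
exists (p.2, k); split; last by rewrite -pk; case: (p).
  by rewrite mem_iota add0n ltnS (mS_ge ap).
rewrite mem_filter mem_zrange; apply/andP; split; first exact/mem_set.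
by rewrite leqNgt; apply/negP => /(aB _ p.2); rewrite -pk => /eqP; rewrite (negPf ap).
Qed.

End ClassSum.

(** * The highest weight of the given module *)

Section WeightLinear.
Variables (K : numFieldType) (g : graded_lie K).
Variables (V : lmodType K) (rho : g -> V -> V) (v0 : V) (xi : g -> K).
Hypothesis rhoP : is_module rho.
Hypothesis v0P : highest_weight_vector rho v0 xi.

(** [xi] is a bare function; its linearity on degree 0 is forced by the action on the nonzero vector
    [v0]. *)
Lemma weight_lin a (x y : g) : lie_homog 0 x -> lie_homog 0 y ->
  lie_homog 0 (a *: x + y) -> xi (a *: x + y) = a * xi x + xi y.
Proof.
case: v0P => v0N _ v0z x0 y0 xy0; apply/eqP; rewrite -subr_eq0.
have : rho (a *: x + y) v0 = a *: rho x v0 + rho y v0.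
  by case: rhoP => _ H _; apply: H; [case: x0 | case: y0].
move/eqP; rewrite !v0z // scalerA -scalerDl -subr_eq0 -scalerBl scaler_eq0.
by rewrite (negPf v0N) orbF.
Qed.

End WeightLinear.

Section DegreeZero.
Variables (K : numFieldType) (eps : dsign).
Implicit Types (f h e : {poly K}) (x y : Dhat K).
Local Notation homog0 := (@lie_homog K (Dhat_lie K eps) 0).

Lemma Dhat_homog0_lin a x y : homog0 x -> homog0 y -> homog0 (a *: x + y).
Proof.
move=> [xm [x1 _]] [ym [y1 _]]; split; first exact: Dhat_mem_lin.
by split=> // n n0; rewrite -[LHS]/(a *: x.1 n + y.1 n) x1 // y1 // scaler0 addr0.
Qed.

Lemma Dhat_poly_homog0 f : twisted eps 0 f -> homog0 (Dhat_poly f).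
Proof.
move=> f_tw; have fd : Dhat_deg 0 (Dhat_poly f).
  by split=> // n /negPf n0; rewrite /Dhat_poly /= n0.
split=> //; apply/DhatP; split; first exact: Dhat_deg_finite fd.
move=> k z; rewrite /Dhat_poly /=; case: eqP => [->|_]; first exact: f_tw.
by rewrite !horner0 mulr0.
Qed.

Lemma twisted0 k : twisted eps k (0 : {poly K}).
Proof. by move=> z; rewrite !horner0 mulr0. Qed.

Lemma Dhat_C_homog0 : homog0 (Dhat_C K).
Proof.
have Cd : Dhat_deg 0 (Dhat_C K) by split.
split=> //; apply/DhatP; split; first exact: Dhat_deg_finite Cd.
by move=> k; apply: twisted0.
Qed.

Lemma Dhat_homog0E x : homog0 x ->
  twisted eps 0 (x.1 0) /\ x = x.2 *: Dhat_C K + Dhat_poly (x.1 0).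
Proof.
move=> [/DhatP[_ xE] [x1 _]]; split; first exact: xE.
apply: Dhat_eq; last by rewrite -[RHS]/(x.2 * 1 + 0) mulr1 addr0.
apply/funext => n; rewrite -[RHS]/(x.2 *: 0 + (if n == 0 then x.1 0 else 0)).
by rewrite scaler0 add0r; case: eqP => [->//|/eqP/x1].
Qed.

(* the shift turning the central difference of an even polynomial into the   *)
(* forward difference whose value at D lies in the degree 0 subalgebra       *)
Definition offset : K := match eps with Dminus => 2^-1 | Dplus => 0 end.

Definition base : {poly K} :=
  match eps with Dminus => 'X | Dplus => 'X + (2^-1)%:P end.

Lemma horner_base z : base.[z] = z + 2^-1 - offset.
Proof.
by rewrite /base /offset; case: eps; rewrite ?hornerD ?hornerX ?hornerC ?addrK ?subr0.
Qed.

Lemma comp_base_shift e :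
  (pshift 2^-1 e - pshift (- 2^-1) e) \Po base =
  pshift 1 (pshift (- offset) e) - pshift (- offset) e.
Proof.
apply: poly_ext => z; rewrite horner_comp horner_base !(hornerD, hornerN) !horner_pshift.
by congr (e.[_] - e.[_]); field.
Qed.

Lemma odd_base_twisted h : (forall z, h.[- z] = - h.[z]) -> twisted eps 0 (h \Po base).
Proof.
move=> h_odd z; rewrite !horner_comp !horner_base.
have -> : sg K eps 0 = -1 by rewrite /sg; case: eps; rewrite ?expr0z.
rewrite mulN1r -h_odd; congr h.[_].
by rewrite /kappa /offset; case: eps => /=; field.
Qed.

(** Recentred at its point of antisymmetry, [f] is odd, so [even_central_difference] applies. *)
Lemma twisted0_difference f : twisted eps 0 f ->
  exists2 e : {poly K}, (forall z, e.[- z] = e.[z]) &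
    f = (pshift 2^-1 e - pshift (- 2^-1) e) \Po base.
Proof.
move=> f_tw.
have [|e e_even eE] := @even_central_difference K (pshift (offset - 2^-1) f).
  move=> z; rewrite !horner_pshift.
  have -> : - z + (offset - 2^-1) = - (z + (offset - 2^-1)) - kappa K eps 0.
    by rewrite /kappa /offset; case: (eps) => /=; field.
  rewrite f_tw (_ : sg K eps 0 = -1) ?mulN1r //.
  by rewrite /sg; case: (eps); rewrite ?expr0z.
exists e => //; rewrite eE; apply: poly_ext => z.
by rewrite horner_comp horner_base horner_pshift; congr f.[_]; ring.
Qed.

Section DeltaPairing.
Variables (V : lmodType K) (rho : Dhat_lie K eps -> V -> V) (v0 : V).
Variable xi : Dhat_lie K eps -> K.
Hypothesis rhoP : is_module rho.
Hypothesis v0P : highest_weight_vector rho v0 xi.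

(** Up to n!, the odd coefficients of Delta are the values of -xi on odd powers of [base], and an
    odd [h] involves no other powers. *)
Lemma pairing_Delta h : (forall z, h.[- z] = - h.[z]) ->
  pairing (Delta eps xi) h = - xi (Dhat_poly (h \Po base)).
Proof.
move=> h_odd.
have base_odd n : odd n -> forall z, ('X^n : {poly K}).[- z] = - ('X^n).[z].
  by move=> on z; rewrite !hornerXn exprNn -signr_odd on mulN1r.
have h_even n : ~~ odd n -> h`_n = 0.
  move=> on; have : (h \Po (- 'X))`_n = - h`_n.
    rewrite -coefN; congr (nth 0 (polyseq _) n); apply: poly_ext => z.
    by rewrite horner_comp !hornerN hornerX.
  rewrite coef_compN -signr_odd (negPf on) mul1r => /eqP.
  by rewrite -addr_eq0 -mulr2n -mulr_natr mulf_eq0 pnatr_eq0 orbF => /eqP.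
pose E n : Dhat K := Dhat_poly ('X^n \Po base).
have E0 n : odd n -> homog0 (E n).
  by move=> /base_odd/odd_base_twisted; apply: Dhat_poly_homog0.
have C0 := Dhat_C_homog0; have z0 : homog0 0.
  by have := Dhat_homog0_lin (-1) C0 C0; rewrite scaleN1r addNr.
have xi0 : xi 0 = 0.
  have := weight_lin rhoP v0P (a := -1) C0 C0 (Dhat_homog0_lin (-1) C0 C0).
  by rewrite scaleN1r addNr mulN1r addNr.
have S (r : seq nat) : homog0 (\sum_(n <- r | odd n) h`_n *: E n) /\
    xi (\sum_(n <- r | odd n) h`_n *: E n) = \sum_(n <- r | odd n) h`_n * xi (E n).
  elim: r => [|n r [rh rx]]; first by rewrite !big_nil.
  rewrite !big_cons; case: ifP => // /E0 nh; split; first exact: Dhat_homog0_lin.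
  by rewrite (weight_lin rhoP v0P) ?rx //; apply: Dhat_homog0_lin.
have -> : Dhat_poly (h \Po base) = \sum_(n <- iota 0 (size h) | odd n) h`_n *: E n.
  have polyL : linear (@Dhat_poly K).
    move=> b p q; apply: Dhat_eq; last by rewrite -[RHS]/(b * 0 + 0) mulr0 addr0.
    apply/funext => k.
    rewrite -[RHS]/(b *: (if k == 0 then p else 0) + (if k == 0 then q else 0)) /=.
    by case: eqP => //; rewrite scaler0 addr0.
  rewrite -{1}[h]coefK poly_def (lin_sum (f := fun p => p \Po base)); last first.
    by move=> b p q; rewrite comp_polyD comp_polyZ.
  rewrite (lin_sum polyL) -(big_mkord xpredT (fun n => Dhat_poly ((h`_n *: 'X^n) \Po base))).
  rewrite /index_iota subn0 [RHS]big_mkcond; apply: eq_bigr => n _.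
  rewrite comp_polyZ (linZ polyL); case: ifP => // /negbT/h_even ->.
  by rewrite scale0r.
have [_ ->] := S (iota 0 (size h)).
rewrite -sumrN /pairing -(big_mkord xpredT (fun n => h`_n * n`!%:R * Delta eps xi n)).
rewrite /index_iota subn0 [RHS]big_mkcond; apply: eq_bigr => n _.
rewrite /Delta; case: ifP => [on|_]; last by rewrite mulr0.
have -> : Dhat_poly (match eps with Dminus => 'X ^+ n | Dplus => ('X + (2^-1)%:P) ^+ n end)
    = E n.
  by rewrite /E comp_Xn_poly /base; case: (eps).
have n0 : n`!%:R != 0 :> K by rewrite pnatr_eq0 -lt0n fact_gt0.
by field.
Qed.

Lemma weight_homog0 x : homog0 x ->
  xi x = x.2 * xi (Dhat_C K) + xi (Dhat_poly (x.1 0)).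
Proof.
move=> x0; have [x_tw xE] := Dhat_homog0E x0; rewrite {1}xE.
apply: (weight_lin rhoP v0P); [exact: Dhat_C_homog0|exact: Dhat_poly_homog0|].
by rewrite -xE.
Qed.

End DeltaPairing.

End DegreeZero.

Section Series.
Variables (K : numFieldType) (e : {poly K}).
Hypothesis e_even : forall z, e.[- z] = e.[z].

(** As [e] is even, the two exponentials of eta contribute equally, and the factor x^j extracts a
    Taylor coefficient at mu. *)
Lemma pairing_eta j mu : pairing (eta_series j mu) e = (pshift mu e)`_j.
Proof.
rewrite /eta_series pairingZ fps_mulDr fps_mulZr addrC pairing_lincomb !pairing_exp.
rewrite !pairing_fps_Xn even_coef // !mulrA.
have j0 : j`!%:R != 0 :> K by rewrite pnatr_eq0 -lt0n fact_gt0.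
have -> : (-1) ^+ j * j`!%:R * (-1) ^+ j = j`!%:R :> K.
  by rewrite mulrAC -expr2 sqrr_sign mul1r.
by field.
Qed.

Lemma pairing_cosh_half : pairing (cosh_half K) e = e.[2^-1].
Proof.
rewrite /cosh_half pairingZ -[fps_exp 2^-1]scale1r pairing_lincomb !pairing_fps_exp.
by rewrite e_even; field.
Qed.

Lemma central_difference_odd z : (pshift 2^-1 e - pshift (- 2^-1) e).[- z]
    = - (pshift 2^-1 e - pshift (- 2^-1) e).[z].
Proof.
rewrite !(hornerD, hornerN) !horner_pshift opprB.
by rewrite -[X in X - _]e_even -[X in _ - X]e_even; congr (e.[_] - e.[_]); ring.
Qed.

End Series.

Section WeightFormula.
Variables (K : numFieldType) (eps : dsign) (a : K -> nat -> K) (c : K) (F : fps K).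
Hypothesis a_fin : finite_set [set p : K * nat | a p.1 p.2 != 0].
Hypothesis F0 : F 0%N = 0.
Hypothesis hF : F + c *: (match eps with
                    | Dminus => cosh_half K
                    | Dplus => fps1 K
                    end)
          = \sum_(p \in [set: K * nat])
              a p.1 p.2 *: eta_series p.2 (match eps with
                                    | Dminus => p.1 - 2^-1
                                    | Dplus => p.1
                                    end).

Lemma finite_weight_sum : exists r : seq (K * nat), forall (V : lmodType K) (G : K * nat -> V),
  \sum_(p \in [set: K * nat]) a p.1 p.2 *: G p = \sum_(p <- r) a p.1 p.2 *: G p.
Proof.
have [r ur rE] := finite_uniq_seq a_fin; exists r => V G.
rewrite (fsumT_seqE ur) // => p pr; rewrite (_ : a p.1 p.2 = 0) ?scale0r //.
by apply/eqP; apply: contraNT pr => /rE.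
Qed.

Lemma pairing_expansion (e : {poly K}) : (forall z, e.[- z] = e.[z]) ->
  pairing F e + c * e.[offset K eps] = \sum_(p \in [set: K * nat])
     a p.1 p.2 * (pshift p.1 (pshift (- offset K eps) e))`_p.2.
Proof.
move=> e_even; have [r rE] := finite_weight_sum.
transitivity (pairing (c *: (match eps with Dminus => cosh_half K | Dplus => fps1 K end) + F) e).
  rewrite pairing_lincomb addrC; congr (_ * _ + _).
  by case: (eps) => /=; rewrite ?pairing_cosh_half // pairing_fps1.
rewrite addrC hF rE.
have -> := rE K^o (fun p => (pshift p.1 (pshift (- offset K eps) e))`_p.2).
elim: (r) => [|p q IH]; first by rewrite !big_nil /pairing big1 // => i _; rewrite mulr0.
rewrite !big_cons pairing_lincomb IH pairing_eta // pshiftD.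
by congr (_ * (pshift _ _)`_ _ + _); case: (eps); rewrite /= ?subr0.
Qed.

(** Pairing the expansion with the constant polynomial 1 compares constant terms, and F(0) = 0. *)
Lemma central_sum : c = \sum_(p \in [set: K * nat]) a p.1 p.2 * (p.2 == 0%N)%:R.
Proof.
have := @pairing_expansion 1; rewrite -[in pairing F 1](expr0 'X) pairingXn F0 mulr0 add0r.
rewrite hornerC mulr1 => -> => [|z]; last by rewrite !hornerC.
apply: eq_fsbigr => p _; congr (_ * _).
rewrite (_ : pshift _ _ = 1) ?coef1 //.
by apply: poly_ext => x; rewrite !horner_pshift !hornerC.
Qed.

Variables (V : lmodType K) (rho : Dhat_lie K eps -> V -> V) (v0 : V).
Variable xi : Dhat_lie K eps -> K.
Hypothesis rhoP : is_module rho.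
Hypothesis v0P : highest_weight_vector rho v0 xi.
Hypothesis hDelta : fps_mul (Delta eps xi) (two_sinh_half K) = F.

(** Multiplication by 2 sinh(x/2) is adjoint to e(w + 1/2) - e(w - 1/2), so pairing F with [e] gives
    minus the left side; [pairing_expansion] computes the same pairing from [a]. *)
Lemma weight_difference (e : {poly K}) : (forall z, e.[- z] = e.[z]) ->
  let q := pshift (- offset K eps) e in
  xi (Dhat_poly (pshift 1 q - q)) =
  \sum_(p \in [set: K * nat])
    a p.1 p.2 * ((p.2 == 0%N)%:R * q.[0] - (pshift p.1 q)`_p.2).
Proof.
move=> e_even q.
have := pairing_Delta rhoP v0P (central_difference_odd e_even).
rewrite comp_base_shift -/q (linB (pairing_linear _)) -!pairing_exp -pairingB -fps_mulBr.
rewrite -[_ - fps_exp _]/(two_sinh_half K) hDelta => xiE.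
have := pairing_expansion e_even; rewrite -/q xiE.
have [r rE] := finite_weight_sum.
have S (G : K * nat -> K) : \sum_(p \in [set: K * nat]) a p.1 p.2 * G p =
    \sum_(p <- r) a p.1 p.2 * G p := rE K^o G.
have -> : q.[0] = e.[offset K eps] by rewrite /q horner_pshift add0r e_even.
have -> : c = \sum_(p <- r) a p.1 p.2 * (p.2 == 0%N)%:R by rewrite -S central_sum.
rewrite (S (fun p => (pshift p.1 q)`_p.2)).
rewrite (S (fun p => (p.2 == 0%N)%:R * e.[offset K eps] - (pshift p.1 q)`_p.2)).
move=> H; under [RHS]eq_bigr do rewrite mulrBr mulrA.
move: H; rewrite sumrB -mulr_suml => <-; ring.
Qed.

End WeightFormula.

(** * Comparison of the highest weights *)

Section RepresentativeWeights.
Variable R : realType.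
Local Notation C := R[i].
Variables (eps : dsign) (a : C -> nat -> C).
Hypothesis a_fin : finite_set [set p : C * nat | a p.1 p.2 != 0].
Hypothesis a_norm : forall s, in_supp a s -> normalized eps s.
Variables (n : nat) (s : 'I_n -> C).
Hypothesis s_rep : representatives eps a s.

Lemma rep_compatible i : compatible (s i) eps (rep_type eps (s i)).
Proof.
apply: compatibleP; case: (repP s_rep i) => [_ _ _|s0|sh]; first by constructor 1.
  by case: (eps); [constructor 2 | constructor 3]; split=> //; left.
move: sh; rewrite /half_rep; case: (eps) => sh; [constructor 2 | constructor 3];
  by split=> //; right.
Qed.

Lemma rep_sub i l (c : int) : i != l -> s i - s l != c%:~R.
Proof.
case: s_rep => _ _ inj; apply: contraNneq => e; apply/eqP/inj.
by exists c; left; rewrite -e addrC subrK.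
Qed.

Lemma rep_add i l (c : int) : i != l -> s i + s l != c%:~R.
Proof.
case: s_rep => _ _ inj; apply: contraNneq => e; apply/eqP/inj.
by exists c; right; rewrite -e addrC addrK.
Qed.

Lemma rep_double i (c : int) : rep_type eps (s i) = gl_infty -> s i *+ 2 != c%:~R.
Proof.
case: (repP s_rep i) => [sI sH _ _|_|_]; [|by case: (eps)..].
apply/eqP => sc; have [k [ck|ck]] : exists k : int, c = k + k \/ c = k + k + 1.
  exists (divz c 2); have := divz_eq c 2; have := modz_ge0 c (isT : 2%:Z != 0).
  have := ltz_pmod c (isT : 0 < 2%:Z); lia.
- apply: sI; exists k; transitivity (s i *+ 2 / 2); first by field.
  by rewrite sc ck intrD; field.
apply: sH; exists k; transitivity (s i *+ 2 / 2); first by field.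
by rewrite sc ck !intrD; field.
Qed.

(** For the special representatives the argument of [e] at s is 0 or -1/2. Odd Taylor coefficients
    of an even polynomial vanish at 0 and are opposite at 1/2 and -1/2, which is what
    [LambdaS_half_diff] requires. *)
Lemma LambdaS_diff i m e : (forall z, e.[- z] = e.[z]) ->
  let q := pshift (- offset C eps) e in
  LambdaS eps a (s i) (phihat m (s i) (Dhat_poly (pshift 1 q - q))) =
  \sum_(j < m.+1) \sum_(k \in index_dom (rep_type eps (s i)))
    a (s i - k%:~R) j * ((j == 0%N :> nat)%:R * q.[0] - (pshift (s i - k%:~R) q)`_j).
Proof.
move=> e_even q; rewrite LambdaSE.
have sE z j : (pshift z q)`_j = (pshift (z - offset C eps) e)`_j by rewrite /q pshiftD.
have odd_coef z j : odd j -> (pshift (- z) e)`_j = - (pshift z e)`_j.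
  by move=> oj; rewrite even_coef // -signr_odd oj mulN1r.
have odd0 j : odd j -> (pshift 0 e)`_j = 0.
  move=> oj; have /eqP := odd_coef 0 j oj.
  by rewrite oppr0 -addr_eq0 -mulr2n -mulr_natr mulf_eq0 pnatr_eq0 orbF => /eqP.
have half_sum j : odd j -> (pshift (- 2^-1) e)`_j +
    ((pshift 2^-1 e)`_j - (pshift (- 2^-1) e)`_j) / 2 = 0.
  by move=> oj; rewrite odd_coef //; field.
have h1 : - 2^-1 + 1 = 2^-1 :> C by field.
case: (repP s_rep i) => [_ _ _|s0|sh]; first exact: LambdaS_gl_diff.
  have H j : odd j -> (pshift (s i) q)`_j +
      (if has00 (match eps with Dminus => b_infty | Dplus => d_infty end) then
        ((pshift (s i + 1) q)`_j - (pshift (s i) q)`_j) / 2 else 0) = 0.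
    move=> oj; rewrite !sE s0 sub0r add0r /offset.
    case: (eps) => /=; last by rewrite oppr0 odd0 // addr0.
    by rewrite (_ : 1 - 2^-1 = 2^-1) ?half_sum //; field.
  by move: (LambdaS_half_diff a_fin m H); case: (eps).
have H j : odd j -> (pshift (s i) q)`_j +
    (if has00 (match eps with Dminus => c_infty | Dplus => bt_infty end) then
      ((pshift (s i + 1) q)`_j - (pshift (s i) q)`_j) / 2 else 0) = 0.
  move=> oj; rewrite !sE sh /half_rep /offset.
  case: (eps) => /=; first by rewrite subrr odd0 // addr0.
  by rewrite !subr0 h1 half_sum.
by move: (LambdaS_half_diff a_fin m H); case: (eps).
Qed.

Section Weight.
Variables (c : C) (F : fps C).
Hypothesis F0 : F 0%N = 0.
Hypothesis hF : F + c *: (match eps with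
                    | Dminus => cosh_half C
                    | Dplus => fps1 C
                    end)
          = \sum_(p \in [set: C * nat])
              a p.1 p.2 *: eta_series p.2 (match eps with
                                    | Dminus => p.1 - 2^-1
                                    | Dplus => p.1
                                    end).

Lemma central_charge : c = \sum_(i < n)
  LambdaS eps a (s i) (phihat (mS a (s i)) (s i) (Dhat_C C)).
Proof.
rewrite (central_sum a_fin F0 hF).
rewrite (class_sum a_fin a_norm s_rep (fun _ j => (j == 0%N)%:R)).
apply: eq_bigr => i _; rewrite LambdaS_C big_ord_recl /=.
rewrite [X in _ + X]big1 ?addr0 => [|j _]; last first.
  by rewrite fsbig1 // => k _; rewrite mulr0.
by apply: eq_fsbigr => k _; rewrite mulr1.
Qed.

Variables (V : lmodType C) (rho : Dhat_lie C eps -> V -> V) (v0 : V).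
Variable xi : Dhat_lie C eps -> C.
Hypothesis rhoP : is_module rho.
Hypothesis v0P : highest_weight_vector rho v0 xi.
Hypothesis xi_c : xi (Dhat_C C) = c.
Hypothesis hDelta : fps_mul (Delta eps xi) (two_sinh_half C) = F.

Variables (L : 'I_n -> lmodType C)
    (rhoL : forall i, infty_lie C (mS a (s i)) (rep_type eps (s i)) -> L i -> L i)
    (w0 : forall i, L i).
Hypothesis irrL : forall i, irreducible_hw_module (@rhoL i) (w0 i)
                        (@LambdaS R eps a (s i) (mS a (s i))).

(** In degree 0 an element is a multiple of C plus a difference. [central_charge] treats C; for the
    difference, [weight_difference] regrouped by [class_sum] agrees with [LambdaS_diff] class by
    class. *)
Lemma weightE (x : Dhat_lie C eps) : lie_homog 0 x ->
  xi x = \sum_i LambdaS eps a (s i) (phihat (mS a (s i)) (s i) x).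
Proof.
move=> x0; have [x_tw xE] := Dhat_homog0E x0.
rewrite (weight_homog0 rhoP v0P x0) xi_c central_charge mulr_sumr.
have [e e_even eE] := twisted0_difference x_tw.
rewrite {1}eE comp_base_shift (weight_difference a_fin F0 hF rhoP v0P hDelta e_even).
rewrite (class_sum a_fin a_norm s_rep (fun z j => (j == 0%N)%:R *
   (pshift (- offset C eps) e).[0] - (pshift z (pshift (- offset C eps) e))`_j)).
rewrite -big_split; apply: eq_bigr => i _ /=.
rewrite -LambdaS_diff // -comp_base_shift -eE.
have homogE (y : Dhat_lie C eps) : lie_homog 0 y -> @lie_homog _ (infty_lie C _ (rep_type eps (s i))) 0
    (phihat (mS a (s i)) (s i) y) :=
  @phihat_homog C (mS a (s i)) (s i) eps _ 0 y (rep_compatible i).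
have [rP _ wP] := irrL i.
rewrite -(weight_lin rP wP); first 1 last.
- exact/homogE/Dhat_C_homog0.
- exact/homogE/Dhat_poly_homog0.
- by rewrite -phihat_linear -xE; apply: homogE.
by rewrite -phihat_linear -xE.
Qed.

End Weight.

End RepresentativeWeights.

Unset Implicit Arguments.

Theorem theorem6p2 (R : realType) (eps : dsign)
    (V : lmodType R[i]) (rho : Dhat_lie R[i] eps -> V -> V)
    (v0 : V) (xi : Dhat_lie R[i] eps -> R[i])
    (irrV : irreducible_hw_module rho v0 xi)
    (qfV : quasifinite rho v0)
    (c : R[i]) (hc : c = xi (Dhat_C R[i]))
    (F : fps R[i])
    (F_quasi : quasipolynomial F) (F_even : fps_even F) (F0 : F 0%N = 0)
    (hDelta : fps_mul (Delta eps xi) (two_sinh_half R[i]) = F)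
    (a : R[i] -> nat -> R[i])
    (a_fin : finite_set [set p : R[i] * nat | a p.1 p.2 != 0])
    (a_norm : forall s, in_supp a s -> normalized eps s)
    (hF : F + c *: (match eps with
                    | Dminus => cosh_half R[i]
                    | Dplus => fps1 R[i]
                    end)
          = \sum_(p \in [set: R[i] * nat])
              a p.1 p.2 *: eta_series p.2 (match eps with
                                    | Dminus => p.1 - 2^-1
                                    | Dplus => p.1
                                    end))
    (n : nat) (s : 'I_n -> R[i]) (s_rep : representatives eps a s)
    (L : 'I_n -> lmodType R[i])
    (rhoL : forall i, infty_lie R[i] (mS a (s i)) (rep_type eps (s i)) ->
                      L i -> L i)
    (w0 : forall i, L i)
    (irrL : forall i, irreducible_hw_module (rhoL i) (w0 i)
                        (@LambdaS R eps a (s i) (mS a (s i)))) :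
  exists (T : lmodType R[i]) (rhoT : Dhat_lie R[i] eps -> T -> T)
         (tau : (forall i, L i) -> T),
    is_tensor_module
      (fun i (x : Dhat_lie R[i] eps) => rhoL i (phihat (mS a (s i)) (s i) x))
      rhoT tau
    /\ module_iso rho rhoT.
Proof.
have [rhoP _ v0P] := irrV; have xi_c := esym hc.
have Lam_fin i : exists N, forall X : infty_lie R[i] (mS a (s i)) (rep_type eps (s i)),
    lie_homog 0 X -> vanishes N X -> LambdaS eps a (s i) X = 0.
  by have [N NP] := LambdaS_finite eps a_fin (s i) (mS a (s i)); exists N => X _; apply: NP.
have comp i := rep_compatible s_rep i.
have phi_homog i k x := @phihat_homog _ (mS a (s i)) (s i) eps _ k x (comp i).
have phi_br i (x y : Dhat_lie R[i] eps) : lie_mem x -> lie_mem y ->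
    phihat (mS a (s i)) (s i) (lie_br x y) =
    glhat_br (phihat (mS a (s i)) (s i) x) (phihat (mS a (s i)) (s i) y).
  by move=> [xf _] _; apply: phihat_br.
have [T [rhoT [tau [tauP irrT]]]] := @irreducible_tensor_exists _ _ _
  (Dhat_graded R[i] eps) n _ _ (fun i => glhat_graded _ (mS a (s i)) (rep_type eps (s i)))
  L rhoL w0 _ irrL (fun i => phihat (mS a (s i)) (s i)) phi_homog
  (fun i a x y _ _ => phihat_linear _ _ a x y) phi_br
  (phihat_dense comp (rep_sub s_rep) (rep_add s_rep) (rep_double s_rep) irrL Lam_fin)
  xi (weightE a_fin a_norm s_rep F0 hF rhoP v0P xi_c hDelta irrL).
exists T, rhoT, tau; split=> //.
(* Both modules are irreducible with highest weight [xi]. *)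
exact: (highest_weight_iso (Dhat_graded R[i] eps) irrV irrT).
Qed.
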